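(* Consider an ROS system with two bidders (and any finite number of items) in the smooth limit, with dynamics $\frac{dm_i}{dt}=U_i(m)$, $i=1,2$. If $m_0\in(1,\infty)^2$ and the forward orbit of the solution with $m(0)=m_0$ is bounded, then $m(t)$ converges, as $t\to\infty$, to an equilibrium, i.e., to a point $m^*$ with $U_1(m^* )=U_2(m^* )=0$.
   Context: ROS system: $n$ bidders (here $n=2$), $k$ items; bidder $i$ uses multiplier $m_i$ and bids $b_{ij}=m_iv_{ij}$ on item $j$. Each item is sold by a second-price auction with uniform random tie-breaking: the highest bid wins (ties split uniformly), allocation $x_{ij}\in[0,1]$ is the winning probability and payment $p_{ij}=x_{ij}\max_{s\ne i}b_{sj}$. Smooth limit: the valuation vector $v=(v_{ij})$ is random with a positive $C^1$ density on a box $[0,M]^{nk}$ and $U_i(m)=\mathbb E[\sum_j v_{ij}x_{ij}(m)-p_{ij}(m)]$, a $C^1$ function of $m$. *)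

(* Defs.v *)
From HB Require Import structures.
From mathcomp Require Import all_boot all_order all_algebra.
From mathcomp Require Import all_classical all_reals all_analysis.
Set Implicit Arguments. Unset Strict Implicit. Unset Printing Implicit Defensive.
Import Order.TTheory GRing.Theory Num.Theory.
Import numFieldNormedType.Exports.
Local Open Scope classical_set_scope.
Local Open Scope ring_scope.

Section ROS.
Variable R : realType.

(* Valuation profiles / bid profiles: 2 x k real matrices, entry (i,j) = bidder i, item j. *)
Definition other (i : 'I_2) : 'I_2 := if i == ord0 then ord_max else ord0.

Definition bid k (m : 'rV[R]_2) (v : 'M[R]_(2, k)) (i : 'I_2) (j : 'I_k) : R :=
  m ord0 i * v i j.

(* second-price auction per item with uniform random tie-breaking (two bidders):
   winning probability *)
Definition alloc k (m : 'rV[R]_2) (v : 'M[R]_(2, k)) (i : 'I_2) (j : 'I_k) : R :=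
  if bid m v (other i) j < bid m v i j then 1
  else if bid m v i j == bid m v (other i) j then 2^-1 else 0.

Definition pay k (m : 'rV[R]_2) (v : 'M[R]_(2, k)) (i : 'I_2) (j : 'I_k) : R :=
  alloc m v i j * bid m v (other i) j.

Definition utility k (m : 'rV[R]_2) (v : 'M[R]_(2, k)) (i : 'I_2) : R :=
  \sum_(j < k) (v i j * alloc m v i j - pay m v i j).

Definition setentry k (v : 'M[R]_(2, k)) (p : 'I_2 * 'I_k) (x : R) : 'M[R]_(2, k) :=
  \matrix_(i, j) if (i, j) == p then x else v i j.

Fixpoint iterint k (M : R) (ps : seq ('I_2 * 'I_k)) (F : 'M[R]_(2, k) -> R)
  (v : 'M[R]_(2, k)) : R :=
  match ps with
  | [::] => F v
  | p :: ps' =>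
      Rintegral lebesgue_measure `[0, M]
        (fun x : R => iterint M ps' F (setentry v p x))
  end.

(* integral of F over the box [0,M]^{2k} w.r.t. Lebesgue measure on R^{2k} *)
Definition boxint k (M : R) (F : 'M[R]_(2, k) -> R) : R :=
  iterint M (enum [set: 'I_2 * 'I_k]%SET) F 0.

(* f is a positive C^1 probability density on the box [0,M]^{2k}
   (f is (the restriction of) a C^1 function on R^{2k}: all partial
   derivatives exist everywhere and are continuous) *)
Definition C1 k (f : 'M[R]_(2, k) -> R) : Prop :=
  continuous f /\
  forall (i : 'I_2) (j : 'I_k),
    (forall v, derivable f v (delta_mx i j)) /\
    continuous (fun v => 'D_(delta_mx i j) f v).

Definition in_box k (M : R) (v : 'M[R]_(2, k)) : Prop :=
  forall i j, 0 <= v i j <= M.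

Definition pos_C1_density k (M : R) (f : 'M[R]_(2, k) -> R) : Prop :=
  0 < M /\ C1 f /\ (forall v, in_box M v -> 0 < f v) /\
  boxint M f = 1.

Definition U k (M : R) (f : 'M[R]_(2, k) -> R) (m : 'rV[R]_2) (i : 'I_2) : R :=
  boxint M (fun v => utility m v i * f v).

Definition Uvec k (M : R) (f : 'M[R]_(2, k) -> R) (m : 'rV[R]_2) : 'rV[R]_2 :=
  \row_i U M f m i.

End ROS.

(* Main.v *)
(** With x = m_1, y = m_2 and r = y / x one has U_1 = A(r) - y B(r) and
    U_2 = C(r) - x D(r), where A + D and B + C are constant and, as Stieltjes
    differentials, dA = r dB; B is locally Lipschitz and strictly decreasing.
    The square (1, oo)^2 is invariant because A > r B and D < r C.  In the
    coordinates (r, x) the system reads r' = N / x with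
    N = U_2 - r U_1 = n(r) + x q(r) affine in x, and x' = A - r B x; if r
    converges, so does x, and the limit is an equilibrium.

    Suppose that r oscillates between r1 < r2.  Every line r = z in between is
    crossed in both directions, which forces q to have constant sign there.  The
    function H = x n + x^2 q / 2 satisfies dH = w dB along orbits, where
    w = x^2 r (r + 1) / 2 - x (1 + r^2) is increasing in x on the invariant
    square (this is the negative divergence of the field).  Subtracting
    from H a function of r whose differential is w dB along the zero set of N
    gives a Lyapunov function, up to the sign of q.  Hence N tends to 0 on every
    compact part of the strip, so the two nullclines coincide there and x follows
    their common graph phi = A / (r B), with phi' = - A / q.  Differentiating
    n + phi q = 0 then shows that dB = 0 on the strip, contradicting the strict
    monotonicity of B.  *)

Require Import Defs.
From HB Require Import structures.
From mathcomp Require Import all_boot all_order all_algebra.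
From mathcomp Require Import all_classical all_reals all_analysis.
From mathcomp Require Import measurable_realfun.
From mathcomp Require Import ring lra.
Import Order.TTheory GRing.Theory Num.Theory.
Import numFieldNormedType.Exports.
Local Open Scope classical_set_scope.
Local Open Scope ring_scope.

Set Implicit Arguments.
Unset Strict Implicit.
Unset Printing Implicit Defensive.

(** * Derivatives and continuity on the line *)

(** The obstacle is regularity: of [B] only monotonicity and a Lipschitz bound are established, so
    neither a Jacobian nor a divergence is at hand. Two devices replace the derivative of [B].
    First, dA = r dB is used with r frozen: [A - r * B] has derivative zero at r. Every differential
    is computed after expressing [A], [C], [D] through this function, [B] and constants, and after
    subtracting from the coefficient of [B] its value at the base point; the remaining product has
    one factor that vanishes there, and continuity of [B] is enough. Second, integrals against dB
    are ordinary integrals in the variable v = B(r).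

    The sign of q is forced as follows. On a line r = z with q = 0 the drift N is the constant n: if
    n is nonzero, nearby lines cannot be crossed both ways, and if n = 0 the line is invariant and
    cannot be crossed at all.

    The Lyapunov function must decrease at all late times, although r may overshoot the interval
    from r1 to r2 slightly. Hence the strip is enlarged wherever q keeps its sign, and the zero of
    N, which may leave the range of x out there, is clamped to that range. *)

Section Calculus.
Variable R : realType.
Implicit Types (f g : R -> R) (a b c d e s t u v l r K M : R).

Definition cont_at f t :=
  forall e, 0 < e -> exists2 d, 0 < d & forall s, `|s - t| < d -> `|f s - f t| < e.

(** Free of quotients, so that [s = t] needs no exclusion and error terms simply add up. *)
Definition deriv_at f t l :=
  forall e, 0 < e -> exists2 d, 0 < d &
    forall s, `|s - t| < d -> `|f s - f t - l * (s - t)| <= e * `|s - t|.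

Lemma cont_atP f t : cont_at f t <-> {for t, continuous f}.
Proof.
split=> [ft|/cvgrPdist_lt ft].
  apply/cvgrPdist_lt => e e0; have [d d0 H] := ft _ e0.
  by exists d => // s /=; rewrite distrC => /H; rewrite distrC.
move=> e e0; have [d /= d0 H] := ft _ e0.
by exists d => // s; rewrite distrC => /H; rewrite distrC.
Qed.

Lemma deriv_atP f t l : is_derive t 1 f l <-> deriv_at f t l.
Proof.
split=> [[df <-] e e0|H].
  move: df => /cvg_ex[/= k Hk]; have kE : 'D_1 f t = k by exact/cvg_lim.
  move/cvgrPdist_le : Hk => /(_ _ e0)[d /= d0 Hd]; exists d => // s sd.
  have [->|st] := eqVneq s t; first by rewrite !subrr mulr0 subr0 !normr0 mulr0.
  have st0 : s - t != 0 by rewrite subr_eq0.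
  have := Hd (s - t); rewrite /= sub0r normrN => /(_ sd st0).
  rewrite /GRing.scale/= mulr1 subrK kE => Hs.
  have -> : f s - f t - k * (s - t) = - ((k - (s - t)^-1 * (f s - f t)) * (s - t)).
    by rewrite mulrBl mulrAC mulVf// mul1r opprB.
  by rewrite normrN normrM ler_wpM2r.
have Hl : h^-1 *: (f (h *: (1 : R) + t) - f t) @[h --> (0 : R)^'] --> l.
  apply/cvgrPdist_le => e e0; have [d d0 Hd] := H _ e0.
  exists d => //= h; rewrite /= sub0r normrN => hd h0.
  have := Hd (h + t); rewrite addrK => /(_ hd) {}Hd.
  rewrite /GRing.scale/= mulr1.
  rewrite -(ler_pM2r (_ : 0 < `|h|)) ?normr_gt0// -normrM mulrBl mulrAC mulVf// mul1r.
  by rewrite distrC.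
by split; [apply/cvg_ex; exists l | exact/cvg_lim].
Qed.

Lemma deriv_at_eq f t l k : deriv_at f t l -> l = k -> deriv_at f t k.
Proof. by move=> ? <-. Qed.

Lemma deriv_at_cst a t : deriv_at (fun=> a) t 0.
Proof. by apply/deriv_atP; exact: is_derive_cst. Qed.

Lemma deriv_at_id t : deriv_at id t 1.
Proof. by apply/deriv_atP; exact: is_derive_id. Qed.

Lemma deriv_atD f g t l k : deriv_at f t l -> deriv_at g t k ->
  deriv_at (fun s => f s + g s) t (l + k).
Proof. by move=> /deriv_atP ? /deriv_atP ?; apply/deriv_atP; exact: is_deriveD. Qed.

Lemma deriv_atN f t l : deriv_at f t l -> deriv_at (fun s => - f s) t (- l).
Proof. by move=> /deriv_atP ?; apply/deriv_atP; exact: is_deriveN. Qed.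

Lemma deriv_atB f g t l k : deriv_at f t l -> deriv_at g t k ->
  deriv_at (fun s => f s - g s) t (l - k).
Proof. by move=> ? /deriv_atN; exact: deriv_atD. Qed.

Lemma deriv_atM f g t l k : deriv_at f t l -> deriv_at g t k ->
  deriv_at (fun s => f s * g s) t (f t * k + g t * l).
Proof. by move=> /deriv_atP ? /deriv_atP ?; apply/deriv_atP; exact: is_deriveM. Qed.

Lemma deriv_at_comp f g t l k : deriv_at f t l -> deriv_at g (f t) k ->
  deriv_at (fun s => g (f s)) t (k * l).
Proof.
by move=> /deriv_atP fl /deriv_atP gk; apply/deriv_atP.
Qed.

Lemma deriv_atV f t l : f t != 0 -> deriv_at f t l ->
  deriv_at (fun s => (f s)^-1) t (- l / f t ^+ 2).
Proof.
move=> ft0 /deriv_atP fl; apply/deriv_atP.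
have [dV vV] := is_deriveV ft0 fl; split => //.
by rewrite vV /GRing.scale/= mulrC mulrN mulNr.
Qed.

Lemma deriv_at_cont f t l : deriv_at f t l -> cont_at f t.
Proof.
move=> /deriv_atP[df _]; apply/cont_atP.
by apply: differentiable_continuous; exact/derivable1_diffP.
Qed.

Lemma deriv_at_mvt f (df : R -> R) a b : a < b ->
  (forall t, a <= t <= b -> deriv_at f t (df t)) ->
  exists2 c, a < c < b & f b - f a = df c * (b - a).
Proof.
move=> ab Hf.
have [t||c] := @MVT _ f df a b ab.
- rewrite in_itv/= => /andP[/ltW at_ /ltW tb].
  by apply/deriv_atP/Hf; rewrite at_.
- apply: derivable_within_continuous => t; rewrite in_itv/= => tab.
  by have /deriv_atP[] := Hf _ tab.
- by rewrite in_itv/= => cab E; exists c.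
Qed.

Lemma cont_atD f g t : cont_at f t -> cont_at g t -> cont_at (fun s => f s + g s) t.
Proof. by move=> /cont_atP ? /cont_atP ?; apply/cont_atP; exact: continuousD. Qed.

Lemma cont_atN f t : cont_at f t -> cont_at (fun s => - f s) t.
Proof. by move=> /cont_atP ?; apply/cont_atP; exact: continuousN. Qed.

Lemma cont_atM f g t : cont_at f t -> cont_at g t -> cont_at (fun s => f s * g s) t.
Proof. by move=> /cont_atP ? /cont_atP ?; apply/cont_atP; exact: continuousM. Qed.

Lemma cont_atV f t : f t != 0 -> cont_at f t -> cont_at (fun s => (f s)^-1) t.
Proof. by move=> ? /cont_atP ?; apply/cont_atP; exact: continuousV. Qed.

Lemma cont_at_cst a t : cont_at (fun=> a) t.
Proof. by move=> e e0; exists 1 => // s _; rewrite subrr normr0. Qed.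

Lemma cont_at_id t : cont_at id t.
Proof. by move=> e e0; exists e. Qed.

Lemma cont_at_max f g t : cont_at f t -> cont_at g t ->
  cont_at (fun s => Num.max (f s) (g s)) t.
Proof. by move=> /cont_atP ? /cont_atP ?; apply/cont_atP; exact: continuous_max. Qed.

Lemma cont_at_min f g t : cont_at f t -> cont_at g t ->
  cont_at (fun s => Num.min (f s) (g s)) t.
Proof. by move=> /cont_atP ? /cont_atP ?; apply/cont_atP; exact: continuous_min. Qed.

Lemma cont_at_comp f g t : cont_at f t -> cont_at g (f t) ->
  cont_at (fun s => g (f s)) t.
Proof.
by move=> Hf Hg e /Hg[d /Hf[d' d'0 H'] H]; exists d' => // s /H' /H.
Qed.

Lemma cont_at_norm f t : cont_at f t -> cont_at (fun s => `|f s|) t.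
Proof.
move=> cf e /cf[d d0 H]; exists d => // s /H.
exact: le_lt_trans (ler_dist_dist _ _).
Qed.

Lemma cont_at_within f a b : (forall t, a <= t <= b -> cont_at f t) ->
  {within `[a, b], continuous f}.
Proof.
move=> H; apply: continuous_in_subspaceT => t; rewrite inE/= in_itv/= => /H.
by move/cont_atP.
Qed.

(* A one-sided Dini condition suffices for monotonicity, so that the Lyapunov
   function below need not be differentiable. *)
Lemma dini_nonincreasing f a b : a <= b ->
  (forall t, a <= t <= b -> cont_at f t) ->
  (forall t, a <= t < b -> forall e, 0 < e -> exists2 d, 0 < d &
     forall s, t < s < t + d -> f s - f t <= e * (s - t)) ->
  f b <= f a.
Proof.
move=> ab cf Hf.
suff H e : 0 < e -> f b - f a <= e * (b - a).
  rewrite -subr_le0; apply/ler_addgt0Pl => e e0; rewrite addr0.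
  have [ba|ba] := leP (b - a) 0.
    have -> : b = a by apply/le_anti; lra.
    by rewrite subrr ltW.
  have := H (e / (b - a)); rewrite divr_gt0// divfK ?gt_eqF//; exact.
move=> e0.
(* With slope [e] to spare, the times up to which the linear bound holds form a set closed under
   suprema by continuity and extendable to the right by the Dini condition; its supremum can only be
   [b]. *)
pose S := [set t | a <= t <= b /\ forall s, a <= s <= t -> f s - f a <= e * (s - a)].
have Sa : S a.
  split; first by rewrite lexx.
  move=> s sa; have -> : s = a by apply/le_anti; rewrite andbC.
  by rewrite !subrr mulr0.
have hS : has_sup S by split; [exists a | exists b => t [/andP[]]].
pose c := sup S.
have ac : a <= c by exact: ub_le_sup hS.2 _ Sa.
have cb : c <= b by apply: ge_sup; [exists a | move=> t [/andP[]]].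
have below s : a <= s < c -> f s - f a <= e * (s - a).
  move=> /andP[as_ sc].
  have cs0 : 0 < c - s by rewrite subr_gt0.
  have [t [tab Ht] st] := sup_adherent cs0 hS.
  by apply: Ht; rewrite as_ /=; move: st; rewrite -/c; lra.
have atc : f c - f a <= e * (c - a).
  rewrite leNgt; apply/negP => gap.
  have ac' : a < c by rewrite lt_neqAle ac andbT; apply/eqP => E; move: gap; rewrite -E !subrr mulr0 ltxx.
  have gap0 : 0 < f c - f a - e * (c - a) by rewrite subr_gt0.
  have [d d0 Hd] := cf c (introT andP (conj ac cb)) _ gap0.
  pose s := Num.max a (c - d / 2).
  have as_ : a <= s by rewrite le_max lexx.
  have sc : s < c by rewrite gt_max ac'/=; lra.
  have cs : c - d / 2 <= s by rewrite le_max lexx orbT.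
  have := below s (introT andP (conj as_ sc)).
  have : `|s - c| < d by rewrite ler0_norm; lra.
  move=> /Hd; rewrite ltr_norml => /andP[+ _].
  have : e * (s - a) <= e * (c - a) by rewrite ler_pM2l//; lra.
  lra.
have upto s : a <= s <= c -> f s - f a <= e * (s - a).
  move=> /andP[as_]; rewrite le_eqVlt => /predU1P[->//|sc].
  by apply: below; rewrite as_.
have [<-//|cb'] := eqVneq c b.
have {}cb' : c < b by rewrite lt_neqAle cb'.
have [d d0 Hd] := Hf c (introT andP (conj ac cb')) _ e0.
pose s1 := Num.min b (c + d / 2).
have cs1 : c < s1 by rewrite lt_min cb'/=; lra.
have s1b : s1 <= b by rewrite ge_min lexx.
have s1d : s1 <= c + d / 2 by rewrite ge_min lexx orbT.
suff /(ub_le_sup hS.2) : S s1 by rewrite leNgt cs1.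
split=> [|s /andP[as_ ss1]]; first by rewrite s1b andbT (le_trans ac)// ltW.
have [sc|cs] := leP s c; first by apply: upto; rewrite as_.
have := Hd s; rewrite cs/= => /(_ _); have -> : s < c + d by lra.
move=> /(_ isT) H1; have -> : e * (s - a) = e * (s - c) + e * (c - a) by ring.
lra.
Qed.

(** The extracted passage stays between the two levels, so that later arguments need information
    only on the strip between them. *)
Lemma crossing_up f a b u v : a <= b -> u < v ->
  (forall t, a <= t <= b -> cont_at f t) -> f a <= u -> v <= f b ->
  exists s t, [/\ a <= s, s < t <= b, f s = u, f t = v &
    forall z, s <= z <= t -> u <= f z <= v].
Proof.
move=> ab uv cf fa fb.
have ivt c d w : a <= c -> c <= d -> d <= b -> f c <= w -> w <= f d ->
    exists2 z, c <= z <= d & f z = w.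
  move=> ac cd db fc fd; have [||z] := @IVT _ f c d w cd.
  - apply: cont_at_within => t /andP[ct td]; apply: cf; lra.
  - by rewrite ge_min fc le_max fd orbT.
  - by rewrite in_itv/= => zcd E; exists z.
(* the last time at level u, then the first later time at level v *)
pose S := [set t | a <= t <= b /\ f t <= u].
have Sa : S a by split; rewrite ?lexx.
have hS : has_sup S by split; [exists a | exists b => t [/andP[]]].
pose s := sup S.
have as_ : a <= s by exact: ub_le_sup hS.2 _ Sa.
have sb : s <= b by apply: ge_sup; [exists a | move=> t [/andP[]]].
have after t : s < t -> t <= b -> u < f t.
  move=> st tb; rewrite ltNge; apply/negP => ft.
  suff /(ub_le_sup hS.2) : S t by rewrite leNgt st.
  by split=> //; rewrite tb andbT (le_trans as_)// ltW.
have fs : f s = u.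
  apply/le_anti/andP; split.
    rewrite leNgt; apply/negP => gap.
    have gap0 : 0 < f s - u by rewrite subr_gt0.
    have [d d0 Hd] := cf s (introT andP (conj as_ sb)) _ gap0.
    have [t [tab ft] st] := sup_adherent d0 hS.
    have ts : t <= s by apply: ub_le_sup hS.2 _ _.
    have : `|t - s| < d by rewrite ler0_norm; move: st; rewrite -/s; lra.
    by move=> /Hd; rewrite ltr_norml => /andP[+ _]; lra.
  have [E|sb'] := eqVneq s b; first by rewrite E; lra.
  rewrite leNgt; apply/negP => gap.
  have [z /andP[sz zb] fz] := ivt s b u as_ sb (lexx b) (ltW gap) (le_trans (ltW uv) fb).
  have [E|zs] := eqVneq z s; first by rewrite -E fz ltxx in gap.
  have := after z; rewrite fz ltxx => H; apply: notF; apply: H => //.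
  by rewrite lt_neqAle eq_sym zs.
pose V := [set t | s <= t <= b /\ v <= f t].
have Vb : V b by split; rewrite ?lexx ?sb.
have hV : has_inf V by split; [exists b | exists s => t [/andP[]]].
pose t := inf V.
have tb : t <= b by exact: ge_inf hV.2 _ Vb.
have st : s <= t by apply: lb_le_inf; [exists b | move=> z [/andP[]]].
have before z : s <= z -> z < t -> f z < v.
  move=> sz zt; rewrite ltNge; apply/negP => fz.
  suff /(ge_inf hV.2) : V z by rewrite leNgt zt.
  by split=> //; rewrite sz (le_trans (ltW zt)).
have ft : f t = v.
  apply/le_anti/andP; split; last first.
    rewrite leNgt; apply/negP => gap.
    have atb : a <= t <= b by rewrite tb (le_trans as_).
    have gap0 : 0 < v - f t by rewrite subr_gt0.
    have [d d0 Hd] := cf t atb _ gap0.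
    have [z [zab fz] tz] := inf_adherent d0 hV.
    have zt : t <= z by apply: ge_inf hV.2 _ _.
    have : `|z - t| < d by rewrite ger0_norm; move: tz; rewrite -/t; lra.
    by move=> /Hd; rewrite ltr_norml => /andP[_ +]; lra.
  rewrite leNgt; apply/negP => gap.
  have fsv : f s <= v by rewrite fs ltW.
  have [z /andP[sz zt] fz] := ivt s t v as_ st tb fsv (ltW gap).
  have [E|zt'] := eqVneq z t; first by rewrite -E fz ltxx in gap.
  have := before z sz; rewrite fz ltxx => H; apply: notF; apply: H => //.
  by rewrite lt_neqAle zt'.
have st' : s < t.
  by rewrite lt_neqAle st andbT; apply/eqP => E; move: ft; rewrite -E fs; lra.
exists s, t; split=> //; [by rewrite st' tb|move=> z /andP[sz zt]; apply/andP; split].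
  move: sz; rewrite le_eqVlt => /predU1P[<-|sz]; first by rewrite fs.
  by apply/ltW/after => //; exact: le_trans tb.
move: zt; rewrite le_eqVlt => /predU1P[->|zt]; first by rewrite ft.
by apply/ltW/before.
Qed.

Lemma crossing_down f a b u v : a <= b -> u < v ->
  (forall t, a <= t <= b -> cont_at f t) -> v <= f a -> f b <= u ->
  exists s t, [/\ a <= s, s < t <= b, f s = v, f t = u &
    forall z, s <= z <= t -> u <= f z <= v].
Proof.
move=> ab uv cf fa fb.
have [|||||s [t [as_ st fs ft Hz]]] := @crossing_up (fun z => - f z) a b (- v) (- u).
- by [].
- by rewrite ltrN2.
- by move=> t /cf /cont_atN.
- by rewrite lerN2.
- by rewrite lerN2.
exists s, t; split=> //; [exact: oppr_inj|exact: oppr_inj|].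
by move=> z /Hz; rewrite !lerN2 andbC.
Qed.

(** The lower limit is the supremum of the eventual lower bounds, the upper limit the infimum of the
    eventual upper bounds. *)
Lemma liminf_limsup f a c d : (forall t, a <= t -> c <= f t <= d) ->
  exists l u, [/\ c <= l, l <= u <= d,
    forall e, 0 < e -> exists2 T, a <= T & forall t, T <= t -> l - e < f t < u + e,
    forall e T, 0 < e -> exists2 t, T <= t & f t < l + e &
    forall e T, 0 < e -> exists2 t, T <= t & u - e < f t].
Proof.
move=> Hf.
pose L := [set z | exists2 T, a <= T & forall t, T <= t -> z <= f t].
pose U := [set z | exists2 T, a <= T & forall t, T <= t -> f t <= z].
have Lc : L c by exists a => // t /Hf /andP[].
have Ud : U d by exists a => // t /Hf /andP[].
have LU z w : L z -> U w -> z <= w.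
  move=> [T _ HT] [T' _ HT']; apply: (le_trans (HT (Num.max T T') _) (HT' _ _));
  by rewrite le_max lexx ?orbT.
have hL : has_sup L by split; [exists c | exists d => z Lz; exact: LU Lz Ud].
have hU : has_inf U by split; [exists d | exists c => z Uz; exact: LU Lc Uz].
exists (sup L), (inf U); split.
- exact: ub_le_sup hL.2 _ Lc.
- apply/andP; split; last exact: ge_inf hU.2 _ Ud.
  apply: ge_sup; first by exists c.
  by move=> z Lz; apply: lb_le_inf; [exists d | move=> w Uw; exact: LU Lz Uw].
- move=> e e0.
  have [z [T aT HT] zl] := sup_adherent e0 hL.
  have [w [T' aT' HT'] wu] := inf_adherent e0 hU.
  exists (Num.max T T'); first by rewrite le_max aT.
  move=> t; rewrite ge_max => /andP[/HT zt /HT' tw].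
  by rewrite (lt_le_trans zl)// (le_lt_trans tw).
- move=> e T e0; apply: contrapT => H.
  suff /(ub_le_sup hL.2) : L (sup L + e) by rewrite leNgt ltrDl e0.
  exists (Num.max a T); first by rewrite le_max lexx.
  move=> t; rewrite ge_max => /andP[_ Tt]; rewrite leNgt; apply/negP => ft.
  by apply: H; exists t.
- move=> e T e0; apply: contrapT => H.
  suff /(ge_inf hU.2) : U (inf U - e) by rewrite leNgt gtrBl e0.
  exists (Num.max a T); first by rewrite le_max lexx.
  move=> t; rewrite ge_max => /andP[_ Tt]; rewrite leNgt; apply/negP => ft.
  by apply: H; exists t.
Qed.

(** [g] is cut off to zero outside the open interval, which makes it bounded and measurable, hence
    integrable up to end points where its continuity is unknown. *)
Lemma antiderivative g a b K :
  (forall t, a < t < b -> cont_at g t) -> (forall t, a < t < b -> `|g t| <= K) ->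
  exists G : R -> R, forall t, a < t < b -> deriv_at G t (g t).
Proof.
move=> cg gK.
pose h : R -> R := g \_ `]a, b[.
have mh : measurable_fun `[a, b] h.
  apply: measurable_funTS; apply: (proj1 (@measurable_restrictT _ _ R R _ g _)) => //.
  apply: open_continuous_measurable_fun; first exact: interval_open.
  by move=> t; rewrite inE/= in_itv/= => /cg /cont_atP.
have ih : lebesgue_measure.-integrable `[a, b] (EFin \o h).
  apply: measurable_bounded_integrable => //.
    by rewrite /= lebesgue_measure_itv/=; case: ifP; rewrite ?ltry// -EFinD ltry.
  exists `|K|; split => // x Kx t tab /=; apply: le_trans (ltW Kx).
  rewrite /h patchE; case: ifPn => [|_]; last by rewrite normr0.
  by rewrite inE/= in_itv/= => /gK /le_trans; apply; exact: ler_norm.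
exists (fun x => Rintegral lebesgue_measure `[a, x] h) => t /andP[at_ tb].
have tab : `]a, b[%classic t by rewrite /= in_itv/= at_.
have ch : {for t, continuous h}.
  apply/cont_atP => e e0; have [d d0 Hd] := cg t (introT andP (conj at_ tb)) _ e0.
  exists (Num.min d (Num.min (t - a) (b - t))) => [|s].
    by rewrite !lt_min d0/=; lra.
  rewrite !lt_min => /and3P[/Hd sd]; rewrite !ltr_norml => /andP[? _] /andP[_ ?].
  have sab : `]a, b[%classic s by rewrite /= in_itv/=; lra.
  by rewrite /h !patchE (mem_set sab) (mem_set tab) -ltr_norml.
have [dF F'] := continuous_FTC1_closed tb ih at_ ch.
apply/deriv_atP; split => //.
by rewrite -derive1E F' /h patchE mem_set.
Qed.

(** The function [c] is an antiderivative of g dB. Since [B] is a homeomorphism onto its image, it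
    suffices to integrate g over the inverse of [B] in the variable v = B(r) and to compose with
    [B]. *)
Lemma stieltjes_antiderivative (B g : R -> R) a b K : a < b ->
  (forall r, a <= r <= b -> cont_at B r) ->
  (forall r s, a <= r -> r < s -> s <= b -> B s < B r) ->
  (forall r, a < r < b -> cont_at g r) -> (forall r, a < r < b -> `|g r| <= K) ->
  exists c : R -> R,
    (forall r, a < r < b -> forall e, 0 < e -> exists2 d, 0 < d &
      forall s, `|s - r| < d -> `|c s - c r - g r * (B s - B r)| <= e * `|B s - B r|) /\
    (forall r s, a < r < b -> a < s < b -> `|c r - c s| <= K * `|B r - B s|).
Proof.
move=> ab cB dB cg gK.
have le_B r s : a <= r -> r <= s -> s <= b -> B s <= B r.
  move=> ar; rewrite le_eqVlt => /predU1P[->//|rs] sb; exact/ltW/dB.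
pose P v := [set r | a <= r <= b /\ v <= B r].
(* The inverse of the decreasing [B]: the last point whose value is at least [v]. *)
pose rho v := sup (P v).
have rhoB r : a <= r <= b -> rho (B r) = r.
  move=> rab.
  have Pr : P (B r) r by split.
  have hP : ubound (P (B r)) r.
    move=> s [/andP[as_ sb] rs]; rewrite leNgt; apply/negP => sr.
    by move/andP: rab => [ar _]; have := dB r s ar sr sb; rewrite ltNge rs.
  apply/le_anti/andP; split; first by apply: ge_sup => //; exists r.
  by apply: ub_le_sup => //; exists r.
have BI v : B b < v < B a -> exists2 r, a < r < b & B r = v.
  move=> /andP[bv va].
  have [||r] := @IVT _ B a b v (ltW ab).
  - exact: cont_at_within.
  - by rewrite ge_min (ltW bv) orbT le_max (ltW va).
  rewrite in_itv/= => /andP[ar rb] E; exists r => //.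
  apply/andP; split; rewrite lt_neqAle ?ar ?rb andbT; apply/eqP => E'.
    by move: va; rewrite -E -E' ltxx.
  by move: bv; rewrite -E -E' ltxx.
have BIr r : a < r < b -> B b < B r < B a.
  by move=> /andP[ar rb]; rewrite !dB// ltW.
have crho v : B b < v < B a -> cont_at rho v.
  move=> /BI[r rab <-] e e0.
  pose e1 := Num.min e (Num.min (r - a) (b - r)).
  have e10 : 0 < e1 by rewrite !lt_min e0/=; move/andP: rab => [? ?]; lra.
  have e1e : e1 <= e by rewrite ge_min lexx.
  have e1a : e1 <= r - a by rewrite !ge_min lexx orbT.
  have e1b : e1 <= b - r by rewrite !ge_min lexx !orbT.
  pose l := r - e1 / 2; pose h := r + e1 / 2.
  have Bl : B r < B l by apply: dB; rewrite /l; lra.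
  have Bh : B h < B r by apply: dB; rewrite /h; lra.
  exists (Num.min (B l - B r) (B r - B h)) => [|v'].
    by rewrite lt_min !subr_gt0 Bl.
  rewrite lt_min !ltr_norml => /andP[/andP[_ v1] /andP[v2 _]].
  have lh : l <= h by rewrite /l /h; lra.
  have [||s] := @IVT _ B l h v' lh.
  - by apply: cont_at_within => z /andP[lz zh]; apply: cB; move: lz zh; rewrite /l /h; lra.
  - by rewrite ge_min le_max; apply/andP; split; apply/orP; [right|left]; lra.
  rewrite in_itv/= => /andP[ls sh] <-.
  move: ls sh; rewrite /l /h => ls sh.
  rewrite !rhoB; try lra.
have [||G HG] := @antiderivative (fun v => g (rho v)) (B b) (B a) K.
- move=> v vab; apply: cont_at_comp; first exact: crho.
  by have [r rab <-] := BI v vab; rewrite rhoB; [exact: cg|move/andP: rab => [? ?]; lra].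
- move=> v /BI[r rab <-]; rewrite rhoB; [exact: gK|move/andP: rab => [? ?]; lra].
exists (fun r => G (B r)); split.
  move=> r rab e e0.
  have [d d0 Hd] := HG _ (BIr r rab) e e0.
  have rab' : a <= r <= b by move/andP: rab => [? ?]; lra.
  have [d' d'0 Hd'] := cB r rab' d d0.
  by exists d' => // s /Hd' /Hd; rewrite rhoB.
suff H r s : a < r < b -> a < s < b -> r < s -> `|G (B r) - G (B s)| <= K * `|B r - B s|.
  move=> r s rab sab; have [rs|sr|->] := ltgtP r s; first exact: H.
  - by rewrite distrC (distrC (B r)); exact: H.
  - by rewrite !subrr normr0 mulr0.
move=> /[dup] rab /andP[ar rb] /[dup] sab /andP[as_ sb] rs.
have [|t|z /andP[sz zr] ->] := @deriv_at_mvt G (fun v => g (rho v)) (B s) (B r).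
- by apply: dB => //; exact: ltW.
- move=> /andP[st tr]; apply: HG.
  have /andP[h1 _] := BIr s sab; have /andP[_ h2] := BIr r rab; lra.
rewrite normrM ler_wpM2r//.
have [|r' r'ab <-] := BI z.
  have /andP[h1 _] := BIr s sab; have /andP[_ h2] := BIr r rab; lra.
rewrite rhoB; [exact: gK|move/andP: r'ab => [? ?]; lra].
Qed.

(** The product rule survives a merely continuous factor if the other factor vanishes at the point.
    Terms containing [B] are differentiated in this way. *)
Lemma deriv_atM_cont f g t l : f t = 0 -> deriv_at f t l -> cont_at g t ->
  deriv_at (fun s => f s * g s) t (l * g t).
Proof.
move=> ft0 df cg e e0.
have [d1 d10 H1] := df 1 ltr01.
have e1 : 0 < e / (2 * (`|l| + 1)) by rewrite divr_gt0// mulr_gt0// ltr_wpDl.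
have [d2 d20 H2] := cg _ e1.
have e2 : 0 < e / (2 * (`|g t| + 1)) by rewrite divr_gt0// mulr_gt0// ltr_wpDl.
have [d3 d30 H3] := df _ e2.
exists (Num.min d1 (Num.min d2 d3)); first by rewrite !lt_min d10 d20.
move=> s; rewrite !lt_min => /and3P[/H1 {}H1 /H2 {}H2 /H3 {}H3].
move: H1 H3; rewrite ft0 subr0 mul0r => H1 H3.
have -> : f s * g s - 0 - l * g t * (s - t) =
  f s * (g s - g t) + g t * (f s - l * (s - t)) by ring.
set h := s - t in H1 H3 *.
have fs : `|f s| <= (`|l| + 1) * `|h|.
  have -> : f s = l * h + (f s - l * h) by ring.
  by rewrite (le_trans (ler_normD _ _))// normrM mulrDl lerD2l.
rewrite (le_trans (ler_normD _ _))// !normrM.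
have -> : e * `|h| = (`|l| + 1) * `|h| * (e / (2 * (`|l| + 1))) +
    (`|g t| + 1) * (e / (2 * (`|g t| + 1)) * `|h|).
  have ? : `|l| + 1 != 0 by rewrite gt_eqF// ltr_wpDl.
  have ? : `|g t| + 1 != 0 by rewrite gt_eqF// ltr_wpDl.
  by field; apply/andP; split.
rewrite lerD// ler_pM//; first exact: ltW.
by rewrite lerDl.
Qed.

Lemma deriv_at_gt0 f t l : deriv_at f t l -> 0 < l -> exists2 d, 0 < d &
  forall s, `|s - t| < d -> (t < s -> f t < f s) /\ (s < t -> f s < f t).
Proof.
move=> df l0; have l2 : 0 < l / 2 by lra.
have [d d0 Hd] := df _ l2.
exists d => // s /Hd; rewrite ler_norml => /andP[h1 h2]; split=> st.
  by move: h1 h2; rewrite gtr0_norm ?subr_gt0//; nra.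
by move: h1 h2; rewrite ltr0_norm ?subr_lt0//; nra.
Qed.

Lemma deriv_at_near f g t l d : 0 < d -> (forall s, `|s - t| < d -> f s = g s) ->
  deriv_at f t l -> deriv_at g t l.
Proof.
move=> d0 fg df e e0; have [d' d'0 H] := df e e0.
exists (Num.min d d') => [|s]; first by rewrite lt_min d0.
by rewrite lt_min => /andP[sd /H]; rewrite !fg// subrr normr0.
Qed.

Lemma small_eq0 (E c : R) : (forall e, 0 < e -> `|E| <= c * e) -> E = 0.
Proof.
move=> H; apply/eqP; rewrite -normr_le0; apply/ler_addgt0Pl => e e0; rewrite addr0.
have c1 : 0 < `|c| + 1 by rewrite ltr_wpDl.
apply: le_trans (H _ (divr_gt0 e0 c1)) _.
rewrite mulrCA ler_piMr ?(ltW e0)// ler_pdivrMr// mul1r.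
by rewrite (le_trans (ler_norm _))// lerDl.
Qed.

Lemma ivt_sign (f : R -> R) a b : a <= b -> (forall z, a <= z <= b -> cont_at f z) ->
  (forall z, a <= z <= b -> f z != 0) -> 0 < f a * f b.
Proof.
move=> ab cf f0; rewrite ltNge; apply/negP => fab.
have [|z] := @IVT _ f a b 0 ab (cont_at_within cf).
  rewrite ge_min le_max.
  have [fa|fa] := leP (f a) 0 => /=; last first.
    by move: fab; rewrite pmulr_rle0// => ->; rewrite (ltW fa).
  have fa0 : f a != 0 by apply: f0; rewrite lexx.
  have {}fa : f a < 0 by rewrite lt_neqAle fa0.
  by move: fab; rewrite nmulr_rle0// => ->; rewrite orbT.
by rewrite in_itv/= => /f0 /eqP.
Qed.

Lemma deriv_lipschitz (f df : R -> R) t0 M : (forall t, t0 <= t -> deriv_at f t (df t)) ->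
  (forall t, t0 <= t -> `|df t| <= M) ->
  forall s t, t0 <= s -> t0 <= t -> `|f s - f t| <= M * `|s - t|.
Proof.
move=> Hf Hd.
have H s t : t0 <= s -> s < t -> `|f t - f s| <= M * `|t - s|.
  move=> ts st; have [u /andP[su _]|c /andP[/ltW sc _] ->] := deriv_at_mvt st (df := df) (f := f).
    by apply/Hf/(le_trans ts).
  by rewrite normrM ler_wpM2r// Hd// (le_trans ts).
move=> s t ts tt; have [st|st|->] := ltgtP s t; last by rewrite !subrr normr0 mulr0.
  by rewrite distrC (distrC s); exact: H.
exact: H.
Qed.

End Calculus.

(** * Lipschitz functions on a segment *)

Section Lipschitz.
Variables (R : realType) (lo hi : R).
Implicit Types (f g : R -> R) (r s : R).

Definition lip_on f := exists2 L, 0 <= L & forall r s, lo <= r <= hi -> lo <= s <= hi ->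
  `|f r - f s| <= L * `|r - s|.

Lemma lip_on_bound f : lip_on f -> exists2 M, 0 <= M & forall r, lo <= r <= hi -> `|f r| <= M.
Proof.
move=> [L L0 Hf]; exists (`|f lo| + L * `|hi - lo|).
  by rewrite addr_ge0// mulr_ge0.
move=> r /andP[lr rh]; have -> : f r = f lo + (f r - f lo) by ring.
rewrite (le_trans (ler_normD _ _))// lerD2l (le_trans (Hf _ _ _ _))//; try lra.
by rewrite ler_wpM2l// !ger0_norm; lra.
Qed.

Lemma lip_on_cst a : lip_on (fun=> a).
Proof. by exists 0 => // r s _ _; rewrite subrr normr0 mul0r. Qed.

Lemma lip_on_id : lip_on id.
Proof. by exists 1 => // r s _ _; rewrite mul1r. Qed.

Lemma lip_onD f g : lip_on f -> lip_on g -> lip_on (fun r => f r + g r).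
Proof.
move=> [L L0 Hf] [M M0 Hg]; exists (L + M); first exact: addr_ge0.
move=> r s rI sI; rewrite opprD addrACA (le_trans (ler_normD _ _))// mulrDl lerD//.
  exact: Hf.
exact: Hg.
Qed.

Lemma lip_onN f : lip_on f -> lip_on (fun r => - f r).
Proof.
move=> [L L0 Hf]; exists L => // r s rI sI; rewrite -opprD normrN; exact: Hf.
Qed.

Lemma lip_onM f g : lip_on f -> lip_on g -> lip_on (fun r => f r * g r).
Proof.
move=> lf lg; have [F F0 HF] := lip_on_bound lf; have [G G0 HG] := lip_on_bound lg.
case: lf lg => [L L0 Hf] [M M0 Hg]; exists (F * M + G * L).
  by rewrite addr_ge0// mulr_ge0.
move=> r s rI sI.
have -> : f r * g r - f s * g s = f r * (g r - g s) + g s * (f r - f s) by ring.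
rewrite (le_trans (ler_normD _ _))// !normrM mulrDl -!mulrA.
by rewrite lerD// ler_pM// ?HF ?HG ?Hf ?Hg.
Qed.

Lemma lip_on_eq f g : (forall r, lo <= r <= hi -> f r = g r) ->
  lip_on g -> lip_on f.
Proof.
by move=> fg [M M0 H]; exists M => // r s rI sI; rewrite !fg//; exact: H.
Qed.

Lemma lip_on_cont f r : lip_on f -> lo < r < hi -> cont_at f r.
Proof.
move=> [L L0 Hf] /andP[lr rh] e e0.
exists (Num.min (Num.min (r - lo) (hi - r)) (e / (L + 1))) => [|s].
  by rewrite !lt_min !subr_gt0 lr rh divr_gt0//; lra.
rewrite !lt_min => /andP[/andP[s1 s2] s3].
move/ltr_normlP: s1 => [s1 _]; move/ltr_normlP: s2 => [_ s2].
rewrite (le_lt_trans (Hf _ _ _ _))//; try lra.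
move: s3; rewrite ltr_pdivlMr; last lra.
have := normr_ge0 (s - r); nra.
Qed.

End Lipschitz.

(** * Limits at infinity and scalar differential inequalities *)

Section AtInfinity.
Variable R : realType.
Implicit Types (f df : R -> R) (l c d e m t T : R).

Lemma cvgyP f l : f t @[t --> +oo] --> l <->
  forall e, 0 < e -> exists T, forall t, T <= t -> `|f t - l| < e.
Proof.
split=> [/cvgrPdist_lt H e /H [T [_ HT]]|H].
  exists (T + 1) => t Tt; rewrite distrC; apply: HT; lra.
apply/cvgrPdist_lt => e /H [T HT]; exists T; split; first exact: num_real.
by move=> t /ltW Tt; rewrite distrC HT.
Qed.

(** Above the level [c] the function falls at rate at least [d], so the lower bound [m] forces it
    below [c] once. It cannot return, since by the mean value theorem a rise above [c] would contain
    a point of positive derivative. *)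
Lemma eventually_le f df c d m T : 0 < d ->
  (forall t, T <= t -> deriv_at f t (df t)) -> (forall t, T <= t -> m <= f t) ->
  (forall t, T <= t -> c <= f t -> df t <= - d) ->
  exists2 T', T <= T' & forall t, T' <= t -> f t <= c.
Proof.
move=> d0 Df fm Hc.
have [t1 Tt1 ft1] : exists2 t1, T <= t1 & f t1 < c.
  apply: contrapT => H.
  have fc t : T <= t -> c <= f t.
    by move=> Tt; rewrite leNgt; apply/negP => ?; apply: H; exists t.
  (* Falling at rate [d] until this time would bring [f] down to at most [m - 1]. *)
  pose s := T + (`|f T - m| + 1) / d.
  have Ts : T < s by rewrite ltrDl divr_gt0// ltr_wpDl.
  have [t /andP[/Df]//|u /andP[/ltW Tu _] E] := deriv_at_mvt Ts (df := df) (f := f).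
  have h1 := Hc u Tu (fc u Tu).
  have : df u * (s - T) <= - (d * (s - T)) by rewrite -mulNr ler_pM2r ?subr_gt0.
  have -> : d * (s - T) = `|f T - m| + 1 by rewrite /s; field; rewrite gt_eqF.
  by rewrite -E; have := fm s (ltW Ts); have := ler_norm (f T - m); lra.
exists t1 => // t2 t12; rewrite leNgt; apply/negP => ft2.
have [|||s [t [t1s /andP[st _] fs ft H]]] := @crossing_up _ f t1 t2 c (f t2) t12 ft2.
- by move=> t /andP[/(le_trans Tt1) /Df /deriv_at_cont].
- exact: ltW.
- exact: lexx.
have [u /andP[su _]|u /andP[/ltW su /ltW ut] E] := deriv_at_mvt st (df := df) (f := f).
  by apply: Df; rewrite (le_trans Tt1)// (le_trans t1s).
have Tu : T <= u by rewrite (le_trans Tt1)// (le_trans t1s).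
have /andP[cu _] := H u (introT andP (conj su ut)).
have h1 := Hc u Tu cu.
have : df u * (t - s) <= 0 by rewrite mulr_le0_ge0 ?subr_ge0 ?(ltW st)// (le_trans h1)// oppr_le0 ltW.
by rewrite -E fs ft; lra.
Qed.

(** On late intervals of length one the increment of [f] is small, and it equals the derivative at
    some intermediate time. *)
Lemma cvg_deriv0 f df l k T : (forall t, T <= t -> deriv_at f t (df t)) ->
  f t @[t --> +oo] --> l -> df t @[t --> +oo] --> k -> k = 0.
Proof.
move=> Df /cvgyP fl /cvgyP dk; apply: (@small_eq0 _ _ 3) => e e0.
have [T1 H1] := fl e e0; have [T2 H2] := dk e e0.
pose s := Num.max T (Num.max T1 T2).
have sT : T <= s by rewrite le_max lexx.
have sT1 : T1 <= s by rewrite !le_max lexx orbT.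
have sT2 : T2 <= s by rewrite !le_max lexx !orbT.
have ss : s < s + 1 by rewrite ltrDl.
have [t /andP[st _]|u /andP[/ltW su _] E] := deriv_at_mvt ss (df := df) (f := f).
  by apply/Df/(le_trans sT).
rewrite addrAC subrr add0r mulr1 in E.
have h1 := H1 _ (le_trans sT1 (ltW ss)); have h2 := H1 _ sT1; have h3 := H2 _ (le_trans sT2 su).
have -> : k = (f (s + 1) - l) - (f s - l) - (df u - k) by rewrite -E; ring.
rewrite (le_trans (ler_normB _ _))// (_ : 3 * e = e + e + e); last by ring.
by rewrite lerD ?(ltW h3)// (le_trans (ler_normB _ _))// lerD// ltW.
Qed.

Lemma cvg_linear_ode f (a b : R -> R) (al be K T : R) : 0 < be ->
  (forall t, T <= t -> deriv_at f t (a t - b t * f t)) -> (forall t, T <= t -> `|f t| <= K) ->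
  a t @[t --> +oo] --> al -> b t @[t --> +oo] --> be ->
  f t @[t --> +oo] --> al / be.
Proof.
move=> be0 Df fK ca cb.
have K0 : 0 <= K by rewrite (le_trans _ (fK T (lexx T))).
suff side (g a' : R -> R) (al' : R) : (forall t, T <= t -> deriv_at g t (a' t - b t * g t)) ->
    (forall t, T <= t -> `|g t| <= K) -> a' t @[t --> +oo] --> al' ->
    forall e, 0 < e -> exists T', forall t, T' <= t -> g t <= al' / be + e.
  apply/cvgyP => e e0; have e2 : 0 < e / 2 by lra.
  have [T1 H1] := side f a al Df fK ca _ e2.
  have [||T2 H2] := side (fun t => - f t) (fun t => - a t) (- al) _ _ (cvgN ca) _ e2.
  - by move=> t /Df /deriv_atN h; apply: deriv_at_eq h _; ring.
  - by move=> t /fK; rewrite normrN.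
  exists (Num.max T1 T2) => t; rewrite ge_max => /andP[/H1 h1 /H2].
  by rewrite mulNr ltr_norml => h2; apply/andP; split; lra.
move=> Dg gK /cvgyP ca' e e0.
(* Tolerance for both coefficients: the total error [h + h * K] equals [be * e / 4], well below the
   decay [be * e] available when [g] exceeds the limit by [e]. *)
pose h := be * e / (4 * (1 + K)).
have K1 : 0 < 1 + K by lra.
have h0 : 0 < h by rewrite divr_gt0// mulr_gt0.
have [T1 H1] := ca' h h0; move/cvgyP: cb => /(_ h h0)[T2 H2].
pose S := Num.max T (Num.max T1 T2).
have sT : T <= S by rewrite le_max lexx.
have sT1 : T1 <= S by rewrite !le_max lexx orbT.
have sT2 : T2 <= S by rewrite !le_max lexx !orbT.
have d0 : 0 < be * e / 4 by rewrite divr_gt0// mulr_gt0.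
have [|||T' _ H] := @eventually_le g (fun t => a' t - b t * g t) (al' / be + e) (be * e / 4) (- K) S d0.
- by move=> t /(le_trans sT) /Dg.
- by move=> t /(le_trans sT) /gK /ler_normlP[]; lra.
- move=> t St cg.
  have /ltr_normlP[_ h1] := H1 t (le_trans sT1 St).
  have h2 := H2 t (le_trans sT2 St).
  have gt := gK t (le_trans sT St).
  have h3 : `|(b t - be) * g t| <= h * K by rewrite normrM ler_pM// ltW.
  have /ler_normlP[h4 _] := h3.
  have h5 : be * (al' / be + e) <= be * g t by rewrite ler_pM2l.
  rewrite mulrDr mulrC divfK ?gt_eqF// in h5.
  have h6 : h + h * K = be * e / 4 by rewrite /h; field; rewrite gt_eqF.
  have -> : a' t - b t * g t = (a' t - al') - (b t - be) * g t - (be * g t - al') by ring.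
  by lra.
by exists T'.
Qed.

End AtInfinity.

(** * The Lyapunov function *)

Section Core.
Variables (R : realType) (A B C D : R -> R) (al be : R).
Implicit Types (r s t z : R).
Hypothesis AD : forall r, 0 < r -> A r + D r = al.
Hypothesis BC : forall r, 0 < r -> B r + C r = be.
Hypothesis dA : forall r s, 0 < r -> r < s ->
  r * (B r - B s) <= A r - A s <= s * (B r - B s).
Hypothesis dB : forall r s, 0 < r -> r < s -> B s < B r.
Hypothesis B_ge0 : forall r, 0 < r -> 0 <= B r.
Hypothesis C_ge0 : forall r, 0 < r -> 0 <= C r.
Hypothesis rB_le_A : forall r, 0 < r -> r * B r <= A r.
Hypothesis D_le_rC : forall r, 0 < r -> D r <= r * C r.

(** The coefficients n and q of N, which is affine in x for fixed r. *)
Definition drift_cst r := C r - r * A r.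
Definition drift_slope r := r * r * B r - D r.
Definition weight (r x : R) := x * x * (r * (r + 1)) / 2 - x * (1 + r * r).

Lemma B_gt0 r : 0 < r -> 0 < B r.
Proof.
by move=> r0; apply: le_lt_trans (dB r0 (_ : r < r + 1)); [apply: B_ge0|]; lra.
Qed.

Lemma C_gt0 r : 0 < r -> 0 < C r.
Proof.
move=> r0; have r20 : 0 < r / 2 by lra.
have rr : r / 2 < r by lra.
by have := dB r20 rr; have := BC r0; have := BC r20; have := C_ge0 r20; lra.
Qed.

(** The weak inequality at [r + 1] and the lower estimate in [dA] together leave the margin
    [B (r + 1)]. *)
Lemma rB_lt_A r : 0 < r -> r * B r < A r.
Proof.
move=> r0; have r10 : 0 < r + 1 by lra.
have r1 : r < r + 1 by lra.
have /andP[h1 _] := dA r0 r1; have h2 := rB_le_A r10; have := B_gt0 r10; nra.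
Qed.

(** Mirror image of [rB_lt_A]: comparison with [r / 2] leaves the margin [r / 2 * C (r / 2)]. *)
Lemma D_lt_rC r : 0 < r -> D r < r * C r.
Proof.
move=> r0; have r20 : 0 < r / 2 by lra.
have rr : r / 2 < r by lra.
have /andP[_ h1] := dA r20 rr; have h2 := D_le_rC r20; have := C_gt0 r20.
have := AD r0; have := AD r20; have := BC r0; have := BC r20; nra.
Qed.

(** The increment is exactly the quadratic term plus [(z - x) * (r * r * (x - 1) + (r * x - 1))],
    which is nonnegative on the invariant square. The quadratic term makes the growth of the weight
    quantitative. *)
Lemma weight_incr r x z : 0 < r -> 1 <= x -> 1 <= z -> 1 <= r * x -> 1 <= r * z ->
  x <= z -> (z - x) * (z - x) * (r * (r + 1)) / 2 <= weight r z - weight r x.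
Proof.
move=> r0 x1 z1 rx rz xz.
have -> : weight r z - weight r x = (z - x) * (z - x) * (r * (r + 1)) / 2 +
  (z - x) * (r * r * (x - 1) + (r * x - 1)) by rewrite /weight; field.
rewrite lerDl mulr_ge0 ?subr_ge0// addr_ge0 ?subr_ge0// mulr_ge0 ?subr_ge0//.
by rewrite mulr_ge0// ltW.
Qed.

Variables (lo hi L : R).
Hypothesis lo0 : 0 < lo.
Hypothesis L0 : 0 <= L.
Hypothesis lipB : forall r s, lo <= r -> r < s -> s <= hi -> B r - B s <= L * (s - r).

Lemma B_lipschitz r s : lo <= r <= hi -> lo <= s <= hi -> `|B r - B s| <= L * `|r - s|.
Proof.
move=> /andP[lr rh] /andP[ls sh].
have [rs|sr|->] := ltgtP r s; last by rewrite !subrr normr0 mulr0.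
  rewrite ger0_norm ?ler0_norm ?opprB; [exact: lipB|lra|].
  by have := dB (lt_le_trans lo0 lr) rs; lra.
rewrite ler0_norm ?ger0_norm ?opprB; [exact: lipB|lra|].
by have := dB (lt_le_trans lo0 ls) sr; lra.
Qed.

Lemma lip_B : lip_on lo hi B.
Proof. by exists L => //; exact: B_lipschitz. Qed.

(** By [dA] the increment of [A] is that of [B] times a number between the two points; the error is
    then at most the distance times the increment of [B], hence quadratic. This is dA = r dB. *)
Lemma A_flat r : lo < r < hi -> deriv_at (fun z => A z - r * B z) r 0.
Proof.
move=> /andP[lr rh] e e0; have ? := lo0; have ? := L0.
exists (Num.min (Num.min (r - lo) (hi - r)) (e / (L + 1))) => [|s].
  by rewrite !lt_min !subr_gt0 lr rh divr_gt0//; lra.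
rewrite !lt_min => /andP[/andP[s1 s2] s3].
move/ltr_normlP: s1 => [s1 _]; move/ltr_normlP: s2 => [_ s2].
move: s3; rewrite ltr_pdivlMr; last lra.
rewrite mul0r subr0 => s3.
have r0 : 0 < r by lra.
have s0 : 0 < s by lra.
have H : `|A s - r * B s - (A r - r * B r)| <= `|s - r| * (L * `|s - r|).
  have [rs|sr|->] := ltgtP r s; last by rewrite !subrr !normr0 mul0r.
    have /andP[h1 h2] := dA r0 rs; have h3 := dB r0 rs.
    have h4 : B r - B s <= L * (s - r) by apply: lipB; lra.
    have h5 : (s - r) * (B r - B s) <= (s - r) * (L * (s - r)).
      by rewrite ler_pM2l// subr_gt0.
    have h6 : 0 <= (s - r) * (B r - B s) by rewrite mulr_ge0; lra.
    rewrite (gtr0_norm (_ : 0 < s - r)) ?subr_gt0// ler_norml; lra.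
  have /andP[h1 h2] := dA s0 sr; have h3 := dB s0 sr.
  have h4 : B s - B r <= L * (r - s) by apply: lipB; lra.
  have h5 : (r - s) * (B s - B r) <= (r - s) * (L * (r - s)).
    by rewrite ler_pM2l// subr_gt0.
  have h6 : 0 <= (r - s) * (B s - B r) by rewrite mulr_ge0; lra.
  rewrite (ltr0_norm (_ : s - r < 0)) ?subr_lt0// ler_norml; lra.
rewrite (le_trans H)// mulrC ler_wpM2r//.
by have := normr_ge0 (s - r); nra.
Qed.

Lemma lip_A : lip_on lo hi A.
Proof.
have ? := lo0; have ? := L0.
have AL r s : lo <= r -> r < s -> s <= hi -> 0 <= A r - A s <= hi * L * (s - r).
  move=> lr rs sh; have r0 := lt_le_trans lo0 lr.
  have /andP[h1 h2] := dA r0 rs; have h3 := dB r0 rs.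
  by have := lipB lr rs sh; nra.
have [hl|hl] := ltP hi lo.
  by exists 0 => // r s; lra.
exists (hi * L) => [|r s /andP[lr rh] /andP[ls sh]]; first by rewrite mulr_ge0//; lra.
have [rs|sr|->] := ltgtP r s; last by rewrite !subrr normr0 mulr0.
  by rewrite ger0_norm ?ler0_norm ?opprB; have := AL r s lr rs sh; lra.
by rewrite ler0_norm ?ger0_norm ?opprB; have := AL s r ls sr rh; lra.
Qed.

Lemma lip_C : lip_on lo hi C.
Proof.
apply: (@lip_on_eq _ _ _ _ (fun r => be - B r)) => [r /andP[lr _]|].
  by rewrite -(BC (lt_le_trans lo0 lr)); ring.
by apply: lip_onD; [exact: lip_on_cst | exact/lip_onN/lip_B].
Qed.

Lemma lip_D : lip_on lo hi D.
Proof.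
apply: (@lip_on_eq _ _ _ _ (fun r => al - A r)) => [r /andP[lr _]|].
  by rewrite -(AD (lt_le_trans lo0 lr)); ring.
by apply: lip_onD; [exact: lip_on_cst | exact/lip_onN/lip_A].
Qed.

Lemma lip_drift_cst : lip_on lo hi drift_cst.
Proof.
apply: lip_onD; first exact: lip_C.
by apply/lip_onN/lip_onM; [exact: lip_on_id | exact: lip_A].
Qed.

Lemma lip_drift_slope : lip_on lo hi drift_slope.
Proof.
apply: lip_onD; last exact/lip_onN/lip_D.
apply: lip_onM; last exact: lip_B.
by apply: lip_onM; exact: lip_on_id.
Qed.

(* Orbits, in the coordinates x = m_1 and r = m_2 / m_1. *)
Variables (x r : R -> R) (t0 K k1 k2 : R).
Hypothesis rI : forall t, t0 <= t -> k1 <= r t <= k2.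
Hypothesis lok1 : lo < k1.
Hypothesis k2hi : k2 < hi.
Hypothesis x1 : forall t, t0 <= t -> 1 < x t <= K.
Hypothesis rx1 : forall t, t0 <= t -> 1 < r t * x t.

Definition drift t := drift_cst (r t) + x t * drift_slope (r t).

Hypothesis dx : forall t, t0 <= t -> deriv_at x t (A (r t) - r t * x t * B (r t)).
Hypothesis dr : forall t, t0 <= t -> deriv_at r t (drift t / x t).

Let rI' t : t0 <= t -> lo < r t < hi.
Proof. by move=> /rI; have := lok1; have := k2hi; lra. Qed.

Let r_gt0 t : t0 <= t -> 0 < r t.
Proof. by move=> /rI'; have := lo0; lra. Qed.

Lemma cont_lip f t : lip_on lo hi f -> t0 <= t -> cont_at (fun s => f (r s)) t.
Proof.
move=> lf tt; apply: cont_at_comp; first exact: deriv_at_cont (dr tt).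
by apply: lip_on_cont lf _; exact: rI'.
Qed.

(** The function H along the orbit; for fixed r it is the antiderivative of N in x that vanishes at
    x = 0. *)
Definition energy t := x t * drift_cst (r t) + x t * x t * drift_slope (r t) / 2.

(* Along an orbit dH0 = weight dB as a Stieltjes differential; since [B] need not be
   differentiable this is expressed by freezing [weight] at time [t]. *)
Lemma energy_deriv t : t0 < t ->
  deriv_at (fun s => energy s - weight (r t) (x t) * B (r s)) t 0.
Proof.
move=> tt; have tt' := ltW tt.
(* With [r t] frozen, [A], [C] and [D] are expressed through [At], [B] and constants. The energy
   becomes [P0 s + (P1 s + weight (r t) (x t)) * B (r s)], where [P1] vanishes at [t]. *)
pose At s := A (r s) - r t * B (r s).
have dAt : deriv_at At t 0.
  apply: deriv_at_eq; first exact: deriv_at_comp (dr tt') (A_flat (rI' tt')).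
  by rewrite mul0r.
pose P1 s := - x s * (1 + r s * r t) + x s * x s * (r s * r s + r t) / 2 - weight (r t) (x t).
have P10 : P1 t = 0 by rewrite /P1 /weight; field.
pose P0 s := x s * (be - r s * At s) + x s * x s * (At s - al) / 2.
have Dx := dx tt'; have Dr := dr tt'.
have Dxx := deriv_atM Dx Dx; have Drr := deriv_atM Dr Dr.
have DP1 := deriv_atB (deriv_atD
  (deriv_atM (deriv_atN Dx) (deriv_atD (deriv_at_cst 1 t) (deriv_atM Dr (deriv_at_cst (r t) t))))
  (deriv_atM (deriv_atM Dxx (deriv_atD Drr (deriv_at_cst (r t) t))) (deriv_at_cst 2^-1 t)))
  (deriv_at_cst (weight (r t) (x t)) t).
have DP1B := deriv_atM_cont P10 DP1 (cont_lip lip_B tt').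
have DP0 := deriv_atD
  (deriv_atM Dx (deriv_atB (deriv_at_cst be t) (deriv_atM Dr dAt)))
  (deriv_atM (deriv_atM Dxx (deriv_atB dAt (deriv_at_cst al t))) (deriv_at_cst 2^-1 t)).
have tt0 : 0 < t - t0 by lra.
apply: (deriv_at_near tt0 _ (deriv_at_eq (deriv_atD DP0 DP1B) _)) => [s|].
  move=> /ltr_normlP[st _]; have s0 : 0 < r s by apply: r_gt0; lra.
  have -> : be = B (r s) + C (r s) by rewrite BC.
  have -> : al = A (r s) + D (r s) by rewrite AD.
  by rewrite /energy /At /P1 /drift_cst /drift_slope; field.
have s0 := r_gt0 tt'; have xt : x t != 0 by have /andP[? _] := x1 tt'; rewrite gt_eqF//; lra.
rewrite /At /drift /drift_cst /drift_slope.
have -> : be = B (r t) + C (r t) by rewrite BC.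
have -> : al = A (r t) + D (r t) by rewrite AD.
by field.
Qed.

Section Lyapunov.
Variables (j1 j2 sg : R).
Hypothesis loj : lo < j1.
Hypothesis jhi : j2 < hi.
Hypothesis j12 : j1 < j2.
Hypothesis q_sg : forall z, j1 < z < j2 -> 0 < sg * drift_slope z.

Definition drift_zero z := - drift_cst z / drift_slope z.
(** The lower bound for x on the line r = z that results from x > 1 and r x > 1. *)
Definition orbit_floor z := Num.max 1 z^-1.
(** Projection of the zero of N onto the range of x. This keeps the weight bounded and inside the
    region where it increases. *)
Definition clamped_zero z := Num.max (orbit_floor z) (Num.min K (drift_zero z)).

Let q_neq0 z : j1 < z < j2 -> drift_slope z != 0.
Proof. by move=> /q_sg qz; apply/eqP => E; move: qz; rewrite E mulr0 ltxx. Qed.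

Let jI z : j1 < z < j2 -> lo < z < hi.
Proof. by have := loj; have := jhi; lra. Qed.

Let cont_w z : j1 < z < j2 -> cont_at (fun z => weight z (clamped_zero z)) z.
Proof.
move=> zj; have zI := jI zj; have z0 : z != 0 by rewrite gt_eqF//; have := lo0; lra.
have cc : cont_at clamped_zero z.
  apply: cont_at_max.
    by apply: cont_at_max; [exact: cont_at_cst | apply: cont_atV => //; exact: cont_at_id].
  apply: cont_at_min; first exact: cont_at_cst.
  apply: cont_atM; first by apply/cont_atN; exact: lip_on_cont lip_drift_cst zI.
  by apply: cont_atV; [exact: q_neq0 | exact: lip_on_cont lip_drift_slope zI].
apply: cont_atD.
  apply: cont_atM; last exact: cont_at_cst.
  apply: cont_atM; first exact: cont_atM.
  apply: cont_atM; first exact: cont_at_id.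
  by apply: cont_atD; [exact: cont_at_id | exact: cont_at_cst].
apply/cont_atN/cont_atM => //.
by apply: cont_atD; [exact: cont_at_cst | apply: cont_atM; exact: cont_at_id].
Qed.

Let K1 : 1 < K.
Proof. by have := x1 (lexx t0); lra. Qed.

Lemma orbit_floor_ge1 z : 0 < z -> 1 <= orbit_floor z /\ 1 <= z * orbit_floor z.
Proof.
move=> z0; split; first by rewrite le_max lexx.
rewrite -(ler_pM2l (_ : 0 < z^-1)) ?invr_gt0// mulrA mulVf ?gt_eqF// mul1r mulr1.
by rewrite le_max lexx orbT.
Qed.

Lemma orbit_floor_le t : t0 <= t -> orbit_floor (r t) <= x t.
Proof.
move=> tt; have := x1 tt; have := rx1 tt; have r0 := r_gt0 tt => rx /andP[x1' _].
rewrite ge_max (ltW x1')/= -(ler_pM2l r0) mulfV ?gt_eqF//; exact: ltW.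
Qed.

Let w_bound : exists M, forall z, j1 < z < j2 -> `|weight z (clamped_zero z)| <= M.
Proof.
pose m := K + lo^-1.
have lo' : 0 < lo^-1 by rewrite invr_gt0 lo0.
have K1' := K1.
have m0 : 0 < m by rewrite /m; lra.
exists (m * m * (hi * (hi + 1)) / 2 + m * (1 + hi * hi)) => z /jI zI.
have z0 : 0 < z by have := lo0; lra.
have c1 : 0 <= clamped_zero z.
  by rewrite le_max (le_trans ler01 (orbit_floor_ge1 z0).1).
have c2 : clamped_zero z <= m.
  have ? : z^-1 <= lo^-1 by rewrite lef_pV2 ?posrE ?lo0//; lra.
  rewrite /clamped_zero /orbit_floor !ge_max ge_min /m; apply/andP; split; first by apply/andP; split; lra.
  by apply/orP; left; lra.
rewrite /weight (le_trans (ler_normD _ _))// normrN.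
have zz : 0 <= z <= hi by lra.
have zz0 : 0 <= z * (z + 1) by rewrite mulr_ge0//; lra.
have z2 : 0 <= z * z by rewrite mulr_ge0//; lra.
rewrite (ger0_norm (_ : 0 <= clamped_zero z * clamped_zero z * _ / 2)); last first.
  by rewrite divr_ge0// mulr_ge0// mulr_ge0.
rewrite (ger0_norm (_ : 0 <= clamped_zero z * _)); last by rewrite mulr_ge0// addr_ge0.
rewrite lerD//.
  rewrite ler_pM2r// ?invr_gt0// ler_pM//; rewrite ?mulr_ge0//; try lra.
    by rewrite ler_pM.
  by rewrite ler_pM//; lra.
rewrite ler_pM//; first by rewrite addr_ge0// mulr_ge0//; lra.
by rewrite lerD2l ler_pM//; lra.
Qed.

(** [x t] obeys the clamping bounds itself, so clamping never carries the zero across [x t]. Hence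
    [sg * drift t] has the sign of [x t - drift_zero (r t)], and the difference of weights has the
    same sign or vanishes. *)
Lemma weight_clamp t : t0 <= t -> j1 < r t < j2 ->
  0 <= (weight (r t) (x t) - weight (r t) (clamped_zero (r t))) * (sg * drift t).
Proof.
move=> tt rj; have r0 := r_gt0 tt; have [l1 l2] := orbit_floor_ge1 r0.
have qn := q_neq0 rj.
have -> : sg * drift t = (sg * drift_slope (r t)) * (x t - drift_zero (r t)).
  by rewrite /drift /drift_zero; field.
have {qn}q0 := q_sg rj.
rewrite mulrCA mulr_ge0//; first exact: ltW.
have lx := orbit_floor_le tt; have /andP[x1' xK] := x1 tt; have rx := rx1 tt.
have lc : orbit_floor (r t) <= clamped_zero (r t) by rewrite le_max lexx.
have c1 := le_trans l1 lc.
have c2 : 1 <= r t * clamped_zero (r t) by rewrite (le_trans l2)// ler_pM2l.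
have rr : 0 <= r t * (r t + 1) by rewrite mulr_ge0//; lra.
have sq a : 0 <= a * a * (r t * (r t + 1)) / 2.
  by rewrite divr_ge0// mulr_ge0// -expr2 sqr_ge0.
have [xc|cx|->] := ltgtP (x t) (clamped_zero (r t)); last by rewrite subrr mul0r.
  have h := weight_incr r0 (ltW x1') c1 (ltW rx) c2 (ltW xc).
  have h' := sq (clamped_zero (r t) - x t).
  rewrite mulr_le0//; first lra.
  move: xc; rewrite lt_max ltNge lx/= lt_min => /andP[_]; lra.
have h := weight_incr r0 c1 (ltW x1') c2 (ltW rx) (ltW cx).
have h' := sq (x t - clamped_zero (r t)).
rewrite mulr_ge0//; first lra.
by move: cx; rewrite gt_max gt_min => /andP[_ /orP[|]]; lra.
Qed.

(** [V] is sg (H - c) with dc = w(r, clamped zero) dB, so along the orbit d(V - mu B) is the first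
    factor of the hypothesis times dB(r). As [r] moves in the direction of the drift and [B]
    decreases, the sign condition gives monotonicity. The slack [mu] later quantifies the decrease
    of [V]. *)
Lemma lyapunov : exists V : R -> R,
  [/\ forall t, t0 < t -> j1 < r t < j2 -> cont_at V t,
     exists m, forall t, t0 < t -> j1 < r t < j2 -> m <= V t &
     forall mu s1 s2, t0 < s1 -> s1 <= s2 ->
       (forall t, s1 <= t <= s2 -> j1 < r t < j2 /\
          0 <= (sg * (weight (r t) (x t) - weight (r t) (clamped_zero (r t))) - mu) * drift t) ->
       V s2 - mu * B (r s2) <= V s1 - mu * B (r s1)].
Proof.
have [M wM] := w_bound.
have [||||c [dc cM]] := @stieltjes_antiderivative _ B (fun z => weight z (clamped_zero z)) j1 j2 M j12.
- move=> z zj; apply: lip_on_cont lip_B _; have := loj; have := jhi; lra.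
- by move=> a b ja ab _; apply: dB => //; have := lo0; have := loj; lra.
- exact: cont_w.
- exact: wM.
have Mp : 0 < `|M| + 1 by rewrite ltr_wpDl.
have cc z : j1 < z < j2 -> cont_at c z.
  move=> zj e e0; have zI := jI zj.
  have eM : 0 < e / (`|M| + 1) by rewrite divr_gt0.
  have [d d0 Hd] := lip_on_cont lip_B zI eM.
  exists (Num.min d (Num.min (z - j1) (j2 - z))) => [|s].
    by rewrite !lt_min d0/=; lra.
  rewrite !lt_min => /and3P[/Hd sd /ltr_normlP[s1 _] /ltr_normlP[_ s2]].
  have sj : j1 < s < j2 by lra.
  rewrite (le_lt_trans (cM _ _ sj zj))//.
  move: sd; rewrite ltr_pdivlMr// => sd; apply: le_lt_trans sd.
  by rewrite mulrC ler_wpM2l// (le_trans (ler_norm _))// lerDl.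
have cV t : t0 < t -> j1 < r t < j2 -> cont_at (fun t => sg * (energy t - c (r t))) t.
  move=> tt rj; have tt' := ltW tt.
  apply: cont_atM; first exact: cont_at_cst.
  apply: cont_atD; last first.
    by apply: cont_atN; apply: cont_at_comp; [exact: deriv_at_cont (dr tt') | exact: cc].
  have cx := deriv_at_cont (dx tt').
  apply: cont_atD; apply: cont_atM => //; first exact: cont_lip lip_drift_cst tt'.
    by apply: cont_atM; [exact: cont_atM | exact: cont_lip lip_drift_slope tt'].
  exact: cont_at_cst.
exists (fun t => sg * (energy t - c (r t))); split => //.
- have [n n_0 nb] := lip_on_bound lip_drift_cst; have [Q Q0 qb] := lip_on_bound lip_drift_slope.
  have [b b0 Bb] := lip_on_bound lip_B.
  pose mid := (j1 + j2) / 2.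
  have midj : j1 < mid < j2 by rewrite /mid; have := j12; lra.
  exists (- (`|sg| * (K * n + K * K * Q / 2 + (`|c mid| + `|M| * (b + b))))) => t tt rj.
  have tt' := ltW tt; have /andP[x1' xK] := x1 tt'; have x0 : 0 <= x t by rewrite ltW// (lt_trans ltr01).
  have rI1 : lo <= r t <= hi by have /andP[/ltW -> /ltW ->] := rI' tt'.
  have mI1 : lo <= mid <= hi by have /andP[/ltW -> /ltW ->] := jI midj.
  rewrite lerNl (le_trans (ler_norm _))// normrN normrM ler_wpM2l//.
  rewrite (le_trans (ler_normD _ _))// normrN lerD//.
    rewrite (le_trans (ler_normD _ _))// lerD// normrM ?normrV ?unitfE// ?normrM.
      by rewrite (ger0_norm x0) ler_pM// nb.
    rewrite (ger0_norm x0) (@ger0_norm _ 2)// ler_pM2r ?invr_gt0// ler_pM ?mulr_ge0//.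
      by rewrite ler_pM.
    exact: qb.
  have -> : c (r t) = c mid + (c (r t) - c mid) by ring.
  rewrite (le_trans (ler_normD _ _))// lerD2l (le_trans (cM _ _ rj midj))//.
  rewrite (le_trans (ler_wpM2r _ (ler_norm M)))// ler_wpM2l//.
  by rewrite (le_trans (ler_normB _ _))// lerD// Bb.
move=> mu s1 s2 ts1 s12 H; have L0' := L0.
apply: (@dini_nonincreasing _ (fun t => sg * (energy t - c (r t)) - mu * B (r t)) s1 s2 s12).
  move=> t /[dup] ts /H[rj _]; have tt : t0 < t by lra.
  apply: cont_atD; first exact: cV.
  by apply/cont_atN/cont_atM; [exact: cont_at_cst | exact: cont_lip lip_B (ltW tt)].
move=> t ts e e0; have tt : t0 < t by lra.
have tt' := ltW tt.
have rI2 s : t0 <= s -> lo <= r s <= hi.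
  by move=> /rI' /andP[/ltW -> /ltW ->].
have ts' : s1 <= t <= s2 by lra.
have [rj] := H t ts'; set cf := sg * _ - mu => cfN.
have sg0 : 0 < `|sg| + 1 by rewrite ltr_wpDl.
have e1 : 0 < e / 3 / (`|sg| + 1) by rewrite !divr_gt0.
have [d1 d10 Hd1] := energy_deriv tt e1.
(* A bound for the difference quotients of [r] near [t], from its derivative with tolerance 1. *)
pose V1 := `|drift t / x t| + 1.
have V10 : 0 < V1 by rewrite ltr_wpDl.
have LV : 0 < L * V1 + 1 by rewrite ltr_wpDl// mulr_ge0// ltW.
have e2 : 0 < e / 3 / (`|sg| + 1) / (L * V1 + 1) by rewrite !divr_gt0.
have [d2 d20 Hd2] := dc (r t) rj _ e2.
have [d3 d30 Hd3] := deriv_at_cont (dr tt') d20.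
have [d4 d40 Hd4] := dr tt' ltr01.
(* A nonzero drift fixes the direction in which [r] leaves, hence the sign of the increment of [B];
   a zero drift makes this increment of smaller order than [s - t]. *)
have [d5 d50 Hd5] : exists2 d, 0 < d & forall s, t < s < t + d ->
    cf * (B (r s) - B (r t)) <= e / 3 * (s - t).
  have rs0 s : t < s -> 0 < r s by move=> ts_; apply/r_gt0/ltW/(lt_trans tt).
  have xt0 : 0 < x t by have /andP[/(lt_trans ltr01)] := x1 tt'.
  have [Nlt|Ngt|N0] := ltgtP (drift t) 0.
  - have Nx : 0 < - (drift t / x t) by rewrite oppr_gt0 pmulr_llt0 ?invr_gt0.
    have [d d0 Hd] := deriv_at_gt0 (deriv_atN (dr tt')) Nx.
    exists d => // s /andP[st sd].
    have [] := Hd s; first by rewrite gtr0_norm ?subr_gt0// ltrBlDl.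
    move=> /(_ st) rr _.
    have cf0 : cf <= 0 by rewrite leNgt; apply/negP => cf0; move: cfN; rewrite pmulr_rge0// leNgt Nlt.
    rewrite (@le_trans _ _ 0)//; last by rewrite mulr_ge0 ?divr_ge0 ?subr_ge0// ltW.
    have := @dB (r s) (r t) (rs0 _ st); rewrite -ltrN2 rr => /(_ isT) BB.
    by rewrite mulr_le0_ge0// subr_ge0 ltW.
  - have Nx : 0 < drift t / x t by rewrite divr_gt0.
    have [d d0 Hd] := deriv_at_gt0 (dr tt') Nx.
    exists d => // s /andP[st sd].
    have [] := Hd s; first by rewrite gtr0_norm ?subr_gt0// ltrBlDl.
    move=> /(_ st) rr _.
    have cf0 : 0 <= cf by move: cfN; rewrite pmulr_lge0.
    rewrite (@le_trans _ _ 0)//; last by rewrite mulr_ge0 ?divr_ge0 ?subr_ge0// ltW.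
    have := dB (r_gt0 tt') rr => BB.
    by rewrite mulr_ge0_le0// subr_le0 ltW.
  - have cfp : 0 < `|cf| * L + 1 by rewrite ltr_wpDl// mulr_ge0.
    have e3 : 0 < e / 3 / (`|cf| * L + 1) by rewrite !divr_gt0.
    have [d d0 Hd] := dr tt' e3.
    exists d => // s /andP[st sd].
    have hs : `|s - t| = s - t by rewrite gtr0_norm// subr_gt0.
    have := Hd s; rewrite hs N0 mul0r mul0r subr0 => /(_ _) Hs.
    have {}Hs : `|r s - r t| <= e / 3 / (`|cf| * L + 1) * (s - t) by apply: Hs; rewrite ltrBlDl.
    rewrite (le_trans (ler_norm _))// normrM.
    have BL : `|B (r s) - B (r t)| <= L * `|r s - r t|.
      by apply: B_lipschitz; apply: rI2 => //; exact: ltW (lt_trans tt st).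
    rewrite (le_trans (ler_wpM2l _ BL))// (le_trans (ler_wpM2l _ (ler_wpM2l _ Hs)))//.
    have -> : `|cf| * (L * (e / 3 / (`|cf| * L + 1) * (s - t))) =
      e / 3 * (s - t) * ((`|cf| * L) / (`|cf| * L + 1)) by field; rewrite gt_eqF.
    rewrite ler_piMr ?mulr_ge0 ?divr_ge0//; [exact: ltW|by rewrite subr_ge0 ltW|].
    by rewrite ler_pdivrMr// mul1r lerDl.
exists (Num.min (Num.min d1 d3) (Num.min d4 d5)); first by rewrite !lt_min d10 d30 d40.
move=> s /andP[st]; rewrite -ltrBlDl !lt_min => /andP[/andP[sd1 sd3] /andP[sd4 sd5]].
have hs : `|s - t| = s - t by rewrite gtr0_norm// subr_gt0.
rewrite -hs in sd1 sd3 sd4.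
have {}Hd1 := Hd1 _ sd1; have {}Hd2 := Hd2 _ (Hd3 _ sd3); have {}Hd4 := Hd4 _ sd4.
have {}Hd5 : cf * (B (r s) - B (r t)) <= e / 3 * (s - t) by apply: Hd5; rewrite st -ltrBlDl.
rewrite mul0r subr0 hs in Hd1.
rewrite mul1r hs in Hd4.
have BL : `|B (r s) - B (r t)| <= L * V1 * (s - t).
  rewrite (le_trans (B_lipschitz (rI2 _ (ltW (lt_trans tt st))) (rI2 _ tt')))//.
  rewrite -mulrA ler_wpM2l//.
  have -> : r s - r t = drift t / x t * (s - t) + (r s - r t - drift t / x t * (s - t)) by ring.
  have -> : V1 * (s - t) = `|drift t / x t| * (s - t) + (s - t) by rewrite /V1; ring.
  by rewrite (le_trans (ler_normD _ _))// [in `|_ * (s - t)|]normrM hs lerD2l.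
have st0 : 0 <= s - t by rewrite subr_ge0 ltW.
have T1 : sg * (energy s - weight (r t) (x t) * B (r s) - (energy t - weight (r t) (x t) * B (r t))) <=
    e / 3 * (s - t).
  rewrite (le_trans (ler_norm _))// normrM (le_trans (ler_wpM2l _ Hd1))//.
  have -> : e / 3 * (s - t) = (`|sg| + 1) * (e / 3 / (`|sg| + 1) * (s - t)).
    by field; rewrite gt_eqF.
  by rewrite ler_wpM2r ?lerDl// mulr_ge0// ltW.
have T2 : - (sg * (c (r s) - c (r t) - weight (r t) (clamped_zero (r t)) * (B (r s) - B (r t)))) <=
    e / 3 * (s - t).
  rewrite (le_trans (ler_norm _))// normrN normrM (le_trans (ler_wpM2l _ Hd2))//.
  rewrite (le_trans (ler_wpM2l _ (ler_wpM2l _ BL)))//; first exact: ltW.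
  have -> : `|sg| * (e / 3 / (`|sg| + 1) / (L * V1 + 1) * (L * V1 * (s - t))) =
    e / 3 * (s - t) * ((`|sg| / (`|sg| + 1)) * ((L * V1) / (L * V1 + 1))).
    by field; rewrite !gt_eqF.
  have LV1 : 0 <= L * V1 by rewrite mulr_ge0// ltW.
  have sg1 := ltW sg0; have LV2 := ltW LV; have e0' := ltW e0.
  rewrite ler_piMr// ?mulr_ge0 ?divr_ge0//.
  rewrite mulr_ile1// ?divr_ge0//.
    by rewrite ler_pdivrMr// mul1r lerDl.
  by rewrite ler_pdivrMr// mul1r lerDl.
have -> : sg * (energy s - c (r s)) - mu * B (r s) - (sg * (energy t - c (r t)) - mu * B (r t)) =
  sg * (energy s - weight (r t) (x t) * B (r s) - (energy t - weight (r t) (x t) * B (r t)))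
  - sg * (c (r s) - c (r t) - weight (r t) (clamped_zero (r t)) * (B (r s) - B (r t)))
  + cf * (B (r s) - B (r t)) by rewrite /cf; ring.
have -> : e * (s - t) = e / 3 * (s - t) + e / 3 * (s - t) + e / 3 * (s - t) by field.
by rewrite lerD// lerD.
Qed.

End Lyapunov.
End Core.

(** * Orbits whose bid ratio does not converge *)

Section Oscillation.
Variables (R : realType) (A B C D : R -> R) (al be : R).
Implicit Types (s t u z a b e : R).
Hypothesis AD : forall z, 0 < z -> A z + D z = al.
Hypothesis BC : forall z, 0 < z -> B z + C z = be.
Hypothesis dA : forall z u, 0 < z -> z < u ->
  z * (B z - B u) <= A z - A u <= u * (B z - B u).
Hypothesis dB : forall z u, 0 < z -> z < u -> B u < B z.
Hypothesis B_ge0 : forall z, 0 < z -> 0 <= B z.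
Hypothesis rB_le_A : forall z, 0 < z -> z * B z <= A z.
Variables (lo hi L : R).
Hypothesis lo0 : 0 < lo.
Hypothesis L0 : 0 <= L.
Hypothesis lipB : forall z u, lo <= z -> z < u -> u <= hi -> B z - B u <= L * (u - z).
Variables (x r : R -> R) (t0 K k1 k2 : R).
Hypothesis rI : forall t, t0 <= t -> k1 <= r t <= k2.
Hypothesis lok1 : lo < k1.
Hypothesis k2hi : k2 < hi.
Hypothesis x1 : forall t, t0 <= t -> 1 < x t <= K.
Hypothesis rx1 : forall t, t0 <= t -> 1 < r t * x t.
Local Notation n0 := (drift_cst A C).
Local Notation q := (drift_slope B D).
Local Notation N := (drift A B C D x r).
Local Notation psi := (drift_zero A B C D).
Local Notation clamp := (clamped_zero A B C D K).
Local Notation w := (@weight R).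
Local Notation low := (@orbit_floor R).
Hypothesis dx : forall t, t0 <= t -> deriv_at x t (A (r t) - r t * x t * B (r t)).
Hypothesis dr : forall t, t0 <= t -> deriv_at r t (N t / x t).
Variables (r1 r2 : R).
Hypothesis k1r1 : k1 <= r1.
Hypothesis r12 : r1 < r2.
Hypothesis r2k2 : r2 <= k2.
Hypothesis r_ev : forall e, 0 < e -> exists2 T, t0 <= T & forall t, T <= t -> r1 - e < r t < r2 + e.
Hypothesis r_low : forall e T, 0 < e -> exists2 t, T <= t & r t < r1 + e.
Hypothesis r_high : forall e T, 0 < e -> exists2 t, T <= t & r2 - e < r t.

Let lip_B' : lip_on lo hi B := lip_B dB lo0 L0 lipB.
Let lip_A' : lip_on lo hi A := lip_A dA dB lo0 L0 lipB.
Let lip_n0' : lip_on lo hi n0 := lip_drift_cst BC dA dB lo0 L0 lipB.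
Let lip_q' : lip_on lo hi q := lip_drift_slope AD dA dB lo0 L0 lipB.

Let rI' t : t0 <= t -> lo < r t < hi.
Proof. by move=> /rI /andP[h1 h2]; rewrite (lt_le_trans lok1 h1) (le_lt_trans h2 k2hi). Qed.

Let rIc t : t0 <= t -> lo <= r t <= hi.
Proof. by move=> /rI' /andP[/ltW -> /ltW ->]. Qed.

Let rcl z : r1 <= z <= r2 -> lo < z < hi.
Proof.
by move=> /andP[h1 h2]; rewrite (lt_le_trans lok1 (le_trans k1r1 h1)) (le_lt_trans (le_trans h2 r2k2) k2hi).
Qed.

Let rop z : r1 < z < r2 -> lo < z < hi.
Proof. by move=> /andP[/ltW h1 /ltW h2]; apply: rcl; rewrite h1. Qed.

Let cr t : t0 <= t -> cont_at r t.
Proof. by move=> /dr /deriv_at_cont. Qed.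

Let x_gt0 t : t0 <= t -> 0 < x t.
Proof. by move=> /x1 /andP[/(lt_trans ltr01)]. Qed.

Lemma cross_up z u T : r1 < z -> z < u -> u < r2 -> t0 <= T ->
  exists s t, [/\ T <= s, s < t, r s = z, r t = u & forall v, s <= v <= t -> z <= r v <= u].
Proof.
move=> z1 zu u2 tT.
have e1 : 0 < z - r1 by rewrite subr_gt0.
have [a Ta ra] := r_low T e1.
have e2 : 0 < r2 - u by rewrite subr_gt0.
have [b ab rb] := r_high a e2.
have [|||s [t [as_ /andP[st tb] rs rt H]]] := @crossing_up _ r a b z u ab zu.
- by move=> v /andP[av _]; apply/cr/(le_trans tT)/(le_trans Ta).
- by move: ra; rewrite subrKC => /ltW.
- by move: rb; rewrite opprB addrC subrK => /ltW.
by exists s, t; split=> //; exact: le_trans as_.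
Qed.

Lemma cross_down z u T : r1 < z -> z < u -> u < r2 -> t0 <= T ->
  exists s t, [/\ T <= s, s < t, r s = u, r t = z & forall v, s <= v <= t -> z <= r v <= u].
Proof.
move=> z1 zu u2 tT.
have e2 : 0 < r2 - u by rewrite subr_gt0.
have [a Ta ra] := r_high T e2.
have e1 : 0 < z - r1 by rewrite subr_gt0.
have [b ab rb] := r_low a e1.
have [|||s [t [as_ /andP[st tb] rs rt H]]] := @crossing_down _ r a b z u ab zu.
- by move=> v /andP[av _]; apply/cr/(le_trans tT)/(le_trans Ta).
- by move: ra; rewrite opprB addrC subrK => /ltW.
- by move: rb; rewrite subrKC => /ltW.
by exists s, t; split=> //; exact: le_trans as_.
Qed.

(** At the start of an upward passage [r] cannot have negative speed. *)
Lemma cross_N_ge0 z : r1 < z < r2 -> exists t, [/\ t0 <= t, r t = z & 0 <= N t].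
Proof.
move=> /andP[z1 z2].
have [s [t [ts st rs _ H]]] := @cross_up z ((z + r2) / 2) t0 z1 (midf_lt z2).1 (midf_lt z2).2 (lexx _).
exists s; split=> //; rewrite leNgt; apply/negP => Ns.
have Nx : 0 < - (N s / x s) by rewrite oppr_gt0 pmulr_llt0 ?invr_gt0// x_gt0.
have [d d0 Hd] := deriv_at_gt0 (deriv_atN (dr ts)) Nx.
pose v := Num.min t (s + d / 2).
have sv : s < v by rewrite lt_min st/=; lra.
have vd : v <= s + d / 2 by rewrite ge_min lexx orbT.
have [] := Hd v; first by rewrite gtr0_norm; lra.
move=> /(_ sv); rewrite ltrN2 => rv _.
have := H v; rewrite (ltW sv) ge_min lexx => /(_ isT) /andP[]; rewrite -rs; lra.
Qed.

Lemma cross_N_le0 z : r1 < z < r2 -> exists t, [/\ t0 <= t, r t = z & N t <= 0].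
Proof.
move=> /andP[z1 z2].
have [s [t [ts st rs _ H]]] := @cross_down ((r1 + z) / 2) z t0 (midf_lt z1).1 (midf_lt z1).2 z2 (lexx _).
exists s; split=> //; rewrite leNgt; apply/negP => Ns.
have Nx : 0 < N s / x s by rewrite divr_gt0// x_gt0.
have [d d0 Hd] := deriv_at_gt0 (dr ts) Nx.
pose v := Num.min t (s + d / 2).
have sv : s < v by rewrite lt_min st/=; lra.
have vd : v <= s + d / 2 by rewrite ge_min lexx orbT.
have [] := Hd v; first by rewrite gtr0_norm; lra.
move=> /(_ sv) => rv _.
have := H v; rewrite (ltW sv) ge_min lexx => /(_ isT) /andP[_]; rewrite -rs; lra.
Qed.

(* When N vanishes identically on the line r = z that line is invariant: N is
   Lipschitz in r, so (r - z)^2 exp(2 l t) is nondecreasing for large l. *)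
Lemma invariant_line z T : lo < z < hi -> n0 z = 0 -> q z = 0 -> t0 <= T -> r T != z ->
  forall t, T <= t -> r t != z.
Proof.
move=> zI nz qz tT rT t Tt.
have [l1 l10 H1] := lip_n0'; have [l2 l20 H2] := lip_q'.
have K0 : 0 <= K by have /andP[/(lt_trans ltr01) h1 h2] := x1 tT; rewrite ltW// (lt_le_trans h1).
have zI' : lo <= z <= hi by move/andP: zI => [/ltW -> /ltW ->].
pose l := l1 + K * l2.
have dl u : t0 <= u -> `|N u / x u| <= l * `|r u - z|.
  move=> tu; have /andP[x1u xK] := x1 tu; have x0 := x_gt0 tu.
  rewrite normrM normrV ?unitfE ?gt_eqF// (gtr0_norm x0) ler_pdivrMr//.
  have -> : N u = (n0 (r u) - n0 z) + x u * (q (r u) - q z) by rewrite nz qz !subr0.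
  rewrite (le_trans (ler_normD _ _))// normrM (gtr0_norm x0).
  have h1 := H1 _ _ (rIc tu) zI'; have h2 := H2 _ _ (rIc tu) zI'.
  rewrite (le_trans (lerD h1 (ler_wpM2l (ltW x0) h2)))//.
  have -> : l1 * `|r u - z| + x u * (l2 * `|r u - z|) = (l1 + x u * l2) * `|r u - z| by ring.
  rewrite -mulrA (mulrC _ (x u)) mulrA ler_wpM2r// (@le_trans _ _ l)//.
    by rewrite lerD2l ler_wpM2r.
  by rewrite ler_peMr ?addr_ge0 ?mulr_ge0// ltW.
pose g u := (r u - z) * (r u - z) * expR (2 * l * u).
have [E|Tt'] := eqVneq T t; first by rewrite -E.
have {}Tt' : T < t by rewrite lt_neqAle Tt'.
pose dg u := (r u - z) * (r u - z) * (expR (2 * l * u) * (2 * l)) +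
   expR (2 * l * u) * (2 * ((r u - z) * (N u / x u))).
have [u /andP[Tu ut]|c /andP[/ltW Tc _] E] := @deriv_at_mvt _ g dg T t Tt'.
  have tu := le_trans tT Tu.
  have D1 := deriv_atB (dr tu) (deriv_at_cst z u).
  have D2 : deriv_at (fun s => expR (2 * l * s)) u (expR (2 * l * u) * (2 * l)).
    apply: (@deriv_at_comp _ (fun s => 2 * l * s) expR).
      apply: deriv_at_eq (deriv_atM (deriv_at_cst (2 * l) u) (deriv_at_id u)) _.
      by ring.
    by apply/deriv_atP; exact: is_derive_expR.
  by apply: deriv_at_eq (deriv_atM (deriv_atM D1 D1) D2) _; rewrite /dg; ring.
have tc := le_trans tT Tc.
have dg0 : 0 <= dg c.
  have -> : dg c = 2 * expR (2 * l * c) * (l * (`|r c - z| * `|r c - z|) + (r c - z) * (N c / x c)).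
    by rewrite -normrM ger0_norm ?mulr_sg// -?expr2 ?sqr_ge0// /dg; ring.
  rewrite mulr_ge0 ?mulr_ge0 ?expR_ge0// -lerBlDr sub0r (le_trans (ler_norm _))// normrN.
  have -> : l * (`|r c - z| * `|r c - z|) = `|r c - z| * (l * `|r c - z|) by ring.
  by rewrite normrM ler_wpM2l// dl.
have gT : 0 < g T.
  by rewrite mulr_gt0 ?expR_gt0// lt_neqAle eq_sym -expr2 sqr_ge0 sqrf_eq0 subr_eq0 rT.
apply/eqP => rt; have : g t = 0 by rewrite /g rt subrr !mul0r.
have : 0 <= dg c * (t - T) by rewrite mulr_ge0// subr_ge0 ltW.
by rewrite -E; lra.
Qed.

(** Crossings exist at interior levels only; the end levels [r1] and [r2] are reached from there by
    continuity. *)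
Lemma dense_open z d : r1 <= z <= r2 -> 0 < d -> exists2 u, r1 < u < r2 & `|u - z| < d.
Proof.
move=> zc d0.
have [z2|z2] := ltP z r2.
  pose v := Num.min ((z + r2) / 2) (z + d / 2).
  have v1 : z < v by rewrite lt_min; apply/andP; split; lra.
  have v2 : v <= z + d / 2 by rewrite ge_min lexx orbT.
  have v3 : v <= (z + r2) / 2 by rewrite ge_min lexx.
  exists v; first lra.
  by rewrite gtr0_norm; lra.
pose v := Num.max ((r1 + r2) / 2) (z - d / 2).
have v2 : z - d / 2 <= v by rewrite le_max lexx orbT.
have v3 : (r1 + r2) / 2 <= v by rewrite le_max lexx.
have := r12 => r12'.
have v1 : v < z by rewrite gt_max; apply/andP; split; lra.
exists v; first lra.
by rewrite ltr0_norm; lra.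
Qed.

(** If [n0 z] were nonzero then, [x] being bounded by [K], [N] would keep the sign of [n0 z] on
    every nearby line r = u, which could then not be crossed in both directions. *)
Lemma n0_eq0 z : r1 <= z <= r2 -> q z = 0 -> n0 z = 0.
Proof.
move=> zc qz; have zI := rcl zc.
have K0 : 0 < K by have /andP[/(lt_trans ltr01) h1 h2] := x1 (lexx t0); rewrite (lt_le_trans h1).
apply/eqP; apply: contrapT => /negP nz.
have n2 : 0 < `|n0 z| / 2 by rewrite divr_gt0// normr_gt0.
have [d1 d10 H1] := lip_on_cont lip_n0' zI n2.
have nK : 0 < `|n0 z| / 2 / K by rewrite divr_gt0.
have [d2 d20 H2] := lip_on_cont lip_q' zI nK.
have d0 : 0 < Num.min d1 d2 by rewrite lt_min d10.
have [u uo] := dense_open zc d0.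
rewrite lt_min => /andP[/H1 {}H1 /H2 {}H2]; rewrite qz subr0 in H2.
have Nu t : t0 <= t -> r t = u -> `|N t - n0 z| < `|n0 z|.
  move=> tt rt; have /andP[x1t xK] := x1 tt; have x0 := x_gt0 tt.
  have -> : N t - n0 z = (n0 u - n0 z) + x t * q u by rewrite /drift rt; ring.
  rewrite (le_lt_trans (ler_normD _ _))// [ltRHS]splitr ltrD// normrM (gtr0_norm x0).
  move: H2; rewrite ltr_pdivlMr// mulrC; apply: le_lt_trans.
  by rewrite ler_wpM2r.
have [t [tt rt Nt]] := cross_N_ge0 uo; have [v [tv rv Nv]] := cross_N_le0 uo.
have := Nu _ tt rt; have := Nu _ tv rv.
move: nz; rewrite neq_lt => /orP[nz|nz].
  by rewrite (ltr0_norm nz) => _ /ltr_normlP[]; lra.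
by rewrite (gtr0_norm nz) => /ltr_normlP[]; lra.
Qed.

(** Otherwise [N] vanishes on the whole line r = z, which cannot be reached from outside by
    [invariant_line]; yet downward passages end on it. *)
Lemma q_neq0 z : r1 < z < r2 -> q z != 0.
Proof.
move=> zo; have zI := rop zo; move/andP: (zo) => [z1 z2].
apply/eqP => qz; have nz : n0 z = 0 by apply: n0_eq0 => //; rewrite !ltW.
have [s [t [ts st rs rt H]]] :=
  @cross_down z ((z + r2) / 2) t0 z1 (midf_lt z2).1 (midf_lt z2).2 (lexx _).
have rsz : r s != z by rewrite rs gt_eqF// midf_lt.
have := invariant_line zI nz qz ts rsz (ltW st).
by rewrite rt eqxx.
Qed.

(** Carries the constant sign of [q] on the strip; its modulus only rescales the Lyapunov
    function. *)
Definition sg := q ((r1 + r2) / 2).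

Let mido : r1 < (r1 + r2) / 2 < r2.
Proof. by rewrite !midf_lt. Qed.

Lemma q_sign z : r1 < z < r2 -> 0 < sg * q z.
Proof.
move=> /andP[z1 z2]; have /andP[m1 m2] := mido.
have H a b : r1 < a -> a <= b -> b < r2 -> 0 < q a * q b.
  move=> a1 ab b2; apply: ivt_sign => // v /andP[av vb].
    by apply: lip_on_cont lip_q' _; apply: rop; rewrite (lt_le_trans a1) ?(le_lt_trans vb).
  by apply: q_neq0; rewrite (lt_le_trans a1) ?(le_lt_trans vb).
have [zm|mz] := leP z ((r1 + r2) / 2); first by rewrite mulrC; exact: H.
by apply: H => //; exact: ltW.
Qed.

Let sg_neq0 : sg != 0.
Proof. exact: q_neq0 mido. Qed.

Lemma q_sign_near z : r1 <= z <= r2 -> q z != 0 -> exists2 d, 0 < d &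
  forall u, `|u - z| < d -> 0 < sg * q u.
Proof.
move=> zc qz; have zI := rcl zc.
have h0 : 0 <= sg * q z.
  rewrite leNgt; apply/negP => h.
  have c : cont_at (fun u => sg * q u) z.
    by apply: cont_atM; [exact: cont_at_cst | exact: lip_on_cont lip_q' zI].
  have h' : 0 < - (sg * q z) by rewrite oppr_gt0.
  have [d d0 H] := c _ h'.
  have [u uo ud] := dense_open zc d0.
  have := H _ ud; have := q_sign uo; move=> ? /ltr_normlP[]; lra.
have h : 0 < sg * q z by rewrite lt_neqAle h0 andbT eq_sym mulf_neq0.
have c : cont_at (fun u => sg * q u) z.
  by apply: cont_atM; [exact: cont_at_cst | exact: lip_on_cont lip_q' zI].
have [d d0 H] := c _ h; exists d => // u /H /ltr_normlP[]; lra.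
Qed.
(** The orbit may exceed [r2] again and again, by less and less, but the strip must contain a whole
    tail of it. Either [q r2 = 0], and the invariant line r = r2 confines the orbit below it from
    some time on, or [q] keeps its sign slightly beyond [r2]. *)
Lemma right_end : exists j2, [/\ r2 <= j2, j2 < hi,
  forall z, r1 < z < j2 -> 0 < sg * q z &
  exists2 T, t0 <= T & forall t, T <= t -> r t < j2].
Proof.
have r2c : r1 <= r2 <= r2 by rewrite lexx ltW.
have r2I := rcl r2c; have /andP[_ r2h] := r2I.
have [qz|qz] := eqVneq (q r2) 0.
  exists r2; split=> //; first exact: q_sign.
  have nz := n0_eq0 r2c qz.
  have e0 : 0 < r2 - r1 by rewrite subr_gt0.
  have [T tT] := r_low t0 e0; rewrite subrKC => rT.
  exists T => // t Tt.
  have H := invariant_line r2I nz qz tT (negbT (lt_eqF rT)).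
  have := @ivt_sign _ (fun u => r u - r2) T t Tt _ _.
  rewrite nmulr_rgt0 ?subr_lt0//; apply => u /andP[Tu _].
    by apply: cont_atD; [exact/cr/(le_trans tT) | exact: cont_at_cst].
  by rewrite subr_eq0 H.
have [d d0 Hd] := q_sign_near r2c qz.
pose j2 := Num.min (r2 + d / 2) ((r2 + hi) / 2).
have j2a : r2 < j2 by rewrite lt_min; apply/andP; split; lra.
have j2b : j2 <= r2 + d / 2 by rewrite ge_min lexx.
have j2c : j2 <= (r2 + hi) / 2 by rewrite ge_min lexx orbT.
exists j2; split; [exact: ltW | lra | |].
  move=> z /andP[z1 z2]; have [zr|zr] := ltP z r2; first by apply: q_sign; rewrite z1.
  by apply: Hd; rewrite ger0_norm; lra.
have e0 : 0 < j2 - r2 by rewrite subr_gt0.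
have [T tT H] := r_ev e0; exists T => // t /H /andP[_]; lra.
Qed.

Lemma left_end : exists j1, [/\ j1 <= r1, lo < j1,
  forall z, j1 < z < r2 -> 0 < sg * q z &
  exists2 T, t0 <= T & forall t, T <= t -> j1 < r t].
Proof.
have r1c : r1 <= r1 <= r2 by rewrite lexx ltW.
have r1I := rcl r1c; have /andP[r1l _] := r1I.
have [qz|qz] := eqVneq (q r1) 0.
  exists r1; split=> //; first exact: q_sign.
  have nz := n0_eq0 r1c qz.
  have e0 : 0 < r2 - r1 by rewrite subr_gt0.
  have [T tT] := r_high t0 e0; rewrite opprB addrC subrK => rT.
  exists T => // t Tt.
  have H := invariant_line r1I nz qz tT (negbT (gt_eqF rT)).
  have := @ivt_sign _ (fun u => r u - r1) T t Tt _ _.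
  rewrite pmulr_rgt0 ?subr_gt0//; apply => u /andP[Tu _].
    by apply: cont_atD; [exact/cr/(le_trans tT) | exact: cont_at_cst].
  by rewrite subr_eq0 H.
have [d d0 Hd] := q_sign_near r1c qz.
pose j1 := Num.max (r1 - d / 2) ((lo + r1) / 2).
have j1a : j1 < r1 by rewrite gt_max; apply/andP; split; lra.
have j1b : r1 - d / 2 <= j1 by rewrite le_max lexx.
have j1c : (lo + r1) / 2 <= j1 by rewrite le_max lexx orbT.
exists j1; split; [exact: ltW | lra | |].
  move=> z /andP[z1 z2]; have [zr|zr] := ltP r1 z; first by apply: q_sign; rewrite zr.
  by apply: Hd; rewrite ler0_norm; lra.
have e0 : 0 < r1 - j1 by rewrite subr_gt0.
have [T tT H] := r_ev e0; exists T => // t /H /andP[]; lra.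
Qed.

Lemma lyapunov_osc : exists (V : R -> R) (T1 : R), [/\ t0 < T1,
  exists m, forall t, T1 <= t -> m <= V t,
  forall s t, T1 <= s -> s <= t -> V t <= V s &
  forall mu s t, T1 <= s -> s <= t ->
    (forall u, s <= u <= t -> 0 <= (sg * (w (r u) (x u) - w (r u) (clamp (r u))) - mu) * N u) ->
    V t - mu * B (r t) <= V s - mu * B (r s)].
Proof.
have [j1 [j1r loj qj1 [T tT HT]]] := left_end.
have [j2 [j2r jhi qj2 [T' tT' HT']]] := right_end.
have j12 : j1 < j2 by rewrite (le_lt_trans j1r)// (lt_le_trans r12).
have qj z : j1 < z < j2 -> 0 < sg * q z.
  move=> /andP[z1 z2]; have [zr|zr] := ltP r1 z; first by apply: qj2; rewrite zr.
  by apply: qj1; rewrite z1 (le_lt_trans zr).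
have [V [_ [m Vm] VB]] := lyapunov AD BC dA dB lo0 L0 lipB rI lok1 k2hi x1 dx dr loj jhi j12 qj.
pose T1 := Num.max (Num.max T T') (t0 + 1).
have TT : T <= T1 by rewrite !le_max lexx.
have TT' : T' <= T1 by rewrite !le_max lexx orbT.
have tT1 : t0 < T1 by rewrite lt_max; apply/orP; right; lra.
have rj t : T1 <= t -> j1 < r t < j2.
  by move=> Tt; rewrite HT ?HT'//; [exact: le_trans TT' _ | exact: le_trans TT _].
exists V, T1; split=> //.
- by exists m => t Tt; apply: Vm; [exact: lt_le_trans Tt | exact: rj].
- move=> s t Ts st; have := VB 0 s t (lt_le_trans tT1 Ts) st; rewrite !mul0r !subr0; apply.
  move=> u /andP[su _]; have Tu := le_trans Ts su; split; first exact: rj.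
  have tu := le_trans (ltW tT1) Tu.
  have := weight_clamp A C lo0 rI lok1 k2hi x1 rx1 qj tu (rj _ Tu).
  by rewrite subr0 mulrCA mulrA.
move=> mu s t Ts st H; apply: VB => //; first exact: lt_le_trans Ts.
by move=> u /[dup] us /andP[su _]; split; [exact/rj/(le_trans Ts) | exact: H].
Qed.

(** [N] takes a nonnegative and a nonpositive value on the line r = z, so [psi z] lies between two
    values of [x] attained by the orbit. Clamping is therefore inactive between [r1] and [r2]. *)
Lemma psi_range z : r1 < z < r2 -> low z <= psi z <= K.
Proof.
move=> zo; have qz := q_sign zo; have qn := q_neq0 zo.
have NE t : r t = z -> sg * N t = (sg * q z) * (x t - psi z).
  by move=> rt; rewrite /drift /drift_zero rt; field.
have [t [tt rt Nt]] := cross_N_ge0 zo; have [v [tv rv Nv]] := cross_N_le0 zo.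
have lt_ : low z <= x t by rewrite -rt; have := orbit_floor_le lo0 rI lok1 k2hi x1 rx1 tt.
have lv : low z <= x v by rewrite -rv; have := orbit_floor_le lo0 rI lok1 k2hi x1 rx1 tv.
have /andP[_ xt] := x1 tt; have /andP[_ xv] := x1 tv.
have Et := NE _ rt; have Ev := NE _ rv.
have [sg0|sg0] := leP sg 0.
  have h1 : x t - psi z <= 0 by rewrite -(pmulr_rle0 _ qz) -Et mulr_le0_ge0.
  have h2 : 0 <= x v - psi z by rewrite -(pmulr_rge0 _ qz) -Ev mulr_le0.
  by apply/andP; split; lra.
have h1 : 0 <= x t - psi z by rewrite -(pmulr_rge0 _ qz) -Et mulr_ge0// ltW.
have h2 : x v - psi z <= 0 by rewrite -(pmulr_rle0 _ qz) -Ev mulr_ge0_le0// ltW.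
by apply/andP; split; lra.
Qed.

Lemma clampE z : r1 < z < r2 -> clamp z = psi z.
Proof.
by move=> /psi_range /andP[h1 h2]; rewrite /clamped_zero (min_r h2) (max_r h1).
Qed.

(** Since [N] is [q * (x - psi)] with [q] bounded, a large [N] keeps [x] away from [psi], and
    [weight_incr] converts this distance into a gap of the weights. *)
Lemma w_gap e : 0 < e -> exists2 k, 0 < k & forall u, t0 <= u -> r1 < r u < r2 ->
  (e <= N u -> k <= sg * (w (r u) (x u) - w (r u) (clamp (r u)))) /\
  (N u <= - e -> sg * (w (r u) (x u) - w (r u) (clamp (r u))) <= - k).
Proof.
move=> e0; have [Q Q0 qb] := lip_on_bound lip_q'.
have Q1 : 0 < Q + 1 by lra.
pose g := e / (Q + 1); have g0 : 0 < g by rewrite divr_gt0.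
have sgp : 0 < `|sg| by rewrite normr_gt0.
(* [g] bounds the distance of [x] from [psi] from below, and [lo] bounds [r * (r + 1)] from
   below. *)
exists (`|sg| * (g * g * lo / 2)); first by rewrite !mulr_gt0// ?invr_gt0.
move=> u tu ro; rewrite clampE//.
have qz := q_sign ro; have qn := q_neq0 ro.
have /andP[l1 _] := psi_range ro.
have r0 : 0 < r u by have := rI' tu; have := lo0; lra.
have [m1 m2] := orbit_floor_ge1 r0.
have p1 : 1 <= psi (r u) := le_trans m1 l1.
have p2 : 1 <= r u * psi (r u) by rewrite (le_trans m2)// ler_pM2l.
have /andP[/ltW y1 _] := x1 tu; have /ltW y2 := rx1 tu.
have NE : N u = q (r u) * (x u - psi (r u)) by rewrite /drift /drift_zero; field.
have qQ : `|q (r u)| <= Q by apply: qb; exact: rIc.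
have lor : lo <= r u * (r u + 1).
  have := rI' tu; have := lo0 => lo0' /andP[h1 _].
  by rewrite -[lo]mulr1 ler_pM// ?ltW//; lra.
have big d : g <= d -> g * g * lo / 2 <= d * d * (r u * (r u + 1)) / 2.
  move=> gd; have g0' := ltW g0; have lo0' := ltW lo0.
  rewrite ler_pM2r ?invr_gt0//; apply: ler_pM => //; first exact: mulr_ge0.
  exact: ler_pM.
have gap : e <= `|N u| -> g <= `|x u - psi (r u)|.
  move=> eN; rewrite /g ler_pdivrMr//; apply: le_trans eN _.
  by rewrite NE normrM mulrC ler_wpM2l// (le_trans qQ)// lerDl.
have up : psi (r u) <= x u -> g <= `|x u - psi (r u)| ->
    g * g * lo / 2 <= w (r u) (x u) - w (r u) (psi (r u)).
  move=> px; rewrite ger0_norm ?subr_ge0// => /big gb.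
  exact: le_trans gb (weight_incr r0 p1 y1 p2 y2 px).
have dn : x u <= psi (r u) -> g <= `|x u - psi (r u)| ->
    g * g * lo / 2 <= w (r u) (psi (r u)) - w (r u) (x u).
  move=> px; rewrite ler0_norm ?subr_le0// opprB => /big gb.
  exact: le_trans gb (weight_incr r0 y1 p1 y2 p2 px).
have sE : sg * N u = (sg * q (r u)) * (x u - psi (r u)) by rewrite NE mulrA.
split=> h.
  have N0 : 0 < N u by exact: lt_le_trans h.
  have {}gap : g <= `|x u - psi (r u)| by apply: gap; rewrite gtr0_norm.
  have [sn|sp|E] := ltgtP sg 0; last by move: sgp; rewrite E normr0 ltxx.
    rewrite (ltr0_norm sn) mulNr -mulrN ler_wnM2l//; first exact: ltW.
    rewrite lerNr opprB; apply: dn gap; rewrite -subr_le0 -(pmulr_rle0 _ qz) -sE.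
    by rewrite mulr_le0_ge0// ltW.
  rewrite (gtr0_norm sp) ler_pM2l//; apply: up gap.
  by rewrite -subr_ge0 -(pmulr_rge0 _ qz) -sE mulr_ge0// ltW.
have N0 : N u < 0 by apply: le_lt_trans h _; rewrite oppr_lt0.
have {}gap : g <= `|x u - psi (r u)| by apply: gap; rewrite ltr0_norm// lerNr.
have [sn|sp|E] := ltgtP sg 0; last by move: sgp; rewrite E normr0 ltxx.
  rewrite (ltr0_norm sn) mulNr opprK ler_nM2l//; apply: up gap.
  by rewrite -subr_ge0 -(pmulr_rge0 _ qz) -sE mulr_le0// ltW.
rewrite (gtr0_norm sp) -mulrN ler_pM2l// lerNr opprB; apply: dn gap.
by rewrite -subr_le0 -(pmulr_rle0 _ qz) -sE mulr_ge0_le0// ltW.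
Qed.

Let K_gt0 : 0 < K.
Proof. by have /andP[/(lt_trans ltr01) h1 h2] := x1 (lexx t0); rewrite (lt_le_trans h1). Qed.

Lemma N_bound : exists2 M, 0 < M & forall t, t0 <= t -> `|N t| <= M.
Proof.
have [n n_0 nb] := lip_on_bound lip_n0'; have [Q Q0 qb] := lip_on_bound lip_q'.
have K0 := ltW K_gt0.
exists (n + K * Q + 1); first by rewrite ltr_wpDl// addr_ge0// mulr_ge0.
move=> t tt; rewrite (le_trans (ler_normD _ _))// (@le_trans _ _ (n + K * Q))//; last by rewrite lerDl.
have /andP[_ xK] := x1 tt; have x0 := ltW (x_gt0 tt).
rewrite lerD ?nb ?rIc// normrM (ger0_norm x0) ler_pM// qb// rIc//.
Qed.

Lemma r_lipschitz : exists2 M, 0 < M &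
  forall s t, t0 <= s -> t0 <= t -> `|r s - r t| <= M * `|s - t|.
Proof.
have [M M0 HM] := N_bound; exists M => //; apply: (deriv_lipschitz dr) => t tt.
have /andP[xt _] := x1 tt; have x0 := x_gt0 tt.
rewrite normrM normrV ?unitfE ?gt_eqF// (gtr0_norm x0) ler_pdivrMr//.
by rewrite (le_trans (HM _ tt))// ler_peMr// ltW.
Qed.

Lemma x_lipschitz : exists2 M, 0 < M &
  forall s t, t0 <= s -> t0 <= t -> `|x s - x t| <= M * `|s - t|.
Proof.
have [a a0 Ab] := lip_on_bound lip_A'.
have [b b0 Bb] := lip_on_bound (lip_onM (@lip_on_id _ lo hi) lip_B').
have K0 := ltW K_gt0.
exists (a + K * b + 1); first by rewrite ltr_wpDl// addr_ge0// mulr_ge0.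
apply: (deriv_lipschitz dx) => t tt.
have /andP[_ xK] := x1 tt; have x0 := ltW (x_gt0 tt).
rewrite (le_trans (ler_normB _ _))// (@le_trans _ _ (a + K * b))//; last by rewrite lerDl.
rewrite lerD ?Ab ?rIc//.
have -> : r t * x t * B (r t) = x t * (r t * B (r t)) by ring.
by rewrite normrM (ger0_norm x0) ler_pM// Bb// rIc.
Qed.

Lemma N_lipschitz : exists2 M, 0 < M &
  forall s t, t0 <= s -> t0 <= t -> `|N s - N t| <= M * `|s - t|.
Proof.
have [ln ln0 Hn] := lip_n0'; have [lq lq0 Hq] := lip_q'.
have [Q Q0 qb] := lip_on_bound lip_q'.
have [Mr Mr0 Hr] := r_lipschitz; have [Mx Mx0 Hx] := x_lipschitz.
have K0 := ltW K_gt0.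
exists (ln * Mr + (K * (lq * Mr) + Q * Mx) + 1).
  by rewrite ltr_wpDl// !addr_ge0// !mulr_ge0// ltW.
move=> s t ts tt; have Ds := Hr _ _ ts tt; have Dx := Hx _ _ ts tt.
rewrite (@le_trans _ _ ((ln * Mr + (K * (lq * Mr) + Q * Mx)) * `|s - t|))//; last first.
  by rewrite ler_wpM2r// lerDl.
have -> : N s - N t = (n0 (r s) - n0 (r t)) +
   (x s * (q (r s) - q (r t)) + q (r t) * (x s - x t)) by rewrite /drift; ring.
have /andP[_ xK] := x1 ts; have x0 := ltW (x_gt0 ts).
have -> : (ln * Mr + (K * (lq * Mr) + Q * Mx)) * `|s - t| =
  ln * (Mr * `|s - t|) + (K * (lq * (Mr * `|s - t|)) + Q * (Mx * `|s - t|)) by ring.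
rewrite (le_trans (ler_normD _ _))// lerD//.
  by rewrite (le_trans (Hn _ _ (rIc ts) (rIc tt)))// ler_wpM2l.
rewrite (le_trans (ler_normD _ _))// lerD// normrM ler_pM//.
- by rewrite ger0_norm.
- by rewrite (le_trans (Hq _ _ (rIc ts) (rIc tt)))// ler_wpM2l.
- by rewrite qb// rIc.
Qed.

(** Compactness makes the strict decrease of [B] uniform. *)
Lemma B_gap a b d : r1 < a -> a <= b -> b < r2 -> 0 < d -> exists2 k, 0 < k &
  forall z u, a <= z <= b -> z + d <= u -> k <= B z - B u.
Proof.
move=> a1 ab b2 d0.
have bI : lo < b < hi by apply: rop; rewrite b2 (lt_le_trans a1).
have aI : lo < a < hi by apply: rop; rewrite a1 (le_lt_trans ab).
have lo0' := lo0.
(* The step is shortened so that [z + d'] stays below [hi], where continuity of [B] is known. *)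
pose d' := Num.min d ((hi - b) / 2).
have d'0 : 0 < d' by rewrite lt_min d0/=; lra.
have d'd : d' <= d by rewrite ge_min lexx.
have d'h : d' <= (hi - b) / 2 by rewrite ge_min lexx orbT.
have [z|c cab Hc] := @EVT_min _ (fun z => B z - B (z + d')) a b ab.
  apply: cont_at_within => {}z zab.
  apply: cont_atD; first by apply: lip_on_cont lip_B' _; lra.
  apply/cont_atN; apply: (@cont_at_comp _ (fun z => z + d') B).
    by apply: cont_atD; [exact: cont_at_id | exact: cont_at_cst].
  by apply: lip_on_cont lip_B' _; lra.
move: cab; rewrite in_itv/= => cab.
exists (B c - B (c + d')); first by rewrite subr_gt0; apply: dB; lra.
move=> z u zab zu; have zi : z \in `[a, b] by rewrite in_itv.
have := Hc z zi => h; apply: le_trans h _; rewrite lerD2l lerN2.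
have : z + d' <= u by lra.
rewrite le_eqVlt => /predU1P[->//|/dB h]; apply/ltW/h; lra.
Qed.

(** Once [|N|] exceeds [e] it stays above [e / 2] for a fixed time. Meanwhile [r] moves by at least
    [d] and [B] changes by at least [g], so monotonicity of [V - k * B] (or of [V + k * B] when
    [N < 0]) forces [V] down by [k * g]. *)
Lemma lyapunov_drop (V : R -> R) T1 a b e : t0 < T1 ->
  (forall mu s t, T1 <= s -> s <= t ->
    (forall u, s <= u <= t -> 0 <= (sg * (w (r u) (x u) - w (r u) (clamp (r u))) - mu) * N u) ->
    V t - mu * B (r t) <= V s - mu * B (r s)) ->
  r1 < a -> a <= b -> b < r2 -> 0 < e ->
  exists tau k, [/\ 0 < tau, 0 < k & forall t, T1 <= t -> a <= r t <= b -> e < `|N t| ->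
    V (t + tau) <= V t - k].
Proof.
move=> tT1 VB a1 ab b2 e0.
have [Mr Mr0 Hr] := r_lipschitz; have [MN MN0 HN] := N_lipschitz.
pose a' := (r1 + a) / 2; pose b' := (b + r2) / 2.
have /andP[a'1 a'a] : r1 < a' < a by rewrite !midf_lt.
have /andP[bb' b'2] : b < b' < r2 by rewrite !midf_lt.
(* Short enough for [r] to stay between [a'] and [b'] and for [N] to change by at most [e / 2]. *)
pose tau := Num.min (Num.min ((a - a') / Mr) ((b' - b) / Mr)) (e / 2 / MN).
have tau0 : 0 < tau by rewrite !lt_min !divr_gt0 ?subr_gt0.
have tau1 : Mr * tau <= a - a' by rewrite mulrC -ler_pdivlMr// !ge_min lexx.
have tau2 : Mr * tau <= b' - b by rewrite mulrC -ler_pdivlMr// !ge_min lexx orbT.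
have tau3 : MN * tau <= e / 2 by rewrite mulrC -ler_pdivlMr// !ge_min lexx !orbT.
have e2 : 0 < e / 2 by lra.
have [k k0 Hk] := w_gap e2.
have K0 := K_gt0.
(* The distance covered by [r], whose speed [N / x] is at least [e / 2 / K] in modulus. *)
pose d := e / 2 / K * tau.
have d0 : 0 < d by rewrite mulr_gt0// divr_gt0.
have a'b' : a' <= b' by lra.
have [g g0 Hg] := B_gap a'1 a'b' b'2 d0.
exists tau, (k * g); split=> //; first exact: mulr_gt0.
move=> t Tt rab eN; have tt : t0 <= t := le_trans (ltW tT1) Tt.
have win u : t <= u <= t + tau -> [/\ t0 <= u, a' <= r u <= b' & `|N u - N t| <= e / 2].
  move=> /andP[tu ut]; have tu0 := le_trans tt tu.
  have ut' : `|u - t| <= tau by rewrite ger0_norm ?subr_ge0// lerBlDl.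
  have h1 := le_trans (Hr _ _ tu0 tt) (ler_wpM2l (ltW Mr0) ut').
  have h2 := le_trans (HN _ _ tu0 tt) (ler_wpM2l (ltW MN0) ut').
  split=> //; last exact: le_trans h2 tau3.
  have /ler_normlP[h3 h4] := le_trans h1 tau1; have /ler_normlP[h5 h6] := le_trans h1 tau2.
  by move: rab => /andP[ra rb]; apply/andP; split; lra.
have tt' : t < t + tau by rewrite ltrDl.
have [ts rs _] := win (t + tau) (introT andP (conj (ltW tt') (lexx _))).
have [_ rt _] := win t (introT andP (conj (lexx _) (ltW tt'))).
have rmvt : exists2 c, t <= c <= t + tau & r (t + tau) - r t = N c / x c * tau.
  have [u /andP[tu _]|c /andP[/ltW h1 /ltW h2] E] := deriv_at_mvt tt' (df := fun t => N t / x t) (f := r).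
    by apply: dr; exact: le_trans tu.
  by exists c; rewrite ?h1// E addrC addKr.
have ro u : a' <= r u <= b' -> r1 < r u < r2.
  by move=> /andP[h1 h2]; rewrite (lt_le_trans a'1 h1) (le_lt_trans h2 b'2).
have xN u : t0 <= u -> e / 2 <= `|N u| -> e / 2 / K <= `|N u / x u|.
  move=> tu h; have /andP[_ xK] := x1 tu; have x0 := x_gt0 tu.
  rewrite normrM normrV ?unitfE ?gt_eqF// (gtr0_norm x0); apply: ler_pM => //.
  - exact: ltW.
  - by rewrite invr_ge0 ltW.
  - by rewrite lef_pV2 ?posrE.
have [c cw rc] := rmvt; have [tc rc' Nc] := win c cw; have xc := x_gt0 tc.
have [Np|Nn] := leP 0 (N t).
  have Nu u : t <= u <= t + tau -> e / 2 <= N u.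
    move=> /win[_ _ /ler_normlP[h _]]; rewrite (ger0_norm Np) in eN.
    by move: h eN; rewrite opprB; lra.
  have := VB k t (t + tau) Tt (ltW tt').
  have -> : k * B (r (t + tau)) = k * B (r t) - k * (B (r t) - B (r (t + tau))) by ring.
  move=> /(_ _) h.
  have {}h : V (t + tau) - (k * B (r t) - k * (B (r t) - B (r (t + tau)))) <= V t - k * B (r t).
    apply: h => u uw; have [tu ru _] := win u uw; have [h _] := Hk u tu (ro _ ru).
    rewrite mulr_ge0//; first by rewrite subr_ge0 h// Nu.
    by rewrite (le_trans (ltW e2))// Nu.
  have dd : r t + d <= r (t + tau).
    rewrite -lerBrDl rc /d ler_pM2r//.
    have := xN c tc; rewrite (ger0_norm (_ : 0 <= N c)) ?(le_trans (ltW e2)) ?Nu//.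
    by rewrite ger0_norm ?divr_ge0 ?(ltW xc) ?(le_trans (ltW e2)) ?Nu// => ->.
  have := ler_wpM2l (ltW k0) (Hg _ _ rt dd).
  by move: h; clear dd; set p := k * (_ - _); set p' := k * g; lra.
have Nu u : t <= u <= t + tau -> N u <= - (e / 2).
  move=> /win[_ _ /ler_normlP[_ h]]; rewrite (ltr0_norm Nn) in eN.
  by move: h eN; lra.
have := VB (- k) t (t + tau) Tt (ltW tt').
have -> : - k * B (r (t + tau)) = - k * B (r t) - k * (B (r (t + tau)) - B (r t)) by ring.
move=> /(_ _) h.
have {}h : V (t + tau) - (- k * B (r t) - k * (B (r (t + tau)) - B (r t))) <= V t - - k * B (r t).
  apply: h => u uw; have [tu ru _] := win u uw; have [_ h] := Hk u tu (ro _ ru).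
  rewrite mulr_le0//; first by rewrite subr_le0 h// Nu.
  by rewrite (le_trans (Nu _ uw))// oppr_le0 ltW.
have Nc0 : N c <= 0 by rewrite (le_trans (Nu _ cw))// oppr_le0 ltW.
have dd : r (t + tau) + d <= r t.
  rewrite -lerBrDl -opprB rc /d -mulNr ler_pM2r//.
  have := xN c tc; rewrite (ler0_norm Nc0) lerNr Nu// => /(_ isT).
  by rewrite ler0_norm// pmulr_lle0// invr_gt0.
have := ler_wpM2l (ltW k0) (Hg _ _ rs dd).
by move: h; clear dd; set p := k * (_ - _); set p' := k * g; lra.
Qed.

(** [V] is nonincreasing and bounded below: once it is within [k] of its infimum, no further drop by
    [k] can occur. *)
Lemma N_to0 a b e : r1 < a -> a <= b -> b < r2 -> 0 < e ->
  exists2 T, t0 <= T & forall t, T <= t -> a <= r t <= b -> `|N t| <= e.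
Proof.
move=> a1 ab b2 e0.
have [V [T1 [tT1 [m Vm] Vmono VB]]] := lyapunov_osc.
have [tau [k [tau0 k0 drop]]] := lyapunov_drop tT1 VB a1 ab b2 e0.
pose S := [set v | exists2 t, T1 <= t & v = V t].
have hS : has_inf S by split; [exists (V T1), T1 | exists m => v [t /Vm ? ->]].
have [v [T TT ->] VT] := inf_adherent k0 hS.
exists T; first exact: le_trans (ltW tT1) TT.
move=> t Tt rab; rewrite leNgt; apply/negP => eN.
have T1t := le_trans TT Tt.
have h1 := drop t T1t rab eN; have h2 := Vmono _ _ TT Tt.
have T1s : T1 <= t + tau by rewrite (le_trans T1t)// lerDl ltW.
have : inf S <= V (t + tau) by apply: ge_inf hS.2 _ _; exists (t + tau).
by lra.
Qed.

(** The left-hand side is [q z * X + z * B z * N], where X is the velocity of [x] on the line r = z;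
    x cancels. After a late passage through z, [N] is at most [e] during a fixed time. So [r] moves
    by O(e), and so does [x], because [q z] is nonzero; thus the mean velocity of [x], and X itself,
    are O(e). *)
Lemma nullclines_agree z : r1 < z < r2 -> A z * q z + z * B z * n0 z = 0.
Proof.
move=> /[dup] zo /andP[z1 z2]; have qn := q_neq0 zo.
have zI : lo <= z <= hi by have /andP[/ltW -> /ltW ->] := rop zo.
pose a := (r1 + z) / 2; pose b := (z + r2) / 2.
have /andP[a1 az] : r1 < a < z by rewrite !midf_lt.
have /andP[zb b2] : z < b < r2 by rewrite !midf_lt.
have [Mr Mr0 Hr] := r_lipschitz.
(* This duration does not depend on [e], so dividing an O(e) displacement by it still gives O(e). *)
pose tau := Num.min ((z - a) / Mr) ((b - z) / Mr).
have tau0 : 0 < tau by rewrite lt_min !divr_gt0 ?subr_gt0.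
have tau1 : Mr * tau <= z - a by rewrite mulrC -ler_pdivlMr// ge_min lexx.
have tau2 : Mr * tau <= b - z by rewrite mulrC -ler_pdivlMr// ge_min lexx orbT.
have [la la0 HA] := lip_A'.
have [lb lb0 HB] := lip_onM (@lip_on_id _ lo hi) lip_B'.
have [ln ln0 Hn] := lip_n0'; have [lq lq0 Hq] := lip_q'.
have K0 := ltW K_gt0.
have qz0 : 0 < `|q z| by rewrite normr_gt0.
(* [c2 * e] will bound the displacement of [x] during the window, and [c3 * e] the variation of its
   velocity. *)
pose c2 := (2 + (ln + K * lq) * tau) / `|q z|.
pose c3 := (la + K * lb) * tau + `|z * B z| * c2.
apply: (@small_eq0 _ _ (`|q z| * ((c2 + tau * c3) / tau) + `|z * B z|)) => e e0.
have [T tT HT] := N_to0 a1 (ltW (lt_trans az zb)) b2 e0.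
have [t [s [Tt _ rt _ _]]] := @cross_up z b T z1 zb b2 tT.
have tt := le_trans tT Tt.
have win u : t <= u <= t + tau -> [/\ t0 <= u, T <= u & a <= r u <= b].
  move=> /andP[tu ut]; have tu0 := le_trans tt tu.
  have ut' : `|u - t| <= tau by rewrite ger0_norm ?subr_ge0// lerBlDl.
  have h1 := le_trans (Hr _ _ tu0 tt) (ler_wpM2l (ltW Mr0) ut'); rewrite rt in h1.
  have /ler_normlP[h3 h4] := le_trans h1 tau1; have /ler_normlP[h5 h6] := le_trans h1 tau2.
  split=> //; first exact: le_trans tu.
  rewrite opprB lerD2l lerN2 in h3; rewrite lerD2r in h6.
  by rewrite h3 h6.
have tt' : t < t + tau by rewrite ltrDl.
have Nw u : t <= u <= t + tau -> `|N u| <= e.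
  by move=> /win[_ Tu ru]; exact: HT.
have rw u : t <= u <= t + tau -> `|r u - z| <= tau * e.
  move=> /[dup] uw /andP[]; rewrite le_eqVlt => /predU1P[<- _|tu ut].
    by rewrite rt subrr normr0 mulr_ge0 ?ltW.
  have [v /andP[tv _]|c /andP[/ltW tc /ltW cu] E] := deriv_at_mvt tu (df := fun t => N t / x t) (f := r).
    by apply: dr; exact: le_trans tv.
  have cw : t <= c <= t + tau by rewrite tc (le_trans cu).
  have [tc0 _ _] := win c cw; have /andP[/ltW xc _] := x1 tc0; have x0 := x_gt0 tc0.
  have e0' := ltW e0.
  rewrite -rt E normrM mulrC ler_pM//.
    by rewrite ger0_norm ?subr_ge0 ?lerBlDl// ltW.
  rewrite normrM normrV ?unitfE ?gt_eqF// (gtr0_norm x0) ler_pdivrMr//.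
  by rewrite (le_trans (Nw _ cw))// ler_peMr.
have xw u : t <= u <= t + tau -> `|x u - x t| <= c2 * e.
  move=> uw; have [tu _ _] := win u uw; have /andP[_ xK] := x1 tu; have x0 := ltW (x_gt0 tu).
  have rw' := rw u uw.
  rewrite /c2 mulrAC ler_pdivlMr// -normrM.
  have -> : (x u - x t) * q z = N u - N t -
      ((n0 (r u) - n0 z) + x u * (q (r u) - q z)) by rewrite /drift rt; ring.
  have -> : (2 + (ln + K * lq) * tau) * e = (e + e) + (ln * (tau * e) + K * (lq * (tau * e))) by ring.
  rewrite (le_trans (ler_normB _ _))// lerD//.
    rewrite (le_trans (ler_normB _ _))// lerD//; first exact: Nw.
    by apply: Nw; rewrite lexx ltW.
  rewrite (le_trans (ler_normD _ _))// lerD//.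
    by rewrite (le_trans (Hn _ _ (rIc tu) zI))// ler_wpM2l.
  rewrite normrM (ger0_norm x0) ler_pM//.
  by rewrite (le_trans (Hq _ _ (rIc tu) zI))// ler_wpM2l.
pose X u := A (r u) - r u * x u * B (r u).
have Xw u : t <= u <= t + tau -> `|X u - X t| <= c3 * e.
  move=> uw; have [tu _ _] := win u uw; have /andP[_ xK] := x1 tu; have x0 := ltW (x_gt0 tu).
  have rw' := rw u uw.
  have -> : X u - X t = (A (r u) - A z) - (x u * (r u * B (r u) - z * B z) +
     z * B z * (x u - x t)) by rewrite /X rt; ring.
  have -> : c3 * e = la * (tau * e) + (K * (lb * (tau * e)) + `|z * B z| * (c2 * e)).
    by rewrite /c3; ring.
  rewrite (le_trans (ler_normB _ _))// lerD//.
    by rewrite (le_trans (HA _ _ (rIc tu) zI))// ler_wpM2l.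
  rewrite (le_trans (ler_normD _ _))// lerD//.
    rewrite normrM (ger0_norm x0) ler_pM//.
    by rewrite (le_trans (HB _ _ (rIc tu) zI))// ler_wpM2l.
  by rewrite normrM ler_wpM2l// xw.
have [v /andP[tv _]|c /andP[/ltW tc /ltW cu] E] := deriv_at_mvt tt' (df := X) (f := x).
  by apply: dx; exact: le_trans tv.
rewrite (addrC t) addrK addrC in E.
have Xt : `|X t| <= (c2 + tau * c3) / tau * e.
  rewrite mulrAC ler_pdivlMr// -(gtr0_norm tau0) -normrM (gtr0_norm tau0).
  have -> : X t * tau = (x (t + tau) - x t) - tau * (X c - X t).
    by rewrite mulrBr mulrC (mulrC tau (X c)) -E; ring.
  have -> : (c2 + tau * c3) * e = c2 * e + tau * (c3 * e) by ring.
  rewrite (le_trans (ler_normB _ _))// lerD//.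
    by apply: xw; rewrite (ltW tt') lexx.
  by rewrite normrM (gtr0_norm tau0) ler_pM2l// Xw// tc.
have -> : A z * q z + z * B z * n0 z = q z * X t + z * B z * N t.
  by rewrite /X /drift rt; ring.
have -> : (`|q z| * ((c2 + tau * c3) / tau) + `|z * B z|) * e =
  `|q z| * ((c2 + tau * c3) / tau * e) + `|z * B z| * e by ring.
rewrite (le_trans (ler_normD _ _))//; apply: lerD; rewrite normrM ler_wpM2l//.
by apply: Nw; rewrite lexx ltW.
Qed.

(** The nullcline of [x]; by [nullclines_agree] it is also the zero of [N] on the strip. *)
Definition phi z := A z / (z * B z).

Let zB_gt0 z : 0 < z -> 0 < z * B z.
Proof. by move=> z0; rewrite mulr_gt0// (B_gt0 dB B_ge0). Qed.

Let ro_gt0 z : r1 < z < r2 -> 0 < z.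
Proof. by move=> /rop /andP[/(lt_trans lo0)]. Qed.

Lemma n0_phi z : r1 < z < r2 -> n0 z = - (q z * phi z).
Proof.
move=> zo; have z0 := ro_gt0 zo; have := nullclines_agree zo; have := zB_gt0 z0 => zB E.
apply: (mulfI (lt0r_neq0 zB)); rewrite /phi.
have -> : z * B z * - (q z * (A z / (z * B z))) = - (A z * q z).
  by field; rewrite (gt_eqF z0) (gt_eqF (B_gt0 dB B_ge0 z0)).
by apply/eqP; rewrite -addr_eq0 addrC E.
Qed.

Lemma NE t : t0 <= t -> r1 < r t < r2 -> N t = q (r t) * (x t - phi (r t)).
Proof. by move=> tt ro; rewrite /drift (n0_phi ro); ring. Qed.

Lemma x_near_phi z e : r1 < z < r2 -> 0 < e ->
  exists2 T, t0 <= T & forall t, T <= t -> r t = z -> `|x t - phi z| <= e.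
Proof.
move=> /[dup] zo /andP[z1 z2] e0.
have qz0 : 0 < `|q z| by rewrite normr_gt0 q_neq0.
have [T tT HT] := N_to0 z1 (lexx z) z2 (mulr_gt0 qz0 e0).
exists T => // t Tt rt; have := HT t Tt; rewrite rt lexx => /(_ isT).
have tt := le_trans tT Tt.
by rewrite NE ?rt// normrM ler_pM2l.
Qed.

(** * The orbit follows the common nullcline *)

Section Strip.
Variables (a b : R) (G : R -> R).
Hypothesis a1 : r1 < a.
Hypothesis b2 : b < r2.
Hypothesis dG : forall z, a < z < b -> deriv_at G z (A z / q z).

Let ab_ro z : a < z < b -> r1 < z < r2.
Proof. by move=> /andP[az zb]; rewrite (lt_trans a1) ?(lt_trans zb). Qed.

(** With [N = q * (x - phi)] and [A = r * B * phi], the derivative of [x + G r] collapses to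
    [- (r * B * (x - phi) ^+ 2 / x)]. *)
Lemma xG_nonincreasing s t : t0 <= s -> s < t -> (forall u, s <= u <= t -> a < r u < b) ->
  x t + G (r t) <= x s + G (r s).
Proof.
move=> ts st H.
pose dxG u := A (r u) - r u * x u * B (r u) + A (r u) / q (r u) * (N u / x u).
have [u uw|c /andP[/ltW sc /ltW ct] E] :=
  deriv_at_mvt st (df := dxG) (f := fun u => x u + G (r u)).
  have tu : t0 <= u by move/andP: uw => [/(le_trans ts)].
  apply: deriv_atD; first exact: dx.
  apply: deriv_at_comp; first exact: dr.
  exact/dG/H.
have cw : s <= c <= t by rewrite sc.
have tc := le_trans ts sc; have rc := H c cw; have ro := ab_ro rc.
have xc := x_gt0 tc; have qn := q_neq0 ro; have zB := zB_gt0 (ro_gt0 ro).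
rewrite -subr_le0 E pmulr_lle0 ?subr_gt0//.
have -> : dxG c = - (r c * B (r c) * (x c - phi (r c)) ^+ 2 / x c).
  rewrite /dxG (NE tc ro) /phi; field.
  have z0 := ro_gt0 ro.
  by rewrite (gt_eqF xc) qn (gt_eqF z0) (gt_eqF (B_gt0 dB B_ge0 z0)).
by rewrite oppr_le0 divr_ge0 ?(ltW xc)// mulr_ge0 ?sqr_ge0// ltW.
Qed.

(** At late times [x] is close to [phi] whenever [r] equals [z] or [u]. Monotonicity along a
    downward passage gives one inequality, along an upward passage the other. *)
Lemma phiG_le z u : a < z -> z < u -> u < b -> phi z + G z = phi u + G u.
Proof.
move=> az zu ub.
have zab : a < z < b by rewrite az (lt_trans zu).
have uab : a < u < b by rewrite ub (lt_trans az).
have zo := ab_ro zab; have uo := ab_ro uab.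
have z1 : r1 < z by exact: lt_trans az.
have u2 : u < r2 by exact: lt_trans b2.
have near e : 0 < e -> exists2 T, t0 <= T & forall t, T <= t ->
    (r t = z -> `|x t - phi z| <= e) /\ (r t = u -> `|x t - phi u| <= e).
  move=> e0; have [T tT HT] := x_near_phi zo e0; have [T' tT' HT'] := x_near_phi uo e0.
  exists (Num.max T T'); first by rewrite le_max tT.
  by move=> t; rewrite ge_max => /andP[h1 h2]; split; [exact: HT | exact: HT'].
apply/le_anti/andP; split; apply/ler_addgt0Pl => e e0.
  have e2 : 0 < e / 2 by lra.
  have [T tT HT] := near _ e2.
  have [s [t [Ts st rs rt H]]] := cross_down z1 zu u2 tT.
  have h := @xG_nonincreasing s t (le_trans tT Ts) st.
  have {}h : x t + G (r t) <= x s + G (r s).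
    by apply: h => v /H /andP[h1 h2]; rewrite (lt_le_trans az) ?(le_lt_trans h2).
  rewrite rs rt in h.
  have [_ /(_ rs) /ler_normlP[_ hs]] := HT s Ts.
  have [/(_ rt) /ler_normlP[ht _] _] := HT t (le_trans Ts (ltW st)).
  by rewrite opprB in ht; lra.
have e2 : 0 < e / 2 by lra.
have [T tT HT] := near _ e2.
have [s [t [Ts st rs rt H]]] := cross_up z1 zu u2 tT.
have h := @xG_nonincreasing s t (le_trans tT Ts) st.
have {}h : x t + G (r t) <= x s + G (r s).
  by apply: h => v /H /andP[h1 h2]; rewrite (lt_le_trans az) ?(le_lt_trans h2).
rewrite rs rt in h.
have [/(_ rs) /ler_normlP[_ hs] _] := HT s Ts.
have [_ /(_ rt) /ler_normlP[ht _]] := HT t (le_trans Ts (ltW st)).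
by rewrite opprB in ht; lra.
Qed.

(** [phi + G] is constant on the strip. The quotient defining [phi] cannot be differentiated
    directly, as [B] has no known derivative. *)
Lemma phi_deriv z : a < z < b -> deriv_at phi z (- (A z / q z)).
Proof.
move=> /[dup] zab /andP[az zb].
have d0 : 0 < Num.min (z - a) (b - z) by rewrite lt_min !subr_gt0 az.
apply: (deriv_at_near d0 (f := fun u => phi z + G z - G u)).
  move=> u; rewrite lt_min => /andP[/ltr_normlP[h1 _] /ltr_normlP[_ h2]].
  have [uz|zu|->] := ltgtP u z; last by rewrite addrK.
    by rewrite -(@phiG_le u z)// ?addrK//; lra.
  by rewrite (@phiG_le z u)// ?addrK//; lra.
apply: deriv_at_eq; first exact: deriv_atB (deriv_at_cst _ _) (dG zab).
by rewrite sub0r.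
Qed.

(** The identity n + phi q = 0 is expanded as in [energy_deriv]. It equates [- k * B] with a
    function whose derivative at z is [A + q * phi'], and this vanishes by [phi_deriv]. *)
Lemma B_deriv0 z : a < z < b -> deriv_at B z 0.
Proof.
move=> /[dup] zab /andP[az zb]; have zo := ab_ro zab.
have z0 := ro_gt0 zo; have zB := zB_gt0 z0; have qn := q_neq0 zo.
(* The coefficient of [B] at z, which is the x-derivative of the weight at x = phi z; hence its
   positivity on the invariant square. *)
pose k := - (1 + z * z) + phi z * (z * z + z).
have k0 : 0 < k.
  have -> : k = z * z * (phi z - 1) + (z * phi z - 1) by rewrite /k; ring.
  have phi1 : 1 < phi z by rewrite /phi ltr_pdivlMr// mul1r (rB_lt_A dA dB B_ge0 rB_le_A).
  have phi2 : 1 <= z * phi z.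
    have [_ l2] := orbit_floor_ge1 z0; have /andP[l1 _] := psi_range zo.
    have <- : psi z = phi z by rewrite /drift_zero (n0_phi zo) opprK mulrAC mulfV// mul1r.
    by rewrite (le_trans l2)// ler_pM2l.
  by rewrite ltr_wpDr ?subr_ge0// mulr_gt0 ?subr_gt0// mulr_gt0.
pose At u := A u - z * B u.
have dAt : deriv_at At z 0 := A_flat dA dB lo0 L0 lipB (rop zo).
have dphi := phi_deriv zab.
pose P1 u := - (1 + u * z) + phi u * (u * u + z) - k.
have P10 : P1 z = 0 by rewrite /P1 /k subrr.
have did := deriv_at_id z.
have DP1 := deriv_atB (deriv_atD
  (deriv_atN (deriv_atD (deriv_at_cst 1 z) (deriv_atM did (deriv_at_cst z z))))
  (deriv_atM dphi (deriv_atD (deriv_atM did did) (deriv_at_cst z z)))) (deriv_at_cst k z).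
have DP1B := deriv_atM_cont P10 DP1 (lip_on_cont lip_B' (rop zo)).
have DP0 := deriv_atD (deriv_atB (deriv_at_cst be z) (deriv_atM did dAt))
  (deriv_atM dphi (deriv_atB dAt (deriv_at_cst al z))).
have D1 := deriv_atD DP0 DP1B.
have d0 : 0 < Num.min (z - a) (b - z) by rewrite lt_min !subr_gt0 az.
have D2 : deriv_at (fun u => - k * B u) z 0.
  apply: (deriv_at_near d0 _ (deriv_at_eq D1 _)) => [u|].
    rewrite lt_min => /andP[/ltr_normlP[h1 _] /ltr_normlP[_ h2]].
    have uo : r1 < u < r2 by apply: ab_ro; lra.
    have u0 := ro_gt0 uo; have := n0_phi uo; rewrite /drift_cst /drift_slope => E.
    have -> : be = B u + C u by rewrite BC.
    have -> : al = A u + D u by rewrite AD.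
    have -> : C u = u * A u - (u * u * B u - D u) * phi u by rewrite -E; ring.
    by rewrite /At /P1 /=; ring.
  have Bn : B z != 0 by rewrite gt_eqF// (B_gt0 dB B_ge0).
  have -> : al = A z + D z by rewrite AD.
  rewrite /At /phi /=; rewrite /drift_slope in qn *; field.
  by rewrite qn Bn (gt_eqF z0).
have D3 := deriv_atM (deriv_at_cst (- k^-1) z) D2.
apply: (deriv_at_near ltr01 _ (deriv_at_eq D3 _)) => [u _|]; last by rewrite !mulr0 addr0.
by rewrite mulrA mulrNN mulVf ?mul1r// gt_eqF.
Qed.

End Strip.

Theorem no_oscillation : False.
Proof.
have /andP[m1 m2] := mido.
pose m := (r1 + r2) / 2; rewrite -/m in m1 m2.
pose a := (r1 + m) / 2; pose b := (m + r2) / 2.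
have /andP[a1 am] : r1 < a < m by rewrite !midf_lt.
have /andP[mb b2] : m < b < r2 by rewrite !midf_lt.
have ab : a <= b by rewrite ltW// (lt_trans am).
have ro z : a <= z <= b -> r1 < z < r2.
  by move=> /andP[h1 h2]; rewrite (lt_le_trans a1) ?(le_lt_trans h2).
have cAq z : a <= z <= b -> cont_at (fun z => A z / q z) z.
  move=> /ro zo; apply: cont_atM; first exact: lip_on_cont lip_A' (rop zo).
  by apply: cont_atV; [exact: q_neq0 | exact: lip_on_cont lip_q' (rop zo)].
have [c _ Hc] := EVT_max ab (cont_at_within (fun z zab => cont_at_norm (cAq z zab))).
have [|z zab|G dG] := @antiderivative _ (fun z => A z / q z) a b `|A c / q c|.
- by move=> z /andP[/ltW h1 /ltW h2]; apply: cAq; rewrite h1.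
- by apply: Hc; move/andP: zab => [/ltW h1 /ltW h2]; rewrite in_itv/= h1.
pose z1 := (a + m) / 2; pose z2 := (m + b) / 2.
have /andP[az1 z1m] : a < z1 < m by rewrite !midf_lt.
have /andP[mz2 z2b] : m < z2 < b by rewrite !midf_lt.
have z12 : z1 < z2 by exact: lt_trans mz2.
have [z /andP[h1 h2]|c' _ E] := deriv_at_mvt z12 (df := fun=> 0) (f := B).
  by apply: (B_deriv0 a1 b2 dG); rewrite (lt_le_trans az1) ?(le_lt_trans h2).
have z10 : 0 < z1 by apply: ro_gt0; rewrite (lt_trans a1) ?(lt_trans z1m).
by have := dB z10 z12; move/eqP: E; rewrite mul0r subr_eq0 => /eqP ->; rewrite ltxx.
Qed.

End Oscillation.

(** * Convergence of bounded orbits *)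

Section Planar.
Variables (R : realType) (A B C D : R -> R) (al be : R).
Implicit Types (s t u z e : R).
Hypothesis AD : forall z, 0 < z -> A z + D z = al.
Hypothesis BC : forall z, 0 < z -> B z + C z = be.
Hypothesis dA : forall z u, 0 < z -> z < u ->
  z * (B z - B u) <= A z - A u <= u * (B z - B u).
Hypothesis dB : forall z u, 0 < z -> z < u -> B u < B z.
Hypothesis B_ge0 : forall z, 0 < z -> 0 <= B z.
Hypothesis C_ge0 : forall z, 0 < z -> 0 <= C z.
Hypothesis rB_le_A : forall z, 0 < z -> z * B z <= A z.
Hypothesis D_le_rC : forall z, 0 < z -> D z <= z * C z.
Hypothesis lipB : forall lo hi : R, 0 < lo -> exists2 L, 0 <= L &
  forall z u, lo <= z -> z < u -> u <= hi -> B z - B u <= L * (u - z).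
Variables (x y : R -> R) (t0 K : R).
Hypothesis cx : forall t, t0 <= t -> cont_at x t.
Hypothesis cy : forall t, t0 <= t -> cont_at y t.
Hypothesis dx : forall t, t0 <= t -> 0 < x t -> 0 < y t ->
  deriv_at x t (A (y t / x t) - y t * B (y t / x t)).
Hypothesis dy : forall t, t0 <= t -> 0 < x t -> 0 < y t ->
  deriv_at y t (C (y t / x t) - x t * D (y t / x t)).
Hypothesis x0 : 1 < x t0.
Hypothesis y0 : 1 < y t0.
Hypothesis xK : forall t, t0 <= t -> x t <= K.
Hypothesis yK : forall t, t0 <= t -> y t <= K.

(** When the minimum of the coordinates has come down to 1, the coordinate equal to 1 has positive
    velocity: [A r - r * B r] if x = 1, and C(r) - D(r) / r if y = 1. It would thus have been below
    1 just before. *)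
Lemma orbit_gt1 t : t0 <= t -> 1 < x t /\ 1 < y t.
Proof.
move=> tt; apply/andP; rewrite -lt_min ltNge; apply/negP => g1.
pose g t := Num.min (x t) (y t).
have g0 : 1 < g t0 by rewrite lt_min x0 y0.
have [|s [u [ts /andP[su _] _ gu H]]] := @crossing_down _ g t0 t 1 (g t0) tt g0 _ (lexx _) g1.
  by move=> v /andP[tv _]; apply: cont_at_min; [exact: cx | exact: cy].
have tu : t0 <= u := le_trans ts (ltW su).
have left v : s <= v <= u -> 1 <= x v /\ 1 <= y v.
  by move=> /H /andP[]; rewrite le_min => /andP[].
have [xu yu] := left u (introT andP (conj (ltW su) (lexx _))).
have xu0 : 0 < x u := lt_le_trans ltr01 xu.
have yu0 : 0 < y u := lt_le_trans ltr01 yu.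
have contra f l : deriv_at f u l -> 0 < l -> f u = 1 -> (forall v, s <= v <= u -> 1 <= f v) -> False.
  move=> df l0 fu Hf; have [d d0 Hd] := deriv_at_gt0 df l0.
  pose v := Num.max s (u - d / 2).
  have vu : v < u by rewrite gt_max su/=; lra.
  have vd : u - d / 2 <= v by rewrite le_max lexx orbT.
  have sv : s <= v by rewrite le_max lexx.
  have [] := Hd v; first by rewrite ltr0_norm; lra.
  move=> _ /(_ vu); rewrite fu ltNge Hf// sv ltW//.
move: gu; rewrite /g; have [xy|yx] := leP (x u) (y u) => E.
  apply: (contra _ _ (dx tu xu0 yu0)) => //; last by move=> v /left[].
  by rewrite E divr1 subr_gt0 (rB_lt_A dA dB B_ge0 rB_le_A).
apply: (contra _ _ (dy tu xu0 yu0)) => //; last by move=> v /left[].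
rewrite E div1r subr_gt0.
have xi : 0 < (x u)^-1 by rewrite invr_gt0.
by rewrite -ltr_pdivlMl// (D_lt_rC AD BC dA dB C_ge0 D_le_rC xi).
Qed.

Let x_gt0 t : t0 <= t -> 0 < x t.
Proof. by move=> /orbit_gt1[/(lt_trans ltr01)]. Qed.

Let y_gt0 t : t0 <= t -> 0 < y t.
Proof. by move=> /orbit_gt1[_ /(lt_trans ltr01)]. Qed.

Let r t := y t / x t.

Let rxE t : t0 <= t -> r t * x t = y t.
Proof. by move=> /x_gt0 xt; rewrite divfK// gt_eqF. Qed.

Let dx' t : t0 <= t -> deriv_at x t (A (r t) - r t * x t * B (r t)).
Proof. by move=> tt; rewrite rxE//; apply: dx => //; [exact: x_gt0 | exact: y_gt0]. Qed.

Let dr t : t0 <= t -> deriv_at r t (drift A B C D x r t / x t).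
Proof.
move=> tt; have xt := x_gt0 tt; have xn : x t != 0 by rewrite gt_eqF.
have Dy := dy tt xt (y_gt0 tt); have Dx := dx tt xt (y_gt0 tt).
apply: deriv_at_eq (deriv_atM Dy (deriv_atV xn Dx)) _.
by rewrite /drift /drift_cst /drift_slope /r; field.
Qed.

Let K1 : 1 < K.
Proof. by rewrite (lt_le_trans x0)// xK. Qed.

Let K0 : 0 < K := lt_trans ltr01 K1.

Let rI t : t0 <= t -> K^-1 <= r t <= K.
Proof.
move=> tt; have [x1 y1] := orbit_gt1 tt; have xt := x_gt0 tt.
apply/andP; split.
  by rewrite ler_pdivlMr// ler_pdivrMl// (le_trans (xK tt))// ler_peMr// ltW.
by rewrite ler_pdivrMr// (le_trans (yK tt))// ler_peMr// ltW.
Qed.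

Lemma ratio_cvg : exists2 rs : R, 0 < rs & r t @[t --> +oo] --> rs.
Proof.
have [l [u [Kl /andP[lu uK] ev low high]]] := liminf_limsup rI.
have l0 : 0 < l by rewrite (lt_le_trans _ Kl)// invr_gt0.
move: lu; rewrite le_eqVlt => /predU1P[E|lu].
  exists l => //; apply/cvgyP => e /ev[T _ HT]; exists T => t /HT.
  by rewrite -E ltr_distl.
pose lo := K^-1 / 2; pose hi := K + 1.
have Ki : 0 < K^-1 by rewrite invr_gt0.
have lo0 : 0 < lo by rewrite /lo; lra.
have [L L0 HL] := lipB hi lo0.
have loK : lo < K^-1 by rewrite /lo; lra.
have Khi : K < hi by rewrite /hi; lra.
have x1 t : t0 <= t -> 1 < x t <= K by move=> tt; have [-> _] := orbit_gt1 tt; rewrite xK.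
have rx1 t : t0 <= t -> 1 < r t * x t by move=> tt; have [_ y1] := orbit_gt1 tt; rewrite rxE.
by have := no_oscillation AD BC dA dB B_ge0 rB_le_A lo0 L0 HL rI loK Khi x1 rx1 dx' dr Kl lu uK ev low high.
Qed.

(** Once [r] converges, [x] solves a linear equation with convergent coefficients. The first
    equilibrium equation is then the formula for [xs]; the second holds because [y] and its
    derivative both converge. *)
Theorem planar_convergence : exists xs ys : R,
  [/\ x t @[t --> +oo] --> xs, y t @[t --> +oo] --> ys, 0 < xs, 0 < ys &
    A (ys / xs) - ys * B (ys / xs) = 0 /\ C (ys / xs) - xs * D (ys / xs) = 0].
Proof.
have [rs rs0 crs] := ratio_cvg.
have lo0 : 0 < rs / 2 by lra.
have [L L0 HL] := lipB (rs * 2) lo0.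
have rsI : rs / 2 < rs < rs * 2 by lra.
have comp f : lip_on (rs / 2) (rs * 2) f -> f (r t) @[t --> +oo] --> f rs.
  move=> lf; apply: continuous_cvg => //.
  by apply/cont_atP; exact: lip_on_cont lf rsI.
have cA := comp _ (lip_A dA dB lo0 L0 HL); have cB := comp _ (lip_B dB lo0 L0 HL).
have cC := comp _ (lip_C BC dB lo0 L0 HL); have cD := comp _ (lip_D AD dA dB lo0 L0 HL).
have rB0 : 0 < rs * B rs by rewrite mulr_gt0// (B_gt0 dB B_ge0).
pose xs := A rs / (rs * B rs).
have cxs : x t @[t --> +oo] --> xs.
  apply: (@cvg_linear_ode _ x (fun t => A (r t)) (fun t => r t * B (r t)) _ _ K t0) => //.
  - by move=> t tt; apply: deriv_at_eq (dx' tt) _; rewrite mulrAC.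
  - by move=> t tt; rewrite ger0_norm ?xK// ltW// x_gt0.
  - exact: cvgM.
have xs0 : 0 < xs by rewrite divr_gt0// (lt_trans rB0)// (rB_lt_A dA dB B_ge0 rB_le_A).
pose ys := rs * xs.
have cys : y t @[t --> +oo] --> ys.
  apply: cvg_trans (cvgM crs cxs); apply: near_eq_cvg.
  exists t0; split; first exact: num_real.
  by move=> t /ltW tt /=; rewrite -rxE.
have rsE : ys / xs = rs by rewrite /ys mulfK// gt_eqF.
exists xs, ys; split=> //; first exact: mulr_gt0.
rewrite rsE; split.
  by rewrite /ys /xs mulrAC mulrCA mulfV ?mulr1 ?subrr// gt_eqF.
apply: (cvg_deriv0 _ cys (T := t0)).
  by move=> t tt; apply: dy => //; [exact: x_gt0 | exact: y_gt0].
by apply: cvgB => //; exact: cvgM.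
Qed.

End Planar.

(** * Integrals over the box *)

Section Measurable.
Variables (R : realType) (k : nat).
Local Notation V := 'M[R]_(2, k).
Implicit Types (F G : V -> R) (v : V) (p : 'I_2 * 'I_k).

(* Measurability for the product sigma-algebra, phrased through all measurable
   parametrizations so that no measurable structure on matrices is needed. *)
Definition mxmeas F := forall (d : measure_display) (T : measurableType d) (g : T -> V),
  (forall i j, measurable_fun setT (fun t => g t i j)) ->
  measurable_fun setT (fun t => F (g t)).

Lemma mxmeas_entry i j : mxmeas (fun v => v i j).
Proof. by move=> d T g; exact. Qed.

Lemma mxmeas_cst c : mxmeas (fun=> c).
Proof. by move=> d T g _; exact: measurable_cst. Qed.

Lemma mxmeasD F G : mxmeas F -> mxmeas G -> mxmeas (fun v => F v + G v).
Proof. by move=> HF HG d T g Hg; apply: measurable_funD; [exact: HF | exact: HG]. Qed.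

Lemma mxmeasM F G : mxmeas F -> mxmeas G -> mxmeas (fun v => F v * G v).
Proof. by move=> HF HG d T g Hg; apply: measurable_funM; [exact: HF | exact: HG]. Qed.

Lemma mxmeas_sum (I : Type) (s : seq I) (F : I -> V -> R) :
  (forall i, mxmeas (F i)) -> mxmeas (fun v => \sum_(i <- s) F i v).
Proof.
move=> HF d T g Hg; apply: measurable_sum => i.
exact: HF.
Qed.

Lemma mxmeas_ltr F G (a b : V -> R) : mxmeas F -> mxmeas G -> mxmeas a -> mxmeas b ->
  mxmeas (fun v => if F v < G v then a v else b v).
Proof.
move=> HF HG Ha Hb d T g Hg; apply: measurable_fun_ifT; [|exact: Ha|exact: Hb].
by apply: measurable_fun_ltr; [exact: HF | exact: HG].
Qed.

Lemma mxmeas_eqr F G (a b : V -> R) : mxmeas F -> mxmeas G -> mxmeas a -> mxmeas b ->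
  mxmeas (fun v => if F v == G v then a v else b v).
Proof.
move=> HF HG Ha Hb d T g Hg; apply: measurable_fun_ifT; [|exact: Ha|exact: Hb].
by apply: measurable_fun_eqr; [exact: HF | exact: HG].
Qed.

Lemma setentry_measurable (d : measure_display) (T : measurableType d) (g : T -> V) (h : T -> R) p :
  (forall i j, measurable_fun setT (fun t => g t i j)) -> measurable_fun setT h ->
  forall i j, measurable_fun setT (fun t => setentry (g t) p (h t) i j).
Proof.
move=> Hg Hh i j.
rewrite (_ : (fun t => _) = (fun t => if (i, j) == p then h t else g t i j)); last first.
  by apply/funext => t; rewrite mxE.
by case: ((i, j) == p); [exact: Hh | exact: Hg].
Qed.

(** The set where [F] exceeds [a] is the union of the countably many rational cubes on which it does
    so, and membership of [g t] in a cube is a finite conjunction of measurable conditions. *)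
Lemma mxmeas_continuous F : continuous F -> mxmeas F.
Proof.
move=> cF d T g Hg.
move=> mT; apply: (measurability _ (RGenOInfty.measurableE R)) => //.
move=> _ [_ [a ->] <-]; rewrite setTI.
pose box (c : 'M[rat]_(2, k)) (n : nat) (v : V) :=
  forall i j, `|v i j - ratr (c i j)| < n.+1%:R^-1.
pose Q (cn : 'M[rat]_(2, k) * nat) := forall v, box cn.1 cn.2 v -> a < F v.
have -> : (fun t => F (g t)) @^-1` `]a, +oo[%classic =
   \bigcup_(cn : 'M[rat]_(2, k) * nat) [set t | Q cn /\ box cn.1 cn.2 (g t)].
  apply/seteqP; split=> [t|t [cn _ [Qcn bt]]]; last first.
    by rewrite /= in_itv/= andbT; exact: Qcn.
  rewrite /= in_itv/= andbT => aF.
  have := cF (g t); move/cvgrPdist_lt => /(_ (F (g t) - a)); rewrite subr_gt0 => /(_ aF).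
  move/nbhs_ballP => [e /= e0 He].
  (* The factor 2 leaves room for a cube centred at a rational point near [g t] instead of at
     [g t]. *)
  have [n Hn] : exists n : nat, forall v, (forall i j, `|v i j - g t i j| < (n.+1%:R^-1) *+ 2) -> a < F v.
    exists (Num.truncn (2 / e)) => v Hv.
    have ne : (Num.truncn (2 / e)).+1%:R^-1 *+ 2 < e.
      have := truncnS_gt (2 / e); set N := _.+1%:R => h.
      have N0 : 0 < N by rewrite ltr0n.
      by rewrite -[ltLHS]mulr_natl ltr_pdivrMr// mulrC -ltr_pdivrMr.
    have : ball (g t) e v.
      split=> // i j; rewrite -ball_normE /ball_/= distrC; exact: lt_trans (Hv i j) ne.
    by move=> /He/ltr_normlP[_]; lra.
  pose c : 'M[rat]_(2, k) := \matrix_(i, j) xget 0%Q [set c : rat | `|g t i j - ratr c| < n.+1%:R^-1].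
  have cP i j : `|g t i j - ratr (c i j)| < n.+1%:R^-1.
    rewrite mxE.
    suff : exists c : rat, [set c : rat | `|g t i j - ratr c| < n.+1%:R^-1] c.
      by move=> /(xgetPex 0%Q).
    have n0 : (0 : R) < n.+1%:R^-1 by rewrite invr_gt0.
    have lt_n : g t i j - n.+1%:R^-1 < g t i j + n.+1%:R^-1.
      by rewrite ltrD2l (lt_trans _ n0)// oppr_lt0.
    have [q] := rat_in_itvoo lt_n; rewrite in_itv/= => /andP[q1 q2].
    by exists q => /=; rewrite ltr_distlC q1.
  exists (c, n) => //; split=> //= v bv; apply: Hn => i j.
  have -> : v i j - g t i j = (v i j - ratr (c i j)) - (g t i j - ratr (c i j)) by ring.
  by rewrite (le_lt_trans (ler_normB _ _))// mulr2n ltrD// ?bv ?cP.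
apply: countable_bigcupT_measurable; first exact: countableP.
move=> [c n]; have [Qc|nQ] := pselect (Q (c, n)); last first.
  rewrite (_ : [set _ | _] = set0)//; by apply/seteqP; split=> [t []|//].
rewrite (_ : [set _ | _] = \bigcap_(ij in [set: 'I_2 * 'I_k])
   ((fun t => `|g t ij.1 ij.2 - ratr (c ij.1 ij.2)|) @^-1` `]-oo, n.+1%:R^-1[)); last first.
  apply/seteqP; split=> [t [_ bt] [i j] _ /=|t H]; first by rewrite in_itv/=; exact: bt.
  by split=> // i j; have := H (i, j) I; rewrite /= in_itv.
apply: fin_bigcap_measurable; first exact: finite_finset.
move=> [i j] _ /=; rewrite -[X in measurable X]setTI.
have mg : measurable_fun setT (fun t => `|g t i j - ratr (c i j)|).
  apply: measurableT_comp; first exact: normr_measurable.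
  by apply: measurable_funB; [exact: Hg | exact: measurable_cst].
by apply: mg => //; exact: measurable_itv.
Qed.

End Measurable.

Section BoxIntegral.
Variables (R : realType) (k : nat) (M : R).
Hypothesis M0 : 0 < M.
Local Notation V := 'M[R]_(2, k).
Local Notation mu := (@lebesgue_measure R).
Implicit Types (F G : V -> R) (u v : V) (p : 'I_2 * 'I_k) (ps : seq ('I_2 * 'I_k)).

Definition box_bounded F := exists K : R, forall v, in_box M v -> `|F v| <= K.

(** A class closed under the operations used below and under integrating out one entry, so that
    every iterated integral has integrable integrands at each stage. *)
Definition box_good F := mxmeas F /\ box_bounded F.

Lemma setentry_in_box v p a : in_box M v -> 0 <= a <= M -> in_box M (setentry v p a).
Proof. by move=> bv aM i j; rewrite mxE; case: ifP. Qed.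

Lemma in_box0 : in_box M (0 : V).
Proof. by move=> i j; rewrite mxE lexx ltW. Qed.

Lemma setentry_self v p a : setentry v p a p.1 p.2 = a.
Proof. by rewrite mxE -surjective_pairing eqxx. Qed.

Lemma setentry_other v p a i j : (i, j) != p -> setentry v p a i j = v i j.
Proof. by move=> /negbTE E; rewrite mxE E. Qed.

Lemma finite_itv0M : (mu `[0%R, M] < +oo)%E.
Proof. by rewrite lebesgue_measure_itv/= lte_fin M0 -EFinD ltry. Qed.

Lemma fine_itv0M : fine (mu `[0%R, M]) = M.
Proof. by rewrite lebesgue_measure_itv/= lte_fin M0 -EFinD/= subr0. Qed.

Lemma good_integrable F v p : box_good F -> in_box M v ->
  mu.-integrable `[0, M] (EFin \o (fun a => F (setentry v p a))).
Proof.
move=> [mF [K FK]] bv; apply: measurable_bounded_integrable => //.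
- exact: finite_itv0M.
- apply: measurable_funTS; apply: mF; apply: setentry_measurable => //.
exists `|K|; split => // y Ky a /=; rewrite in_itv/= => aM; apply: le_trans (ltW Ky).
by rewrite (le_trans (FK _ (setentry_in_box _ bv aM)))// ler_norm.
Qed.

Lemma good_cst c : box_good (fun=> c).
Proof. by split; [exact: mxmeas_cst | exists `|c|]. Qed.

Lemma good_entry i j : box_good (fun v => v i j).
Proof.
split; first exact: mxmeas_entry.
by exists M => v /(_ i j) /andP[v0 vM]; rewrite ger0_norm.
Qed.

Lemma goodD F G : box_good F -> box_good G -> box_good (fun v => F v + G v).
Proof.
move=> [mF [K FK]] [mG [L GL]]; split; first exact: mxmeasD.
exists (K + L) => v bv; rewrite (le_trans (ler_normD _ _))// lerD ?FK ?GL//.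
Qed.

Lemma goodM F G : box_good F -> box_good G -> box_good (fun v => F v * G v).
Proof.
move=> [mF [K FK]] [mG [L GL]]; split; first exact: mxmeasM.
by exists (K * L) => v bv; rewrite normrM ler_pM// ?FK ?GL.
Qed.

Lemma good_sum (I : Type) (s : seq I) (F : I -> V -> R) :
  (forall i, box_good (F i)) -> box_good (fun v => \sum_(i <- s) F i v).
Proof.
move=> HF; elim: s => [|i s IH].
  by rewrite (_ : (fun _ => _) = (fun=> 0)); [exact: good_cst | apply/funext => v; rewrite big_nil].
rewrite (_ : (fun _ => _) = (fun v => F i v + \sum_(i <- s) F i v)).
  exact: goodD.
by apply/funext => v; rewrite big_cons.
Qed.

(** Measurability in the parameter is Tonelli's theorem for the positive and negative parts: it
    requires only a sign, while the parameter space carries no measure. *)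
Lemma good_Rintegral F p : box_good F ->
  box_good (fun v => Rintegral mu `[0, M] (fun a => F (setentry v p a))).
Proof.
move=> gF; split; last first.
  case: (gF) => _ [K FK]; exists (K * M) => v bv.
  have iF := good_integrable p gF bv.
  rewrite (le_trans (le_normr_Rintegral _ iF))//.
  rewrite (_ : K * M = Rintegral mu `[0, M] (fun=> K)); last first.
    by rewrite Rintegral_cst//= fine_itv0M.
  apply: le_Rintegral => //.
  - exact: (integrable_norm iF).
  - exact: good_integrable p (good_cst K) bv.
  by move=> a; rewrite /= in_itv/= => aM; apply/FK/setentry_in_box.
case: gF => mF _ d T g Hg.
pose Phi (z : T * R) := F (setentry (g z.1) p z.2).
have mPhi : measurable_fun setT Phi.
  apply: mF; apply: setentry_measurable; last exact: measurable_snd.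
  by move=> i j; exact: (measurableT_comp (Hg i j) measurable_fst).
have mpos (h : T * R -> R) : measurable_fun setT h -> (forall z, 0 <= h z) ->
    measurable_fun setT (fun t => (\int[mu]_(a in `[0%R, M]) (h (t, a))%:E)%E).
  move=> mh h0.
  (* The restriction to the segment is moved into the integrand as an indicator, since Tonelli's
     theorem is applied on the whole line. *)
  pose hh (z : T * R) := ((h z * \1_(`[0, M] : set R) z.2)%:E).
  have mhh : measurable_fun setT hh.
    apply/measurable_EFinP; apply: measurable_funM => //.
    have mi : measurable_fun setT (\1_(`[0, M] : set R) : R -> R) by exact: measurable_indic.
    exact: (measurableT_comp mi measurable_snd).
  have hh0 z : (0 <= hh z)%E by rewrite lee_fin mulr_ge0// indicE.
  rewrite (_ : (fun t => _) = fubini_F mu hh).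
    exact: (measurable_fun_fubini_tonelli_F (m2 := mu)).
  apply/funext => t; rewrite /fubini_F [LHS]integral_mkcond.
  apply: eq_integral => a _; rewrite /hh /= patchE indicE.
  by case: ifP => _; rewrite ?mulr1 ?mulr0.
rewrite /Rintegral; apply: measurableT_comp => //.
rewrite (_ : (fun t => _) = (fun t => (\int[mu]_(a in `[0%R, M]) (Num.max (Phi (t, a)) 0)%:E) -
    (\int[mu]_(a in `[0%R, M]) (Num.max (- Phi (t, a)) 0)%:E))%E); last first.
  apply/funext => t; rewrite integralE; congr (_ - _)%E; apply: eq_integral => a _;
    by rewrite ?funeposE ?funenegE EFin_max ?EFinN.
have m1 : measurable_fun setT (fun z => Num.max (Phi z) 0).
  by apply: measurable_maxr => //; exact: measurable_cst.
have m2 : measurable_fun setT (fun z => Num.max (- Phi z) 0).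
  apply: measurable_maxr; last exact: measurable_cst.
  have := measurable_funB (measurable_cst (0 : R)) mPhi.
  by apply: eq_measurable_fun => z _; rewrite /= sub0r.
have p1 z : 0 <= Num.max (Phi z) 0 by rewrite le_max lexx orbT.
have p2 z : 0 <= Num.max (- Phi z) 0 by rewrite le_max lexx orbT.
have := emeasurable_funB (mpos _ m1 p1) (mpos _ m2 p2).
exact.
Qed.

Lemma good_iterint ps F : box_good F -> box_good (iterint M ps F).
Proof. by elim: ps => [//|p ps IH] gF /=; exact/good_Rintegral/IH. Qed.

Lemma eq_iterint ps F G v : (forall u, in_box M u -> F u = G u) -> in_box M v ->
  iterint M ps F v = iterint M ps G v.
Proof.
move=> FG; elim: ps v => [|p ps IH] v bv /=; first exact: FG.
apply: eq_Rintegral => a; rewrite inE/= in_itv/= => aM.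
by apply: IH; exact: setentry_in_box.
Qed.

Lemma iterintD ps F G v : box_good F -> box_good G -> in_box M v ->
  iterint M ps (fun u => F u + G u) v = iterint M ps F v + iterint M ps G v.
Proof.
move=> gF gG; elim: ps v => [//|p ps IH] v bv /=.
rewrite -RintegralD//.
- apply: eq_Rintegral => a; rewrite inE/= in_itv/= => aM.
  by apply: IH; exact: setentry_in_box.
- exact: good_integrable (good_iterint ps gF) bv.
- exact: good_integrable (good_iterint ps gG) bv.
Qed.

Lemma iterintZ ps c F v : box_good F -> in_box M v ->
  iterint M ps (fun u => c * F u) v = c * iterint M ps F v.
Proof.
move=> gF; elim: ps v => [//|p ps IH] v bv /=.
rewrite -RintegralZl//.
- apply: eq_Rintegral => a; rewrite inE/= in_itv/= => aM.
  by apply: IH; exact: setentry_in_box.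
- exact: good_integrable (good_iterint ps gF) bv.
Qed.

Lemma le_iterint ps F G v : box_good F -> box_good G ->
  (forall u, in_box M u -> F u <= G u) -> in_box M v -> iterint M ps F v <= iterint M ps G v.
Proof.
move=> gF gG FG; elim: ps v => [|p ps IH] v bv /=; first exact: FG.
apply: le_Rintegral => //.
- exact: good_integrable (good_iterint ps gF) bv.
- exact: good_integrable (good_iterint ps gG) bv.
move=> a; rewrite /= in_itv/= => aM.
by apply: IH; exact: setentry_in_box.
Qed.

Lemma Rintegral0M_cst c : Rintegral mu `[0, M] (fun=> c) = c * M.
Proof. by rewrite Rintegral_cst//= fine_itv0M. Qed.

Lemma iterint_indep ps F v : (forall u p a, p \in ps -> F (setentry u p a) = F u) ->
  iterint M ps F v = M ^+ size ps * F v.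
Proof.
elim: ps v => [|p ps IH] v HF /=; first by rewrite expr0 mul1r.
under eq_Rintegral => a _.
  rewrite IH; last by move=> u p' b p'ps; apply: HF; rewrite inE p'ps orbT.
  by rewrite HF ?inE ?eqxx//; over.
by rewrite Rintegral0M_cst exprS; ring.
Qed.

(* Only one of the two coordinates [G] depends on is integrated at the step
   where the bound [e] is used, so no interchange of integrals is needed. *)
Lemma iterint_le_slices ps (h : R -> R -> R) p1 p2 e v : p1 != p2 ->
  box_good (fun v => h (v p1.1 p1.2) (v p2.1 p2.2)) ->
  (forall b, 0 <= b <= M -> Rintegral mu `[0, M] (fun a => h a b) <= e) ->
  (forall a, 0 <= a <= M -> Rintegral mu `[0, M] (fun b => h a b) <= e) ->
  (p1 \in ps) || (p2 \in ps) -> in_box M v ->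
  iterint M ps (fun v => h (v p1.1 p1.2) (v p2.1 p2.2)) v <= e * M ^+ (size ps).-1.
Proof.
move=> p12; set G := fun v => _ => gG h1 h2.
have Gother p u a : p != p1 -> p != p2 -> G (setentry u p a) = G u.
  by move=> n1 n2; rewrite /G !setentry_other// -surjective_pairing eq_sym.
elim: ps v => [//|p ps IH] v pin bv /=.
have [pin'|] := boolP ((p1 \in ps) || (p2 \in ps)).
  have s0 : size ps = (size ps).-1.+1.
    by case: (ps) pin' => //; rewrite !in_nil.
  rewrite s0 exprSr mulrA -Rintegral0M_cst.
  apply: le_Rintegral => //.
  - exact: good_integrable (good_iterint ps gG) bv.
  - exact: good_integrable p (good_cst _) bv.
  by move=> a; rewrite /= in_itv/= => aM; apply: IH => //; exact: setentry_in_box.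
rewrite negb_or => /andP[n1 n2].
under eq_Rintegral => a _.
  rewrite iterint_indep; last first.
    move=> u p' b p'ps; apply: Gother; apply/eqP => E; move: p'ps; rewrite E; exact/negP.
  over.
rewrite RintegralZl//; last exact: good_integrable gG bv.
rewrite mulrC ler_pM2r ?exprn_gt0//.
move: pin; rewrite !inE (negbTE n1) (negbTE n2) !orbF => /orP[]/eqP <-.
  under eq_Rintegral => a _.
    rewrite /G setentry_self setentry_other; last by rewrite -surjective_pairing eq_sym.
    over.
  exact/h1/bv.
under eq_Rintegral => a _.
  rewrite /G setentry_self setentry_other; last by rewrite -surjective_pairing.
  over.
exact/h2/bv.
Qed.

Lemma Rintegral_ge_sub (g : R -> R) a b c : 0 <= a -> a <= b -> b <= M -> 0 <= c ->
  mu.-integrable `[0, M] (EFin \o g) ->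
  (forall z, 0 <= z <= M -> 0 <= g z) -> (forall z, a <= z <= b -> c <= g z) ->
  c * (b - a) <= Rintegral mu `[0, M] g.
Proof.
move=> a0 ab bM c0 ig g0 gc.
have sub : `[a, b] `<=` `[0, M].
  by move=> z /=; rewrite !in_itv/= => /andP[az zb]; rewrite (le_trans a0 az) (le_trans zb bM).
rewrite (_ : b - a = fine (mu `[a, b])); last first.
  rewrite lebesgue_measure_itv/= lte_fin; case: ifPn => [_|]; first by rewrite -EFinD.
  by rewrite -leNgt => ba; rewrite (le_anti (introT andP (conj ab ba))) subrr.
rewrite -Rintegral_cst// -(setIidr sub) Rintegral_mkcondr.
apply: le_Rintegral => //.
- apply: measurable_bounded_integrable => //; first exact: finite_itv0M.
    apply: measurable_funTS; apply: (proj1 (@measurable_restrictT _ _ R R _ (cst c) _)) => //.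
  exists `|c|; split => // y Ky z _; apply: le_trans (ltW Ky).
  by rewrite patchE; case: ifP => // _; rewrite normr0.
move=> z; rewrite /= in_itv/= => zM; rewrite patchE; case: ifPn => [|_]; last exact: g0.
by rewrite inE/= in_itv/=; exact: gc.
Qed.

Lemma iterint_ge0 ps F v : (forall u, in_box M u -> 0 <= F u) -> in_box M v ->
  0 <= iterint M ps F v.
Proof.
move=> F0; elim: ps v => [|p ps IH] v bv /=; first exact: F0.
apply: Rintegral_ge0 => a; rewrite /= in_itv/= => aM; apply: IH; exact: setentry_in_box.
Qed.

(** Each integral is bounded below by its part over the side of the sub-box. The last hypothesis is
    the induction invariant: entries no longer to be integrated already lie in the sub-box. *)
Lemma iterint_ge_subbox ps F (lo hi : 'I_2 * 'I_k -> R) (d l : R) v :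
  box_good F -> (forall u, in_box M u -> 0 <= F u) -> 0 <= d -> 0 <= l ->
  (forall p, [/\ 0 <= lo p, l <= hi p - lo p & hi p <= M]) ->
  (forall u, (forall p, lo p <= u p.1 p.2 <= hi p) -> d <= F u) -> in_box M v ->
  (forall p, p \notin ps -> lo p <= v p.1 p.2 <= hi p) ->
  d * l ^+ size ps <= iterint M ps F v.
Proof.
move=> gF F0 d0 l0 lohi dF; elim: ps v => [|p ps IH] v bv vp /=.
  by rewrite expr0 mulr1; apply: dF => p; exact: vp.
have [lo0 llh hM] := lohi p.
rewrite exprSr mulrA.
have c0 : 0 <= d * l ^+ size ps by rewrite mulr_ge0 ?exprn_ge0.
apply: (le_trans (ler_wpM2l c0 llh)).
have lh : lo p <= hi p by rewrite -subr_ge0 (le_trans l0).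
apply: Rintegral_ge_sub => //.
- exact: good_integrable (good_iterint ps gF) bv.
- by move=> a aM; apply: iterint_ge0 => //; exact: setentry_in_box.
move=> a /andP[la ah].
have aM : 0 <= a <= M by rewrite (le_trans lo0 la) (le_trans ah hM).
apply: IH; first exact: setentry_in_box.
move=> p' p'ps; have [->|pp'] := eqVneq p' p; first by rewrite setentry_self la.
rewrite setentry_other -?surjective_pairing//.
by apply: vp; rewrite inE negb_or pp'.
Qed.

Lemma boxintD F G : box_good F -> box_good G ->
  boxint M (fun u => F u + G u) = boxint M F + boxint M G.
Proof. by move=> gF gG; apply: iterintD => //; exact: in_box0. Qed.

Lemma boxintZ c F : box_good F -> boxint M (fun u => c * F u) = c * boxint M F.
Proof. by move=> gF; apply: iterintZ => //; exact: in_box0. Qed.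

Lemma eq_boxint F G : (forall u, in_box M u -> F u = G u) -> boxint M F = boxint M G.
Proof. by move=> FG; apply: eq_iterint => //; exact: in_box0. Qed.

Lemma boxintB F G : box_good F -> box_good G ->
  boxint M (fun u => F u - G u) = boxint M F - boxint M G.
Proof.
move=> gF gG; rewrite -mulN1r -boxintZ// -boxintD//.
  by apply: eq_boxint => u _; rewrite mulN1r.
by apply: goodM => //; exact: good_cst.
Qed.

Lemma le_boxint F G : box_good F -> box_good G ->
  (forall u, in_box M u -> F u <= G u) -> boxint M F <= boxint M G.
Proof. by move=> gF gG FG; apply: le_iterint => //; exact: in_box0. Qed.

Lemma boxint_ge0 F : (forall u, in_box M u -> 0 <= F u) -> 0 <= boxint M F.
Proof. by move=> F0; apply: iterint_ge0 => //; exact: in_box0. Qed.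

(** The box is carried to row vectors by [mxvec], where it is a product of segments, hence
    compact. *)
Lemma continuous_box_bounds F : continuous F -> (forall v, in_box M v -> 0 < F v) ->
  exists d K : R, 0 < d /\ forall v, in_box M v -> d <= F v <= K.
Proof.
move=> cF F0.
pose S := [set u : 'rV[R]_(2 * k) | forall i, `[0, M]%classic (u ord0 i)].
have cS : compact S.
  apply: (@rV_compact _ _ (fun=> `[0, M]%classic)) => _; exact: segment_compact.
have cV : continuous (fun u : 'rV[R]_(2 * k) => F (vec_mx u)).
  move=> u; apply: (@continuous_comp _ _ _ vec_mx F); last exact: cF.
  move=> P /nbhs_ballP[e e0 HP]; apply/nbhs_ballP; exists e => // w [_ Hw].
  by apply: HP; split=> // i j; rewrite !mxE; exact: Hw.
have S0 : S !=set0 by exists 0 => i /=; rewrite mxE in_itv/= lexx ltW.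
have cW : {within S, continuous (fun u : 'rV[R]_(2 * k) => F (vec_mx u))}.
  exact: continuous_subspaceT.
have [a aS Ha] := EVT_min_rV S0 cS cW; have [b bS Hb] := EVT_max_rV S0 cS cW.
have boxS v : in_box M v -> mxvec v \in S.
  move=> bv; rewrite inE /S /= => i; case/mxvec_indexP: i => i j.
  by rewrite mxvecE in_itv/=; exact: bv.
exists (F (vec_mx a)), (F (vec_mx b)); split.
  apply: F0 => i j; rewrite mxE; move: aS; rewrite inE /S /= => /(_ (mxvec_index i j)).
  by rewrite in_itv.
by move=> v /boxS vS; have := Ha _ vS; have := Hb _ vS; rewrite mxvecK => -> ->.
Qed.

Lemma Rintegral_itv_le (p q c : R) : p <= q -> 0 <= c ->
  Rintegral mu `[0, M] (fun a => if a < p then 0 else if q < a then 0 else c) <= c * (q - p).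
Proof.
move=> pq c0.
rewrite (_ : (fun a => _) = (cst c \_ `[p, q])); last first.
  apply/funext => a; rewrite patchE mem_setE in_itv/=.
  by case: (ltP a p) => //= _; case: (ltP q a).
rewrite -Rintegral_mkcondr Rintegral_cst//; last exact: measurableI.
apply: ler_wpM2l => //.
have le : (mu (`[0%R, M] `&` `[p, q]) <= (q - p)%:E)%E.
  apply: (@le_trans _ _ (mu `[p, q])).
    by apply: le_measure; rewrite ?inE//; exact: measurableI.
  rewrite lebesgue_measure_itv/= lte_fin; case: ifP => _; first by rewrite -EFinD.
  by rewrite lee_fin subr_ge0.
rewrite -lee_fin fineK// ge0_fin_numE//; exact: le_lt_trans le (ltry _).
Qed.

Lemma boxint_sum (I : Type) (s : seq I) (F : I -> V -> R) : (forall i, box_good (F i)) ->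
  boxint M (fun v => \sum_(i <- s) F i v) = \sum_(i <- s) boxint M (F i).
Proof.
move=> gF; elim: s => [|i s IH].
  rewrite big_nil -[RHS](mul0r (boxint M (fun _ : V => 1))) -boxintZ//; last exact: good_cst.
  by apply: eq_boxint => // v _; rewrite big_nil mul0r.
rewrite big_cons -IH -boxintD//; last exact: good_sum.
by apply: eq_boxint => // v _; rewrite big_cons.
Qed.

End BoxIntegral.

(** * Expected allocations and values *)

Section Win.
Variable R : realType.
Implicit Types (r s a b : R).

(** Winning probability of the first bidder for values [a] and [b] at r = m_2 / m_1: dividing both
    bids by m_1 leaves a comparison of [a] with [r * b]. *)
Definition win r a b : R := if r * b < a then 1 else if a == r * b then 2^-1 else 0.

Lemma win_ge0 r a b : 0 <= win r a b.
Proof. by rewrite /win; case: ifP => // _; case: ifP => // _; rewrite invr_ge0. Qed.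

Lemma win_le1 r a b : win r a b <= 1.
Proof. by rewrite /win; case: ifP => // _; case: ifP => // _; lra. Qed.

Lemma win_sign r a b : 0 <= (a - r * b) * win r a b.
Proof.
rewrite /win; case: ltP => [h|h]; first by rewrite mulr1 subr_ge0 ltW.
by case: eqP => [->|_]; rewrite ?mulr0// subrr mul0r.
Qed.

Lemma lose_sign r a b : 0 <= (r * b - a) * (1 - win r a b).
Proof.
rewrite /win; case: ltP => [h|h]; first by rewrite subrr mulr0.
by case: eqP => [->|_]; rewrite ?subr0 ?mulr1 ?subr_ge0// subrr mul0r.
Qed.

(** Raising the ratio from [r] to [s] affects only items with [r * b <= a <= s * b]. The two sign
    statements are the pointwise form of dA = r dB. *)
Lemma win_incr r s a b : r < s -> 0 <= b ->
  [/\ win s a b <= win r a b, 0 <= (win r a b - win s a b) * (a - r * b) &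
      0 <= (win r a b - win s a b) * (s * b - a)].
Proof.
move=> rs b0; have rsb : r * b <= s * b by rewrite ler_wpM2r// ltW.
rewrite /win; case: (ltgtP (r * b) a) => [h1|h1|h1]; case: (ltgtP (s * b) a) => [h2|h2|h2]; split; nra.
Qed.

End Win.

Section Market.
Variables (R : realType) (k : nat) (M : R) (f : 'M[R]_(2, k) -> R).
Hypothesis M0 : 0 < M.
Hypothesis cf : continuous f.
Hypothesis f0 : forall v, in_box M v -> 0 < f v.
Local Notation V := 'M[R]_(2, k).
Local Notation mu := (@lebesgue_measure R).
Local Notation i0 := (ord0 : 'I_2).
Local Notation i1 := (ord_max : 'I_2).
Implicit Types (g h : R -> R -> R) (v : V).

Lemma good_f : box_good M f.
Proof.
split; first exact: mxmeas_continuous.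
have [d [K [d0 H]]] := continuous_box_bounds M0 cf f0.
by exists K => v bv; have /andP[h1 h2] := H v bv; rewrite ger0_norm// (le_trans (ltW d0)).
Qed.

Definition pair_good g := forall j, box_good M (fun v : V => g (v i0 j) (v i1 j)).

Definition mean g := boxint M (fun v => (\sum_(j < k) g (v i0 j) (v i1 j)) * f v).

Let good_mean g : pair_good g -> box_good M (fun v => (\sum_(j < k) g (v i0 j) (v i1 j)) * f v).
Proof. by move=> gg; apply: goodM good_f; exact: good_sum. Qed.

Lemma meanD g h : pair_good g -> pair_good h ->
  mean (fun a b => g a b + h a b) = mean g + mean h.
Proof.
move=> gg gh; rewrite -boxintD//; try exact: good_mean.
by apply: eq_boxint => // v _; rewrite big_split/= mulrDl.
Qed.

Lemma meanZ c g : pair_good g -> mean (fun a b => c * g a b) = c * mean g.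
Proof.
move=> gg; rewrite -boxintZ//; last exact: good_mean.
by apply: eq_boxint => // v _; rewrite -mulr_sumr mulrA.
Qed.

Lemma meanB g h : pair_good g -> pair_good h ->
  mean (fun a b => g a b - h a b) = mean g - mean h.
Proof.
move=> gg gh; rewrite -boxintB//; try exact: good_mean.
by apply: eq_boxint => // v _; rewrite sumrB mulrBl.
Qed.

Lemma le_mean g h : pair_good g -> pair_good h ->
  (forall a b, 0 <= a <= M -> 0 <= b <= M -> g a b <= h a b) -> mean g <= mean h.
Proof.
move=> gg gh H; apply: le_boxint => //; try exact: good_mean.
move=> v bv; apply: ler_wpM2r; first exact/ltW/f0.
by apply: ler_sum => j _; apply: H; exact: bv.
Qed.

Lemma mean_ge0 g : (forall a b, 0 <= a <= M -> 0 <= b <= M -> 0 <= g a b) -> 0 <= mean g.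
Proof.
move=> H; apply: boxint_ge0 => // v bv; apply: mulr_ge0; last exact/ltW/f0.
by apply: sumr_ge0 => j _; apply: H; exact: bv.
Qed.

Lemma pair_goodM g h : pair_good g -> pair_good h -> pair_good (fun a b => g a b * h a b).
Proof. by move=> gg gh j; apply: goodM. Qed.

Lemma pair_goodD g h : pair_good g -> pair_good h -> pair_good (fun a b => g a b + h a b).
Proof. by move=> gg gh j; apply: goodD. Qed.

Lemma pair_good_cst c : pair_good (fun _ _ => c).
Proof. by move=> j; exact: good_cst. Qed.

Lemma pair_good_fst : pair_good (fun a _ => a).
Proof. by move=> j; exact: good_entry. Qed.

Lemma pair_good_snd : pair_good (fun _ b => b).
Proof. by move=> j; exact: good_entry. Qed.

Lemma pair_goodN g : pair_good g -> pair_good (fun a b => - g a b).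
Proof.
move=> gg j; rewrite (_ : (fun _ => _) = (fun v : V => -1 * g (v i0 j) (v i1 j))).
  by apply: goodM => //; exact: good_cst.
by apply/funext => v; rewrite mulN1r.
Qed.

Lemma pair_good_win r : pair_good (win r).
Proof.
move=> j; split; last first.
  by exists 1 => v _; rewrite ger0_norm ?win_ge0 ?win_le1.
have m1 : mxmeas (fun v : V => r * v i1 j).
  by apply: mxmeasM; [exact: mxmeas_cst | exact: mxmeas_entry].
have m0 : mxmeas (fun v : V => v i0 j) by exact: mxmeas_entry.
exact: (mxmeas_ltr m1 m0 (mxmeas_cst 1) (mxmeas_eqr m0 m1 (mxmeas_cst 2^-1) (mxmeas_cst 0))).
Qed.

(** [fA] and [fB] are the first and the second bidder's expected values on the items won by the
    first, [fD] and [fC] those on the items won by the second. A winner pays the rival's multiplier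
    times the rival's value. *)
Definition fA r := mean (fun a b => a * win r a b).
Definition fB r := mean (fun a b => b * win r a b).
Definition fC r := mean (fun a b => b * (1 - win r a b)).
Definition fD r := mean (fun a b => a * (1 - win r a b)).

Let gA r : pair_good (fun a b => a * win r a b).
Proof. by apply: pair_goodM; [exact: pair_good_fst | exact: pair_good_win]. Qed.

Let gB r : pair_good (fun a b => b * win r a b).
Proof. by apply: pair_goodM; [exact: pair_good_snd | exact: pair_good_win]. Qed.

Let g1w r : pair_good (fun a b => 1 - win r a b).
Proof. by apply: pair_goodD; [exact: pair_good_cst | apply: pair_goodN; exact: pair_good_win]. Qed.

Let gC r : pair_good (fun a b => b * (1 - win r a b)).
Proof. by apply: pair_goodM; [exact: pair_good_snd | exact: g1w]. Qed.

Let gD r : pair_good (fun a b => a * (1 - win r a b)).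
Proof. by apply: pair_goodM; [exact: pair_good_fst | exact: g1w]. Qed.

Lemma eq_mean g h : (forall a b, g a b = h a b) -> mean g = mean h.
Proof. by move=> gh; apply: eq_boxint => // v _; under eq_bigr do rewrite gh. Qed.

Lemma fAD r : fA r + fD r = mean (fun a _ => a).
Proof. by rewrite -meanD//; apply: eq_mean => a b; ring. Qed.

Lemma fBC r : fB r + fC r = mean (fun _ b => b).
Proof. by rewrite -meanD//; apply: eq_mean => a b; ring. Qed.

Lemma fB_ge0 r : 0 <= fB r.
Proof. by apply: mean_ge0 => a b _ /andP[b0 _]; rewrite mulr_ge0 ?win_ge0. Qed.

Lemma fC_ge0 r : 0 <= fC r.
Proof. by apply: mean_ge0 => a b _ /andP[b0 _]; rewrite mulr_ge0 ?subr_ge0 ?win_le1. Qed.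

Lemma rfB_le_fA r : r * fB r <= fA r.
Proof.
rewrite -meanZ//; apply: le_mean => //.
  by apply: pair_goodM => //; exact: pair_good_cst.
by move=> a b _ _; have := win_sign r a b; rewrite mulrBl mulrA subr_ge0.
Qed.

Lemma fD_le_rfC r : fD r <= r * fC r.
Proof.
rewrite -meanZ//; apply: le_mean => //.
  by apply: pair_goodM => //; exact: pair_good_cst.
by move=> a b _ _; have := lose_sign r a b; rewrite mulrBl mulrA subr_ge0.
Qed.

Lemma fA_incr r s : 0 < r -> r < s ->
  r * (fB r - fB s) <= fA r - fA s <= s * (fB r - fB s).
Proof.
move=> r0 rs; rewrite -!meanB// -!meanZ; last 2 first.
- by apply: pair_goodD => //; exact: pair_goodN.
- by apply: pair_goodD => //; exact: pair_goodN.
have gg c : pair_good (fun a b : R => c * (b * win r a b - b * win s a b)).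
  by apply: pair_goodM; [exact: pair_good_cst | apply: pair_goodD => //; exact: pair_goodN].
have gg' : pair_good (fun a b : R => a * win r a b - a * win s a b).
  by apply: pair_goodD => //; exact: pair_goodN.
apply/andP; split; apply: le_mean => // a b _ /andP[b0 _].
  have [_ h _] := win_incr a rs b0; rewrite -subr_ge0.
  by apply: le_trans h _; rewrite le_eqVlt; apply/orP; left; apply/eqP; ring.
have [_ _ h] := win_incr a rs b0; rewrite -subr_ge0.
by apply: le_trans h _; rewrite le_eqVlt; apply/orP; left; apply/eqP; ring.
Qed.

Lemma fB_decr r s : (0 < k)%N -> 0 < r -> r < s -> fB s < fB r.
Proof.
move=> k0 r0 rs; rewrite -subr_gt0 -meanB//.
have [d [K [d0 fd]]] := continuous_box_bounds M0 cf f0.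
pose j0 : 'I_k := Ordinal k0.
have s0 : 0 < s := lt_trans r0 rs.
(* a rectangle on which r b < a < s b *)
pose c := M / (1 + s).
have c0 : 0 < c by rewrite divr_gt0//; lra.
have cM : c * (1 + s) = M by rewrite divfK// gt_eqF//; lra.
(* Slopes strictly between [r] and [s]; [b1] is the midpoint of [p2 * c / s] and [c], so that
   [a <= a2] still gives [a < s * b] for [b >= b1]. *)
pose p1 := r + (s - r) / 3; pose p2 := r + 2 * (s - r) / 3.
pose a1 := p1 * c; pose a2 := p2 * c.
pose b1 := (p2 / s + 1) / 2 * c.
have p2s : p2 / s < 1 by rewrite ltr_pdivrMr// /p2; lra.
have p2s0 : 0 < p2 / s by rewrite divr_gt0// /p2; lra.
have b1c : b1 < c by rewrite /b1 gtr_pMl//; lra.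
have b10 : 0 < b1 by rewrite /b1 mulr_gt0//; lra.
have a12 : a1 < a2 by rewrite /a1 /a2 ltr_pM2r// /p1 /p2; lra.
have a10 : 0 < a1 by rewrite /a1 mulr_gt0// /p1; lra.
have ra1 : r * c < a1 by rewrite /a1 ltr_pM2r// /p1; lra.
have sa2 : a2 < s * b1.
  have -> : s * b1 = (p2 + s) / 2 * c by rewrite /b1; field; rewrite gt_eqF.
  by rewrite /a2 ltr_pM2r// /p2; lra.
have a2M : a2 < M.
  have : a2 < s * c by rewrite /a2 ltr_pM2r// /p2; lra.
  by rewrite -cM; nra.
have cM' : c < M by rewrite -cM ltr_pMr//; lra.
pose lo (p : 'I_2 * 'I_k) := if p == (i0, j0) then a1 else if p == (i1, j0) then b1 else 0.
pose hi (p : 'I_2 * 'I_k) := if p == (i0, j0) then a2 else if p == (i1, j0) then c else M.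
pose l := Num.min (a2 - a1) (Num.min (c - b1) M).
have l0 : 0 < l by rewrite !lt_min !subr_gt0 a12 b1c.
pose ps := enum [set: 'I_2 * 'I_k]%SET.
have gg : pair_good (fun a b : R => b * win r a b - b * win s a b).
  by apply: pair_goodD => //; exact: pair_goodN.
have nn a b : 0 <= b -> 0 <= b * win r a b - b * win s a b.
  by move=> b0; have [h _ _] := win_incr a rs b0; rewrite -mulrBr mulr_ge0// subr_ge0.
apply: (@lt_le_trans _ _ (b1 * d * l ^+ size ps)); first by apply: mulr_gt0; [exact: mulr_gt0 | exact: exprn_gt0].
apply: (iterint_ge_subbox M0 (lo := lo) (hi := hi)).
- exact: (good_mean gg).
- move=> u bu; apply: mulr_ge0; last exact/ltW/f0.
  by apply: sumr_ge0 => j _; apply: nn; have /andP[] := bu i1 j.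
- by rewrite mulr_ge0// ltW.
- exact: ltW.
- move=> p; rewrite /lo /hi; case: ifP => _; [|case: ifP => _]; split; try lra.
  + by rewrite /l ge_min lexx.
  + by rewrite /l !ge_min lexx orbT.
  + by rewrite /l subr0 !ge_min lexx !orbT.
- move=> u Hu.
  have bu : in_box M u.
    move=> i j; have := Hu (i, j); rewrite /lo /hi /=.
    by case: ifP => _; [|case: ifP => _] => /andP[h1 h2]; apply/andP; split; lra.
  have ua := Hu (i0, j0); rewrite /lo /hi eqxx /= in ua.
  have ub := Hu (i1, j0); rewrite /lo /hi eqxx /= in ub.
  rewrite (bigD1 j0)//= mulrDl -[leLHS]addr0 lerD//; last first.
    apply: mulr_ge0; last exact/ltW/f0.
    by apply: sumr_ge0 => j _; apply: nn; have /andP[] := bu i1 j.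
  have /andP[fd1 _] := fd u bu.
  have W1 : win r (u i0 j0) (u i1 j0) = 1.
    rewrite /win ifT//; have : r * u i1 j0 <= r * c by rewrite ler_pM2l//; lra.
    by lra.
  have W2 : win s (u i0 j0) (u i1 j0) = 0.
    have h : s * b1 <= s * u i1 j0 by rewrite ler_pM2l//; lra.
    rewrite /win ifF; last by apply/negbTE; rewrite -leNgt; lra.
    by rewrite ifF//; apply: lt_eqF; lra.
  by rewrite W1 W2 mulr1 mulr0 subr0 ler_pM//; [lra | lra | lra].
- exact: in_box0.
by move=> p; rewrite mem_enum inE.
Qed.

(** The two integrands differ only on the wedge [r * b <= a <= s * b], by at most [M * K]. Its
    slices have length at most [M * (s - r)] in [a] and [M * (s - r) / lo^2] in [b]. *)
Lemma fB_lip (lo hi : R) : 0 < lo -> exists2 L, 0 <= L &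
  forall r s, lo <= r -> r < s -> s <= hi -> fB r - fB s <= L * (s - r).
Proof.
move=> lo0.
have [d [K [d0 fd]]] := continuous_box_bounds M0 cf f0.
have K0 : 0 <= K.
  by have /andP[h1 h2] := fd 0 (in_box0 M0); rewrite (le_trans (ltW d0))// (le_trans h1).
pose n := (size (enum [set: 'I_2 * 'I_k]%SET)).-1.
(* The sum [1 + lo^-1 * lo^-1] covers both kinds of slices, so the order of integration is
   immaterial. *)
pose L := \sum_(j < k) (M * K * (M * (1 + lo^-1 * lo^-1)) * M ^+ n).
have li : 0 < lo^-1 by rewrite invr_gt0.
have ll : 0 <= 1 + lo^-1 * lo^-1 by rewrite addr_ge0// mulr_ge0// ltW.
have M0' := ltW M0.
exists L; first by apply: sumr_ge0 => j _; rewrite !mulr_ge0// exprn_ge0.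
move=> r s lr rs _.
have r0 : 0 < r := lt_le_trans lo0 lr.
have s0 : 0 < s := lt_trans r0 rs.
rewrite /fB -meanB//.
pose c := M * K; have c0 : 0 <= c by rewrite mulr_ge0.
pose h (a b : R) := if a < r * b then 0 else if s * b < a then 0 else c.
have gh j : box_good M (fun v : V => h (v i0 j) (v i1 j)).
  split; last first.
    by exists c => v _; rewrite /h; case: ifP => _; [|case: ifP => _]; rewrite ?normr0// ger0_norm.
  have mz z : mxmeas (fun v : V => z * v i1 j).
    by apply: mxmeasM; [exact: mxmeas_cst | exact: mxmeas_entry].
  have m0 : mxmeas (fun v : V => v i0 j) by exact: mxmeas_entry.
  exact: (mxmeas_ltr m0 (mz r) (mxmeas_cst 0) (mxmeas_ltr (mz s) m0 (mxmeas_cst 0) (mxmeas_cst c))).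
apply: (@le_trans _ _ (boxint M (fun v => \sum_(j < k) h (v i0 j) (v i1 j)))).
  apply: le_boxint => //.
  - apply: goodM; last exact: good_f.
    exact: good_sum (fun j => pair_goodD (gB r) (pair_goodN (gB s)) j).
  - exact: good_sum.
  move=> v bv; rewrite mulr_suml; apply: ler_sum => j _.
  have /andP[b0 bM] := bv i1 j; have /andP[_ fK] := fd v bv; have fv := ltW (f0 bv).
  have [w1 w2 w3] := win_incr (v i0 j) rs b0.
  have wr1 := win_le1 r (v i0 j) (v i1 j); have ws0 := win_ge0 s (v i0 j) (v i1 j).
  rewrite /h -mulrBr; case: ltP => h1; [|case: ltP => h2].
  - have -> : win r (v i0 j) (v i1 j) - win s (v i0 j) (v i1 j) = 0.
      apply/le_anti/andP; split; last by rewrite subr_ge0.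
      by rewrite -(nmulr_lge0 _ (_ : v i0 j - r * v i1 j < 0)) ?subr_lt0.
    by rewrite mulr0 mul0r.
  - have -> : win r (v i0 j) (v i1 j) - win s (v i0 j) (v i1 j) = 0.
      apply/le_anti/andP; split; last by rewrite subr_ge0.
      by rewrite -(nmulr_lge0 _ (_ : s * v i1 j - v i0 j < 0)) ?subr_lt0.
    by rewrite mulr0 mul0r.
  rewrite /c ler_pM ?mulr_ge0 ?subr_ge0//.
  by rewrite -[leRHS]mulr1 ler_pM ?subr_ge0//; lra.
rewrite boxint_sum// mulr_suml; apply: ler_sum => j _.
have -> : M * K * (M * (1 + lo^-1 * lo^-1)) * M ^+ n * (s - r) =
  c * (M * (1 + lo^-1 * lo^-1) * (s - r)) * M ^+ n by rewrite /c; ring.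
have sr0 : 0 <= s - r by lra.
apply: (@iterint_le_slices _ k _ M0 _ h (i0, j) (i1, j)) => //.
- move=> b /andP[b0 bM]; apply: le_trans (Rintegral_itv_le _ _ c0) _ => //.
    by rewrite ler_wpM2r// ltW.
  rewrite ler_wpM2l// -mulrBl mulrC ler_wpM2r//.
  by rewrite (le_trans bM)// ler_peMr// lerDl mulr_ge0// ltW.
- move=> a /andP[a0 aM].
  rewrite (_ : Rintegral _ _ _ = Rintegral mu `[0, M]
    (fun b => if b < a / s then 0 else if a / r < b then 0 else c)); last first.
    apply: eq_Rintegral => b _; rewrite /h ltr_pdivrMr// (mulrC b r) ltr_pdivlMr// (mulrC s b).
    by case: (a < r * b); case: (b * s < a).
  apply: le_trans (Rintegral_itv_le _ _ c0) _ => //.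
    by rewrite ler_wpM2l// lef_pV2 ?posrE// ltW.
  have -> : a / r - a / s = a * (r^-1 * s^-1) * (s - r).
    by field; rewrite !gt_eqF.
  rewrite ler_wpM2l// ler_wpM2r// ler_pM//.
    by rewrite mulr_ge0// invr_ge0 ltW.
  rewrite (@le_trans _ _ (lo^-1 * lo^-1))// ?lerDr//.
  by rewrite ler_pM ?invr_ge0 ?(ltW r0) ?(ltW s0)// lef_pV2 ?posrE// (le_trans lr)// ltW.
- by rewrite mem_enum inE.
- exact: in_box0.
Qed.

Lemma U0E (m : 'rV[R]_2) : 0 < m ord0 i0 -> 0 < m ord0 i1 ->
  U M f m i0 = fA (m ord0 i1 / m ord0 i0) - m ord0 i1 * fB (m ord0 i1 / m ord0 i0).
Proof.
move=> x0 y0; set r := _ / _; set y := m ord0 i1; set x := m ord0 i0.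
rewrite -(meanZ y (gB r)) -meanB//; last first.
  by apply: pair_goodM => //; exact: pair_good_cst.
apply: eq_boxint => // v _; congr (_ * _); apply: eq_bigr => j _.
rewrite /pay /alloc /bid /other eqxx -/x -/y.
have -> : (if y * v i1 j < x * v i0 j then 1 else if x * v i0 j == y * v i1 j then 2^-1 else 0)
    = win r (v i0 j) (v i1 j) :> R.
  rewrite /win /r -/x -/y mulrAC ltr_pdivrMr// (mulrC (v i0 j)); case: ifP => // _.
  by rewrite -[v i0 j == _](inj_eq (mulIf (lt0r_neq0 x0))) (divfK (lt0r_neq0 x0)) (mulrC (v i0 j)).
by ring.
Qed.

Lemma U1E (m : 'rV[R]_2) : 0 < m ord0 i0 -> 0 < m ord0 i1 ->
  U M f m i1 = fC (m ord0 i1 / m ord0 i0) - m ord0 i0 * fD (m ord0 i1 / m ord0 i0).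
Proof.
move=> x0 y0; set r := _ / _; set y := m ord0 i1; set x := m ord0 i0.
rewrite -(meanZ x (gD r)) -meanB//; last first.
  by apply: pair_goodM => //; exact: pair_good_cst.
apply: eq_boxint => // v _; congr (_ * _); apply: eq_bigr => j _.
rewrite /pay /alloc /bid /other /= -/x -/y.
have -> : (if x * v i0 j < y * v i1 j then 1 else if y * v i1 j == x * v i0 j then 2^-1 else 0)
    = 1 - win r (v i0 j) (v i1 j) :> R.
  rewrite /win /r -/x -/y mulrAC ltr_pdivrMr// (mulrC (v i0 j)).
  rewrite -[v i0 j == _](inj_eq (mulIf (lt0r_neq0 x0))) (divfK (lt0r_neq0 x0)) (mulrC (v i0 j)).
  case: (ltgtP (y * v i1 j) (x * v i0 j)) => h; rewrite ?subr0 ?subrr//.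
  by field.
by ring.
Qed.

End Market.

(** * From the planar system back to vectors of multipliers *)

Lemma rV2_cvg (R : realType) (m : R -> 'rV[R]_2) (xs ys : R) :
  m t ord0 ord0 @[t --> +oo] --> xs -> m t ord0 ord_max @[t --> +oo] --> ys ->
  m t @[t --> +oo] --> (\row_i (if i == ord0 then xs else ys) : 'rV[R]_2).
Proof.
move=> /cvgyP cx /cvgyP cy P /nbhs_ballP[e /= e0 HP].
have [T1 H1] := cx e e0; have [T2 H2] := cy e e0.
exists (Num.max T1 T2); split; first exact: num_real.
move=> t; rewrite gt_max => /andP[/ltW /H1 h1 /ltW /H2 h2].
apply: HP; split=> // i j; rewrite (ord1 i) mxE -ball_normE /ball_/= distrC.
case: j => [[|[|//]] jlt].
  by rewrite (_ : Ordinal jlt = ord0) ?eqxx//; exact: val_inj.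
by rewrite (_ : Ordinal jlt = ord_max) //; exact: val_inj.
Qed.

Lemma entry_deriv_at (R : realType) (n : nat) (m : R -> 'rV[R]_n) (t : R) (d : 'rV[R]_n) (i : 'I_n) :
  is_derive t (1 : R) m d -> deriv_at (fun s => m s ord0 i) t (d ord0 i).
Proof.
move=> [dm dE]; apply/deriv_atP; split; first exact: (derivable_mxP _ _ _).1.
by rewrite -dE derive_mx// mxE.
Qed.

Unset Implicit Arguments.
Set Strict Implicit.
Set Printing Implicit Defensive.

Theorem theorem2 (R : realType) (k : nat) (M : R) (f : 'M[R]_(2, k) -> R)
  (m : R -> 'rV[R]_2) :
  pos_C1_density M f ->
  (1 < m 0 ord0 ord0) -> (1 < m 0 ord0 ord_max) ->
  {within `[0, +oo[, continuous m} ->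
  (forall t : R, 0 < t -> is_derive t 1 m (Uvec M f (m t))) ->
  (exists B : R, forall t : R, 0 <= t -> `|m t| <= B) ->
  exists mstar : 'rV[R]_2,
    m t @[t --> +oo] --> mstar /\
    U M f mstar ord0 = 0 /\ U M f mstar ord_max = 0.
Proof.
move=> [M0 [[cf _] [f0 _]]] x0 y0 cm dm [K mK].
pose x (t : R) : R := m t ord0 ord0; pose y (t : R) : R := m t ord0 ord_max.
have dx t : 0 < t -> deriv_at x t (U M f (m t) ord0).
  by move=> t0; have := entry_deriv_at ord0 (dm t t0); rewrite mxE.
have dy t : 0 < t -> deriv_at y t (U M f (m t) ord_max).
  by move=> t0; have := entry_deriv_at ord_max (dm t t0); rewrite mxE.
have entry_le (u : 'rV[R]_2) i : `|u ord0 i| <= `|u|.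
  by rewrite [leRHS]/Num.Def.normr/= mx_normrE; exact: (le_bigmax _ _ (ord0, i)).
(* The equation is given at positive times only; continuity at 0 provides a positive starting time
   at which both multipliers still exceed 1. *)
have [t0 t00 [xt0 yt0]] : exists2 t0, 0 < t0 & 1 < x t0 /\ 1 < y t0.
  have e0 : 0 < Num.min (x 0 - 1) (y 0 - 1) by rewrite lt_min !subr_gt0 x0.
  have in0 : `[0, +oo[%classic (0 : R) by rewrite /= in_itv/= lexx.
  have := (subspace_continuousP _ _).1 cm 0 in0.
  move/cvgrPdist_lt => /(_ _ e0).
  rewrite near_withinE => -[d /= d0 Hd].
  exists (d / 2); first by rewrite divr_gt0.
  have : `|m 0 - m (d / 2)| < Num.min (x 0 - 1) (y 0 - 1).
    apply: Hd; last by rewrite /= in_itv/= andbT ltW// divr_gt0.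
    by rewrite /ball_/= sub0r normrN gtr0_norm; lra.
  rewrite lt_min => /andP[h1 h2]; split.
    have := le_lt_trans (entry_le _ ord0) h1; rewrite !mxE => /ltr_normlP[_].
    by rewrite -/(x 0) -/(x (d / 2)); lra.
  have := le_lt_trans (entry_le _ ord_max) h2; rewrite !mxE => /ltr_normlP[_].
  by rewrite -/(y 0) -/(y (d / 2)); lra.
have pos t : t0 <= t -> 0 < t by exact: lt_le_trans.
(* Without items [fB] vanishes and is not strictly decreasing, so this case is separate: the field
   is zero and the orbit constant. *)
have [k0|k0] := posnP k.
  have U0 mm i : U M f mm i = 0.
    rewrite /U -(mul0r (boxint M (fun _ : 'M[R]_(2, k) => 1))) -boxintZ//; last exact: good_cst.
    apply: eq_boxint => // v _; rewrite mul0r /utility big1 ?mul0r// => -[j jk].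
    by exfalso; move: jk; rewrite k0.
  have const (g : R -> R) t : (forall s, 0 < s -> deriv_at g s 0) -> t0 <= t -> g t = g t0.
    move=> dg; rewrite le_eqVlt => /predU1P[->//|tt].
    have [s /andP[/pos s0 _]|c _ /eqP] := deriv_at_mvt tt (df := fun=> 0) (f := g).
      exact: dg.
    by rewrite mul0r subr_eq0 => /eqP.
  exists (\row_i (if i == ord0 then x t0 else y t0)); split; last by rewrite !U0.
  apply: rV2_cvg; apply/cvgyP => e e0; exists t0 => t tt.
    by rewrite -/(x t) (const x)// ?subrr ?normr0// => s s0; rewrite -(U0 (m s) ord0); exact: dx.
  by rewrite -/(y t) (const y)// ?subrr ?normr0// => s s0; rewrite -(U0 (m s) ord_max); exact: dy.
have xK t : t0 <= t -> x t <= K.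
  move=> /pos /ltW /mK; apply: le_trans.
  exact: le_trans (ler_norm _) (entry_le _ _).
have yK t : t0 <= t -> y t <= K.
  move=> /pos /ltW /mK; apply: le_trans.
  exact: le_trans (ler_norm _) (entry_le _ _).
have [xs [ys [cx cy xs0 ys0 [E1 E2]]]] : exists xs ys : R,
  [/\ x t @[t --> +oo] --> xs, y t @[t --> +oo] --> ys, 0 < xs, 0 < ys &
    fA M f (ys / xs) - ys * fB M f (ys / xs) = 0 /\
    fC M f (ys / xs) - xs * fD M f (ys / xs) = 0].
  apply: (@planar_convergence R (fA M f) (fB M f) (fC M f) (fD M f)
    (mean M f (fun a _ => a)) (mean M f (fun _ b => b)) _ _ _ _ _ _ _ _ _ x y t0 K) => //.
  - by move=> z _; exact: fAD.
  - by move=> z _; exact: fBC.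
  - by move=> z u; exact: fA_incr.
  - by move=> z u; exact: fB_decr.
  - by move=> z _; exact: fB_ge0.
  - by move=> z _; exact: fC_ge0.
  - by move=> z _; exact: rfB_le_fA.
  - by move=> z _; exact: fD_le_rfC.
  - by move=> lo hi; exact: fB_lip.
  - by move=> t /pos /dx /deriv_at_cont.
  - by move=> t /pos /dy /deriv_at_cont.
  - by move=> t /pos /dx + xp yp; rewrite U0E.
  - by move=> t /pos /dy + xp yp; rewrite U1E.
exists (\row_i (if i == ord0 then xs else ys)); split; first exact: rV2_cvg.
by rewrite U0E ?U1E// !mxE.
Qed.
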